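(* Let $\mathcal{A}:f=0$ be an arrangement of $d$ lines in the complex projective plane $\mathbb{P}^2$, let $r=mdr(f)$, and assume $r\ge 1$. Then, for any choice of a nonzero syzygy $\rho_1\in AR(f)_r$, there is a homogeneous ideal $I\subset S$ and an exact sequence of graded $S$-modules $$0\to S(-r)\to AR(f)\to I(r-d+1)\to 0,$$ whose first map sends $1$ to $\rho_1$, such that the following hold. (1) The ideal $I$ is saturated, defines a subscheme of $\mathbb{P}^2$ of dimension at most $0$, and its degree is given by $\deg I=(d-1)^2-r(d-r-1)-\tau(\mathcal{A})$. (2) The line arrangement $\mathcal{A}$ is free if and only if $I=S$. (3) The line arrangement $\mathcal{A}$ is nearly free if and only if $I$ defines a reduced point $P(\mathcal{A})$ in $\mathbb{P}^2$. The exact sequence and the point $P(\mathcal{A})$ are unique when $2r<d$, i.e. when the exponents $(d_1,d_2)$ of the nearly free arrangement $\mathcal{A}$ satisfy $r=d_1<d_2=d-r$.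
   Context: A line arrangement $\mathcal{A}:f=0$ of $d$ lines is a finite set of $d$ distinct lines in $\mathbb{P}^2=\mathbb{P}^2(\mathbb{C})$, where $f\in S=\mathbb{C}[x,y,z]$ is the product of $d$ linear forms defining the lines. $AR(f)\subset S^3$ is the graded $S$-module whose degree $m$ component consists of the triples $(a,b,c)\in S_m^3$ with $af_x+bf_y+cf_z=0$, where $f_x,f_y,f_z$ are the partial derivatives. $mdr(f)$ is the smallest $m\ge0$ with $AR(f)_m\neq0$. Let $\tau(\mathcal{A})=\sum_{k\ge2}n_k(k-1)^2$ be the global Tjurina number, where $n_k$ is the number of points lying on exactly $k$ lines of $\mathcal{A}$. $\mathcal{A}$ is free if $AR(f)$ is a free graded $S$-module. With $r=mdr(f)$, $\mathcal{A}$ is nearly free if $\tau(\mathcal{A})=(d-1)^2-r(d-r-1)-1$; its exponents are then $(d_1,d_2)=(r,d-r)$, and $d_1\le d_2$. The degree $\deg I$ is the degree of the $0$-dimensional subscheme of $\mathbb{P}^2$ defined by $I$, i.e. $\dim S_m/I_m$ for $m\gg0$ (it is $0$ if the subscheme is empty). For a graded module $M$, $M(k)$ denotes the shift with $M(k)_m=M_{k+m}$. *)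

(* Defs.v *)
From HB Require Import structures.
From mathcomp Require Import all_boot all_order all_algebra.
From mathcomp Require Import finmap boolp classical_sets cardinality reals complex.
From mathcomp Require Import mpoly.

Set Implicit Arguments.
Unset Strict Implicit.
Unset Printing Implicit Defensive.

Import GRing.Theory.
Local Open Scope ring_scope.

(* A grading of an S-module M is given by its homogeneous components: [g m x]
   means that x lies in M_m.  Degrees are integers, to allow for shifts. *)
Definition grading (M : Type) := int -> M -> Prop.

Definition gshift (M : Type) (g : grading M) (k : int) : grading M :=
  fun m => g (k + m).

Section GradedModules.
Variable A : nzRingType.

Definition graded_map (M N : lmodType A) (gM : grading M) (gN : grading N)
    (h : {linear M -> N}) : Prop :=
  forall m x, gM m x -> gN m (h x).

(* 0 -> L -> M -> N -> 0 *)
Record graded_short_exact (L M N : lmodType A)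
    (gL : grading L) (gM : grading M) (gN : grading N)
    (phi : {linear L -> M}) (psi : {linear M -> N}) : Prop := GradedShortExact {
  gse_left : graded_map gL gM phi;
  gse_right : graded_map gM gN psi;
  gse_inj : injective phi;
  gse_exact : forall u, psi u = 0 <-> exists p, phi p = u;
  gse_surj : forall v, exists u, psi u = v }.

(* Existence of a finite homogeneous basis; over a Noetherian ring this is the
   general notion for submodules of A^3. *)
Definition graded_free (M : lmodType A) (gM : grading M) : Prop :=
  exists (n : nat) (e : 'I_n -> M),
    (forall j, exists m, gM m (e j)) /\
    (forall u, exists! a : {ffun 'I_n -> A}, u = \sum_j a j *: e j).

End GradedModules.

Section Plane.
Variable K : fieldType.

Local Notation S := {mpoly K[3]}.

Definition S_gr : grading S :=
  fun m p => match m with Posz n => p \is n.-homog | Negz _ => p = 0 end.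

Definition syzygies (f : S) : {pred 'rV[S]_3} :=
  [pred u : 'rV[S]_3 | \sum_(i < 3) u ord0 i * f^`M(i) == 0].

Lemma syzygies_submod_closed (f : S) : submod_closed (syzygies f).
Proof.
split=> [|a u v]; rewrite !inE.
  by rewrite big1 // => i _; rewrite mxE mul0r.
move=> /eqP hu /eqP hv; apply/eqP.
under eq_bigr => i _ do rewrite !mxE mulrDl -mulrA.
by rewrite big_split /= -mulr_sumr hu hv mulr0 addr0.
Qed.

HB.instance Definition _ (f : S) :=
  GRing.isSubmodClosed.Build S 'rV[S]_3 (syzygies f)
    (syzygies_submod_closed f).

Record AR (f : S) := ARSyzygy { AR_val : 'rV[S]_3; _ : AR_val \in syzygies f }.

HB.instance Definition _ (f : S) := [isSub for @AR_val f].
HB.instance Definition _ (f : S) := [Choice of AR f by <:].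
HB.instance Definition _ (f : S) := [SubChoice_isSubLmodule of AR f by <:].

Definition AR_gr (f : S) : grading (AR f) :=
  fun m u => forall i, S_gr m (val u ord0 i).

Definition is_mdr (f : S) (r : nat) : Prop :=
  (exists2 u : AR f, AR_gr r%:Z u & u != 0) /\
  (forall m : nat, (m < r)%N -> forall u : AR f, AR_gr m%:Z u -> u = 0).

(* Ideals of S are the S-submodules of S^o; unlike the library's [idealr] they
   need not be proper. *)
Record ideal_mod (I : submodClosed S^o) :=
  IdealMod { ideal_val : S^o; _ : ideal_val \in I }.

HB.instance Definition _ (I : submodClosed S^o) := [isSub for @ideal_val I].
HB.instance Definition _ (I : submodClosed S^o) := [Choice of ideal_mod I by <:].
HB.instance Definition _ (I : submodClosed S^o) :=
  [SubChoice_isSubLmodule of ideal_mod I by <:].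

Definition ideal_gr (I : submodClosed S^o) : grading (ideal_mod I) :=
  fun m x => S_gr m (val x).

Definition homogeneous (I : {pred S}) : Prop :=
  forall p : S, p \in I -> forall m : nat, pihomog mdeg m p \in I.

(* The elements p such that (x, y, z)^N p is contained in I for some N. *)
Definition saturation (I : {pred S}) (p : S) : Prop :=
  exists N : nat, forall m : 'X_{1..3}, mdeg m = N -> 'X_[m] * p \in I.

Definition saturated (I : {pred S}) : Prop :=
  forall p : S, saturation I p -> p \in I.

(* The points of Proj (S / I). *)
Definition relevant_prime_over (I : {pred S}) (P : prime_idealr S) : Prop :=
  [/\ homogeneous P, exists i : 'I_3, 'X_i \notin P & {subset I <= P}].

(* Proj (S / I) has Krull dimension at most n (it may be empty). *)
Definition proj_dim_le (I : {pred S}) (n : nat) : Prop :=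
  forall (k : nat) (P : nat -> prime_idealr S),
    (forall i, (i <= k)%N -> relevant_prime_over I (P i)) ->
    (forall i, (i < k)%N ->
       {subset P i <= P i.+1} /\ exists2 p, p \in P i.+1 & p \notin P i) ->
    (k <= n)%N.

Lemma ideal_comp_exists (I : submodClosed S^o) (m : nat) :
  exists U : {vspace dhomog 3 K m},
    forall p, (p \in U) = (mpoly_of_dhomog p \in I).
Proof.
pose sub (U : {vspace dhomog 3 K m}) :=
  forall p, p \in U -> mpoly_of_dhomog p \in I.
have ZI (c : K) (p : S) : p \in I -> c *: p \in I.
  by move=> pI; rewrite -mul_mpolyC; exact: (@rpredZ _ S^o I c%:MP p pI).
have sub0 : sub 0%VS.
  by move=> p; rewrite memv0 => /eqP ->; rewrite raddf0; exact: (rpred0 I).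
pose D k := `[< exists2 U, sub U & \dim U = k >].
have exD : exists k, D k.
  by exists (\dim (0%VS : {vspace dhomog 3 K m})); apply/asboolP; exists 0%VS.
have bD k : D k -> (k <= \dim {:dhomog 3 K m})%N.
  by move=> /asboolP[U _ <-]; exact/dimvS/subvf.
case: (ex_maxnP exD bD) => k /asboolP[U sU dU] maxk.
exists U => p; apply/idP/idP => [/sU //|pI].
have sUp : sub (U + <[p]>)%VS.
  move=> q /memv_addP[u uU [v /vlineP[c ->] ->]].
  by apply: (@rpredD _ I (mpoly_of_dhomog u)); [exact: sU | exact: ZI].
have : (\dim (U + <[p]>) <= k)%N by apply: maxk; apply/asboolP; exists (U + <[p]>)%VS.
rewrite -dU => le; have /eqP -> : U == (U + <[p]>)%VS.
  by rewrite eqEdim addvSl.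
by rewrite memvE addvSr.
Qed.

Definition ideal_comp (I : submodClosed S^o) (m : nat) :
    {vspace dhomog 3 K m} :=
  sval (cid (ideal_comp_exists I m)).

Definition hilbert_fun (I : submodClosed S^o) (m : nat) : nat :=
  (\dim {:dhomog 3 K m} - \dim (ideal_comp I m))%N.

Definition is_degree (I : submodClosed S^o) (e : nat) : Prop :=
  exists N : nat, forall m : nat, (N <= m)%N -> hilbert_fun I m = e.

(* Points of the projective plane: lines through 0 in K^3. *)
Definition point := {P : {vspace 'rV[K]_3} | \dim P == 1%N}.

Definition vanishes_at (p : S) (P : point) : Prop :=
  forall v : 'rV[K]_3, v \in val P -> p.@[v ord0] = 0.

Definition zero_locus (p : S) : set point := [set P | vanishes_at p P]%classic.

(* The subscheme defined by I is the point P with its reduced structure.  A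
   closed subscheme is determined by the saturation of a defining ideal. *)
Definition defines_reduced_point (I : {pred S}) (P : point) : Prop :=
  forall p : S, saturation I p <-> vanishes_at p P.

Definition line_arrangement (d : nat) (l : 'I_d -> S) : Prop :=
  (forall i, l i \is 1.-homog /\ l i != 0) /\
  injective (fun i => zero_locus (l i)).

Definition arr_poly (d : nat) (l : 'I_d -> S) : S := \prod_(i < d) l i.

Definition mult_points (d : nat) (l : 'I_d -> S) (k : nat) : set point :=
  [set P | #|[set i : 'I_d | `[< vanishes_at (l i) P >]]%SET| = k]%classic.

(* n_k; [fset_set] gives the empty set on infinite sets, but [mult_points l k]
   is finite for k >= 2, the only values used. *)
Definition npoints (d : nat) (l : 'I_d -> S) (k : nat) : nat :=
  #|` fset_set (mult_points l k)|%fset.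

Definition tjurina (d : nat) (l : 'I_d -> S) : nat :=
  (\sum_(2 <= k < d.+1) npoints l k * k.-1 ^ 2)%N.

Definition free_arrangement (d : nat) (l : 'I_d -> S) : Prop :=
  graded_free (@AR_gr (arr_poly l)).

Definition nearly_free (d : nat) (l : 'I_d -> S) : Prop :=
  exists2 r : nat, is_mdr (arr_poly l) r &
    (tjurina l)%:Z
      = (d%:Z - 1) ^+ 2 - r%:Z * (d%:Z - r%:Z - 1) - 1.

(* 0 -> S(-r) -> AR(f) -> I(r-d+1) -> 0, with 1 mapped to rho *)
Definition syzygy_sequence (f : S) (d r : nat) (rho : AR f)
    (I : submodClosed S^o)
    (phi : {linear S^o -> AR f}) (psi : {linear AR f -> ideal_mod I}) : Prop :=
  phi 1 = rho /\
  graded_short_exact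
    (gshift (S_gr : grading S^o) (- r%:Z))
    (@AR_gr f)
    (gshift (@ideal_gr I) (r%:Z - d%:Z + 1)) phi psi.

End Plane.

(* Main.v *)
(* Let E be the Euler field.  For u in AR(f) the determinant det(E, rho1, u)
   vanishes on every line, hence equals psi(u) f for some psi(u) in S, and I is
   the image of psi.  Since AR(f) is orthogonal to the gradient of f, psi(u) = 0
   makes u parallel to rho1, and then u is in S rho1 because S is factorial and
   rho1 has minimal degree.  I is saturated by a chase in the Koszul complex.

   For deg I one computes the Hilbert function of the module D(A) of logarithmic
   derivations, adding one line H at a time: restriction to H maps D(A) to the
   logarithmic derivations of the h points cut out on H by the other lines, with
   kernel D(A \ H)(-1), and it is surjective in large degrees.  Hence
   dim D(A)_(m+d) = 3 C(m+2,2) + 2d(m+2) + tau for m >> 0, where tau increases by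
   2(d-1) - h when the d-th line is added, as the Tjurina number does.  The
   determinant gives dim D(A)_m = dim S_(m-1) + dim S_(m-r) + dim I_(m+r-d+1).

   If AR(f) is free, then rho1 is part of a basis and I is principal, so I = S
   as deg I is finite.  A saturated ideal of degree 1 is the ideal of a point. *)
From HB Require Import structures.
From mathcomp Require Import all_boot all_order all_algebra.
From mathcomp Require Import finmap boolp classical_sets cardinality.
From mathcomp Require Import reals complex mpoly ring zify.
Require Import Defs.

Set Implicit Arguments.
Unset Strict Implicit.
Unset Printing Implicit Defensive.

Import GRing.Theory.
Local Open Scope ring_scope.

(** * Dimension of subspaces given by predicates *)

(** Lines are handled as coefficient vectors: a nonzero cross product of two of them means that the
    lines differ, and it is then their common point. The delicate step is surjectivity in large
    degrees when a line [H] is added. A constant vector [z] on [H], multiplied by the forms of the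
    other lines missing [z], is logarithmic for all lines; for varying [z] these give polynomials on
    [H] whose gcd vanishes, simply, exactly at the points cut out by the other lines. A Bezout
    argument with control of sizes then shows that every multiple of the gcd within the size bound
    is reached in large degrees. Splitting off the multiples of the Euler field from D(A) uses that
    [d] is invertible. For uniqueness, 2r < d makes det(E, rho1, rho1') / f a constant for a second
    minimal syzygy rho1'; a constant in the ideal of a point is zero, so the two syzygies are
    proportional. Since the ideal of a point contains two coprime linear forms, two projections with
    the same kernel differ by a scalar. *)

Section Dimension.
Variable K : fieldType.

Definition independent (V : lmodType K) n (b : 'I_n -> V) :=
  forall c : 'I_n -> K, \sum_i c i *: b i = 0 -> forall i, c i = 0.

(** The graded pieces lie in infinite-dimensional spaces of polynomials or triples, so a dimension
    is attached to a predicate; the first two clauses make [P] exactly the span of [b]. *)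
Definition has_dim (V : lmodType K) (P : V -> Prop) (n : nat) :=
  exists b : 'I_n -> V, [/\ forall c : 'I_n -> K, P (\sum_i c i *: b i),
    forall v, P v -> exists c : 'I_n -> K, v = \sum_i c i *: b i
    & independent b].

Lemma linear_sumZ (V W : lmodType K) (f : V -> W) n (c : 'I_n -> K)
    (b : 'I_n -> V) :
  linear f -> f (\sum_i c i *: b i) = \sum_i c i *: f (b i).
Proof.
move=> lf; have f0 : f 0 = 0.
  by have := lf (-1) 0 0; rewrite scaleN1r oppr0 add0r scaleN1r addNr.
elim: n c b => [|n IHn] c b; first by rewrite !big_ord0.
by rewrite !big_ord_recl lf IHn.
Qed.

Lemma linearB_fun (V W : lmodType K) (f : V -> W) u v :
  linear f -> f (u - v) = f u - f v.
Proof. by move=> lf; rewrite addrC -scaleN1r lf scaleN1r addrC. Qed.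

Lemma eq_has_dim (V : lmodType K) (P Q : V -> Prop) n :
  (forall v, P v <-> Q v) -> has_dim P n -> has_dim Q n.
Proof.
move=> PQ [b [bP Pb ib]]; exists b; split=> // [c|v /PQ/Pb //].
exact/PQ/bP.
Qed.

(** In coordinates over a basis of [P], the [b i] are the rows of an [m] by [n] matrix whose rank is
    [m], since a relation between its rows is one between the [b i]. *)
Lemma independent_leq (V : lmodType K) (P : V -> Prop) m n (b : 'I_m -> V) :
  (forall i, P (b i)) -> independent b -> has_dim P n -> (m <= n)%N.
Proof.
move=> bP ib [e [_ Pe _]].
have /choice[M ME] : forall i, exists c : 'I_n -> K, b i = \sum_j c j *: e j.
  by move=> i; exact: Pe.
pose A := \matrix_(i, j) M i j.
suff /eqP <- : row_free A by exact: rank_leq_col.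
apply: inj_row_free => v vA0; apply/rowP => i; rewrite mxE.
apply: (ib (fun i => v ord0 i)).
under eq_bigr => j _ do rewrite ME scaler_sumr.
rewrite exchange_big big1 // => j _ /=.
under eq_bigr => k _ do rewrite scalerA.
rewrite -scaler_suml; have /rowP/(_ j) := vA0; rewrite !mxE => v0.
rewrite (_ : \sum_i0 _ = 0) ?scale0r // -[RHS]v0.
by apply: eq_bigr => k _; rewrite !mxE.
Qed.

Lemma has_dim_leq (V : lmodType K) (P Q : V -> Prop) m n :
  (forall v, P v -> Q v) -> has_dim P m -> has_dim Q n -> (m <= n)%N.
Proof.
move=> PQ [b [bP Pb ib]]; apply: independent_leq ib => i; apply: PQ.
have := bP (fun j => (j == i)%:R); rewrite (bigD1 i) //= eqxx scale1r big1 ?addr0 //.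
by move=> j /negPf ->; rewrite scale0r.
Qed.

Lemma has_dim_uniq (V : lmodType K) (P : V -> Prop) m n :
  has_dim P m -> has_dim P n -> m = n.
Proof.
move=> Pm Pn; apply/eqP; rewrite eqn_leq.
by apply/andP; split; [apply: has_dim_leq Pm Pn | apply: has_dim_leq Pn Pm].
Qed.

(** Rank-nullity: a basis of the kernel and lifts [g] of a basis of the image together span [P];
    applying [f] to a relation shows first that the coefficients of the lifts vanish. *)
Lemma has_dim_exact (V W : lmodType K) (f : V -> W) (P : V -> Prop)
    (Q : W -> Prop) k n :
  linear f ->
  has_dim (fun v => P v /\ f v = 0) k -> has_dim Q n ->
  (forall u v, P u -> P v -> P (u + v)) ->
  (forall (c : K) v, P v -> P (c *: v)) ->
  (forall v, P v -> Q (f v)) ->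
  (forall w, Q w -> exists2 v, P v & f v = w) ->
  has_dim P (k + n).
Proof.
move=> lf [b [bP Pb ib]] [e [eQ Qe ie]] PD PZ PQ QP.
have /choice[g gP] : forall i, exists v, P v /\ f v = e i.
  move=> i.
  have [|v Pv fv] := QP (e i); last by exists v.
  have := eQ (fun j => (j == i)%:R); rewrite (bigD1 i) //= eqxx scale1r big1 ?addr0 //.
  by move=> j /negPf ->; rewrite scale0r.
have P0 : P 0.
  have := bP (fun=> 0); rewrite big1 // => [[]// |i _].
  by rewrite scale0r.
have Pg (c : 'I_n -> K) : P (\sum_i c i *: g i).
  by elim/big_ind: _ => // i _; apply/PZ/(gP i).1.
have fg (c : 'I_n -> K) : f (\sum_i c i *: g i) = \sum_i c i *: e i.
  by rewrite linear_sumZ //; apply: eq_bigr => i _; rewrite (gP i).2.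
exists (fun i => match split i with inl j => b j | inr j => g j end).
have splitE (c : 'I_(k + n) -> K) :
    \sum_i c i *: (match split i with inl j => b j | inr j => g j end)
    = \sum_i c (lshift n i) *: b i + \sum_i c (rshift k i) *: g i.
  rewrite big_split_ord; congr (_ + _); apply: eq_bigr => i _.
    by rewrite (unsplitK (inl i)).
  by rewrite (unsplitK (inr i)).
split.
- by move=> c; rewrite splitE; apply: PD => //; case: (bP (fun i => c (lshift n i))).
- move=> v Pv; have [c fv] := Qe _ (PQ _ Pv).
  have [|d vE] := Pb (v - \sum_i c i *: g i).
    split; first by apply: PD => //; rewrite -scaleN1r; exact: PZ.
    by rewrite linearB_fun // fg fv subrr.
  exists (fun i => match split i with inl j => d j | inr j => c j end).
  rewrite splitE; rewrite -[LHS](subrK (\sum_i c i *: g i)) vE.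
  congr (_ + _); apply: eq_bigr => i _.
    by rewrite (unsplitK (inl i)).
  by rewrite (unsplitK (inr i)).
- move=> c; rewrite splitE => c0.
  have cr : forall i, c (rshift k i) = 0.
    apply: (ie (fun i => c (rshift k i))).
    rewrite -(fg (fun i => c (rshift k i))).
    have [_ fb] := bP (fun i => c (lshift n i)).
    have : f (1 *: (\sum_i c (lshift n i) *: b i) + \sum_i c (rshift k i) *: g i) = 0.
      by rewrite scale1r c0 -(subrr 0) linearB_fun // subrr.
    by rewrite lf fb scaler0 add0r.
  move=> i; rewrite -(splitK i); case: (split i) => j //=.
  apply: (ib (fun i => c (lshift n i))).
  by move: c0; rewrite [X in _ + X]big1 ?addr0 // => l _; rewrite cr scale0r.
Qed.

Lemma has_dim_inj (V W : lmodType K) (f : V -> W) (P : V -> Prop)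
    (Q : W -> Prop) n :
  linear f -> (forall v, P v -> f v = 0 -> v = 0) ->
  (forall w, Q w <-> exists2 v, P v & w = f v) -> has_dim P n -> has_dim Q n.
Proof.
move=> lf injf QP [b [bP Pb ib]]; exists (fun i => f (b i)); split.
- by move=> c; rewrite -linear_sumZ //; apply/QP; exists (\sum_i c i *: b i).
- by move=> w /QP[v /Pb[c ->] ->]; exists c; rewrite linear_sumZ.
- by move=> c; rewrite -linear_sumZ // => /injf c0; apply: ib; exact: c0.
Qed.

Lemma has_dim_zero (V : lmodType K) : has_dim (fun v : V => v = 0) 0.
Proof.
exists (fun=> 0); split=> [c|v ->|c _ []//]; first by rewrite big_ord0.
by exists (fun=> 0); rewrite big_ord0.
Qed.

End Dimension.

(** * Unique factorization in polynomial rings *)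

Section UniqueFactorization.

Definition divides (R : comPzRingType) (a b : R) := exists c, b = c * a.

Lemma divides_mull (R : comPzRingType) (a b c : R) :
  divides a b -> divides a (c * b).
Proof. by move=> [d ->]; exists (c * d); rewrite mulrA. Qed.

Lemma divides_add (R : comPzRingType) (a b c : R) :
  divides a b -> divides a c -> divides a (b + c).
Proof. by move=> [d ->] [e ->]; exists (d + e); rewrite mulrDl. Qed.

Definition prime_elt (R : idomainType) (p : R) :=
  [/\ p != 0, p \isn't a GRing.unit &
      forall a b, divides p (a * b) -> divides p a \/ divides p b].

(** The factors are asked to be prime, not only irreducible, so uniqueness of the factorization is
    built in. *)
Definition ufd (R : idomainType) := forall a : R, a != 0 ->
  exists u s, [/\ u \is a GRing.unit, forall p, p \in s -> prime_elt p
                & a = u * \prod_(p <- s) p].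

Lemma prime_dvd_unit (R : idomainType) (p u : R) :
  prime_elt p -> u \is a GRing.unit -> ~ divides p u.
Proof.
move=> [_ pU _] uU [c uE]; move: uU; rewrite uE unitrM.
by rewrite (negPf pU) andbF.
Qed.

Lemma prime_dvd_prod (R : idomainType) (p : R) (s : seq R) :
  prime_elt p -> divides p (\prod_(q <- s) q) -> exists2 q, q \in s & divides p q.
Proof.
move=> pp; elim: s => [|q s IHs].
  by rewrite big_nil => /(prime_dvd_unit pp (unitr1 R)).
rewrite big_cons; case: pp => _ _ pp /pp[pq|/IHs[r rs pr]].
  by exists q; rewrite ?mem_head.
by exists r; rewrite ?inE ?rs ?orbT.
Qed.

Lemma prime_dvd_prime (R : idomainType) (p q : R) :
  prime_elt p -> prime_elt q -> divides p q ->
  exists2 e, e \is a GRing.unit & q = e * p.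
Proof.
move=> [p0 pU pp] [q0 qU qq] [e qE]; exists e => //.
have [[c eE]|[c pE]] := qq e p (ex_intro _ 1 (etrans (esym qE) (esym (mul1r q)))).
  have : q * (c * p) = q * 1 by rewrite mulr1 [RHS]qE eE mulrAC mulrC.
  move/(mulfI q0) => cp; case/negP: pU; apply/unitrP; exists c.
  by rewrite cp mulrC cp.
have : q * (e * c) = q * 1 by rewrite mulr1 [RHS]qE pE mulrA mulrC.
by move/(mulfI q0) => ec; apply/unitrP; exists c; rewrite ec mulrC ec.
Qed.

Section Poly.
Variable R : idomainType.
Implicit Types A B C : {poly R}.

Lemma dividesCP (p : R) A : divides p%:P A <-> forall i, divides p A`_i.
Proof.
split=> [[c ->] i|/choice[c cE]]; first by rewrite coefMC; exists c`_i.
exists (\poly_(i < size A) c i); apply/polyP => i.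
by rewrite coefMC coef_poly; case: ltnP => [_|/(nth_default 0) ->]; rewrite ?mul0r.
Qed.

Lemma prime_polyC (p : R) : prime_elt p -> prime_elt p%:P.
Proof.
move=> [p0 pU pp]; split; first by rewrite polyC_eq0.
  by rewrite poly_unitE coefC eqxx (negPf pU) andbF.
move=> A B; move: {2}(size A + size B)%N (leqnn (size A + size B)) => n.
elim: n A B => [|n IHn] A B.
  rewrite leqn0 addn_eq0 size_poly_eq0 => /andP[/eqP -> _] _.
  by left; exists 0; rewrite mul0r.
have drop C : C != 0 ->
    (size (C - (lead_coef C)%:P * 'X^((size C).-1))%R < size C)%N.
  move=> C0; rewrite -[X in (_ < X)%N](prednK (n := size C)) ?size_poly_gt0 // ltnS.
  apply/leq_sizeP => j; rewrite leq_eqVlt => /predU1P[<-|lt].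
    by rewrite coefB coefCM coefXn eqxx mulr1 subrr.
  rewrite coefB coefCM coefXn gtn_eqF // mulr0 subr0 nth_default //.
  by rewrite -(prednK (n := size C)) ?size_poly_gt0.
have [->|A0] := eqVneq A 0; first by left; exists 0; rewrite mul0r.
have [->|B0] := eqVneq B 0; first by right; exists 0; rewrite mul0r.
move=> sAB dAB.
have : divides p (lead_coef A * lead_coef B).
  rewrite -lead_coefM lead_coefE.
  by move/dividesCP: dAB; exact.
case/pp=> [[c cE]|[c cE]].
- have dl : divides p%:P ((lead_coef A)%:P * 'X^((size A).-1)).
    by exists (c%:P * 'X^((size A).-1)); rewrite cE polyCM mulrAC.
  have := IHn (A - (lead_coef A)%:P * 'X^((size A).-1)) B.
  case=> [||dA|]; last by right.
  + by rewrite -ltnS; apply: leq_trans sAB; rewrite ltn_add2r; exact: drop.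
  + rewrite mulrBl; apply: divides_add => //; rewrite -mulNr mulrC.
    by apply: divides_mull; rewrite -mulN1r; apply: divides_mull.
  + by left; rewrite -(subrK ((lead_coef A)%:P * 'X^((size A).-1)) A); apply: divides_add.
- have dl : divides p%:P ((lead_coef B)%:P * 'X^((size B).-1)).
    by exists (c%:P * 'X^((size B).-1)); rewrite cE polyCM mulrAC.
  have := IHn A (B - (lead_coef B)%:P * 'X^((size B).-1)).
  case=> [|||dB]; last 2 first.
  + by left.
  + by right; rewrite -(subrK ((lead_coef B)%:P * 'X^((size B).-1)) B); apply: divides_add.
  + by rewrite -ltnS; apply: leq_trans sAB; rewrite ltn_add2l; exact: drop.
  + rewrite mulrBr; apply: divides_add => //; rewrite -mulrN.
    by apply: divides_mull; rewrite -mulN1r; apply: divides_mull.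
Qed.

Definition primitive A := forall p : R, prime_elt p -> ~ divides p%:P A.

Hypothesis ufdR : ufd R.

(** A prime constant dividing [A] divides its leading coefficient, so the number of prime factors of
    the latter bounds how often one can be taken out. *)
Lemma primitive_part A : A != 0 ->
  exists c B, [/\ c != 0, primitive B & A = c%:P * B].
Proof.
move=> A0; have lA0 : lead_coef A != 0 by rewrite lead_coef_eq0.
have [u [s [uU sP lE]]] := ufdR lA0.
move: {2}(size s) (erefl (size s)) => n.
elim: n u s A A0 {lA0} uU sP lE => [|n IHn] u s A A0 uU sP lE sz.
all: have [pA|npA] := pselect (primitive A);
  first by exists 1, A; rewrite oner_eq0 mul1r.
- case: npA => p pp /dividesCP dA; apply: (prime_dvd_unit pp uU).
  by have := dA (size A).-1; rewrite -lead_coefE lE (size0nil sz) big_nil mulr1.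
- have [p pp [B AE]] : exists2 p, prime_elt p & divides p%:P A.
    by apply: contrapT => np; apply: npA => p pp dA; apply: np; exists p.
  have [q qs dpq] : exists2 q, q \in s & divides p q.
    apply: prime_dvd_prod => //.
    case: (pp) => _ _ ppp; have [] := ppp u (\prod_(q <- s) q) => //.
      rewrite -lE AE lead_coefM lead_coefC.
      by exists (lead_coef B).
    by move/(prime_dvd_unit pp uU).
  have [e eU qE] := prime_dvd_prime pp (sP _ qs) dpq.
  have B0 : B != 0 by apply: contraNneq A0 => B0; rewrite AE B0 mul0r.
  have p0 : p != 0 by case: pp.
  have [||||c [C [c0 pC BE]]] := IHn (u * e) (rem q s) B B0.
  + by rewrite unitrM uU.
  + by move=> x /mem_rem; exact: sP.
  + apply: (mulIf p0).
    have : lead_coef B * p = lead_coef A by rewrite AE lead_coefM lead_coefC.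
    move=> ->; rewrite lE (big_rem q) //= qE; ring.
  + by rewrite size_rem // sz.
  + exists (p * c), C; rewrite mulf_neq0 //; split=> //.
    by rewrite AE BE polyCM; ring.
Qed.

(** Each prime factor of [c] stays prime in [{poly R}] and does not divide the primitive [A], so it
    divides the cofactor of [A] and cancels. *)
Lemma primitive_divides A B (c : R) :
  primitive A -> c != 0 -> divides A (c%:P * B) -> divides A B.
Proof.
move=> pA c0; have [u [s [uU sP ->]]] := ufdR c0.
elim: s B sP => [|p s IHs] B sP.
  rewrite big_nil mulr1 => -[D DE]; exists ((u^-1)%:P * D).
  by rewrite -mulrA -DE mulrA -polyCM mulVr // mul1r.
rewrite big_cons => -[D DE]; apply: IHs.
  by move=> q qs; apply: sP; rewrite inE qs orbT.
have pp : prime_elt p by apply: sP; rewrite mem_head.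
have [_ _ pP] := prime_polyC pp.
have [[E EE]|/(pA _ pp)//] : divides p%:P D \/ divides p%:P A.
  apply: pP; rewrite -DE; exists ((u * \prod_(j <- s) j)%:P * B).
  by rewrite mulrCA mulrC !polyCM; ring.
exists E; have p0 : p%:P != 0 :> {poly R} by rewrite polyC_eq0; case: pp.
apply: (mulIf p0); move: DE; rewrite EE !polyCM => DE.
transitivity (u%:P * (p%:P * (\prod_(j <- s) j)%:P) * B); first by ring.
by rewrite DE; ring.
Qed.

(** The gcd is taken over the fraction field: either [A] is coprime to [B], or the primitive part of
    their gcd is a nonconstant factor of [A], hence [A] up to a constant. *)
Lemma primitive_irreducible_prime A : primitive A -> (1 < size A)%N ->
  (forall B C, A = B * C -> (size B <= 1)%N \/ (size C <= 1)%N) -> prime_elt A.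
Proof.
move=> pA sA irrA; have A0 : A != 0 by rewrite -size_poly_gt0 ltnW.
split=> //; first by rewrite poly_unitE gtn_eqF.
(* Over a domain [%|] is divisibility up to a nonzero constant; primitivity of [A] removes the
   constant. *)
have dvdpA C : A %| C -> divides A C.
  by case/Pdiv.WeakIdomain.dvdpP=> -[c q] /= c0 E;
    apply: primitive_divides pA c0 _; exists q; rewrite mul_polyC.
move=> B C [D BCE].
have dA : A %| B * C by rewrite BCE dvdp_mull.
have [cAB|ncAB] := boolP (coprimep A B).
  by right; apply: dvdpA; rewrite -(Gauss_dvdpr _ cAB).
left; apply: dvdpA; set G := gcdp A B.
have G0 : G != 0 by rewrite gcdp_eq0 (negPf A0).
have [c [H [c0 pH GE]]] := primitive_part G0.
have cP0 : c%:P != 0 :> {poly R} by rewrite polyC_eq0.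
have HG : H %= G by rewrite GE mul_polyC eqp_sym eqp_scale.
have [E AE] : divides H A.
  have : H %| A by rewrite (eqp_dvdl _ HG) dvdp_gcdl.
  by case/Pdiv.WeakIdomain.dvdpP=> -[a q] /= a0 E;
    apply: primitive_divides pH a0 _; exists q; rewrite mul_polyC.
have sH : (1 < size H)%N.
  rewrite (eqp_size HG); move: ncAB; rewrite coprimep_def -/G.
  by move: G0; rewrite -size_poly_gt0; case: (size G) => [|[]].
have [sE|] := irrA _ _ AE; last by rewrite leqNgt sH.
have AH : A %= H.
  rewrite AE (size1_polyC sE) mul_polyC eqp_scale //.
  by apply: contraNneq A0 => E0; rewrite AE (size1_polyC sE) E0 mul0r.
by rewrite (eqp_dvdl _ AH) (eqp_dvdl _ HG) dvdp_gcdr.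
Qed.

Lemma primitive_factor A : primitive A -> (1 < size A)%N ->
  exists2 s : seq {poly R}, forall p, p \in s -> prime_elt p & A = \prod_(p <- s) p.
Proof.
move: {2}(size A) (leqnn (size A)) => n.
elim: n A => [|n IHn] A sAn pA sA; first by move: sAn sA; case: (size A).
have [irrA|nirr] := pselect (forall B C, A = B * C -> (size B <= 1)%N \/ (size C <= 1)%N).
  exists [:: A]; last by rewrite big_seq1.
  by move=> p; rewrite inE => /eqP ->; exact: primitive_irreducible_prime.
have [B [C [AE sB sC]]] : exists B C, [/\ A = B * C, (1 < size B)%N & (1 < size C)%N].
  apply: contrapT => nBC; apply: nirr => B C AE.
  case: (leqP (size B) 1) => sB; first by left.
  case: (leqP (size C) 1) => sC; first by right.
  by case: nBC; exists B, C.
have B0 : B != 0 by rewrite -size_poly_gt0 ltnW.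
have C0 : C != 0 by rewrite -size_poly_gt0 ltnW.
have sAE : size A = (size B + size C).-1 by rewrite AE size_mul.
have [||s sP BE] := IHn B _ _ sB; first by lia.
  by move=> p pp dB; apply: (pA p) => //; rewrite AE mulrC; exact: divides_mull.
have [||t tP CE] := IHn C _ _ sC; first by lia.
  by move=> p pp dC; apply: (pA p) => //; rewrite AE; exact: divides_mull.
exists (s ++ t); last by rewrite big_cat -BE -CE.
by move=> p; rewrite mem_cat => /orP[/sP|/tP].
Qed.

Lemma ufd_poly : ufd {poly R}.
Proof.
have ufdC (c : R) : c != 0 -> exists u s, [/\ u \is a GRing.unit,
    forall p : {poly R}, p \in s -> prime_elt p & c%:P = u * \prod_(p <- s) p].
  move=> c0; have [u [s [uU sP ->]]] := ufdR c0.
  exists u%:P, [seq p%:P | p <- s]; split.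
  - by rewrite poly_unitE size_polyC coefC eqxx uU andbT eqb1;
      apply: contraTneq uU => ->; rewrite unitr0.
  - by move=> _ /mapP[p ps ->]; exact/prime_polyC/sP.
  - by rewrite polyCM big_map rmorph_prod.
move=> A A0; case: (leqP (size A) 1) => sA.
  by rewrite (size1_polyC sA) in A0 *; apply: ufdC; rewrite polyC_eq0 in A0.
have [c [B [c0 pB AE]]] := primitive_part A0.
have [|s sP BE] := primitive_factor pB.
  by move: sA; rewrite AE mul_polyC size_scale.
have [u [t [uU tP cE]]] := ufdC _ c0.
exists u, (t ++ s); split=> //.
  by move=> p; rewrite mem_cat => /orP[/tP|/sP].
by rewrite AE cE BE big_cat mulrA.
Qed.

End Poly.

Lemma ufd_iso (R T : idomainType) (f : {rmorphism R -> T}) (g : {rmorphism T -> R}) :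
  cancel f g -> cancel g f -> ufd R -> ufd T.
Proof.
move=> fK gK ufdR a a0.
have ga0 : g a != 0 by apply: contraNneq a0 => ga0; rewrite -(gK a) ga0 rmorph0.
have [u [s [uU sP gaE]]] := ufdR _ ga0.
exists (f u), [seq f p | p <- s]; split.
- exact: rmorph_unit.
- move=> _ /mapP[p /sP[p0 pU pp] ->]; split.
  + by apply: contraNneq p0 => fp0; rewrite -(fK p) fp0 rmorph0.
  + by apply: contraNN pU => fpU; rewrite -(fK p) rmorph_unit.
  + move=> x y [c cE]; have [|[d dE]|[d dE]] := pp (g x) (g y).
    * by exists (g c); rewrite -rmorphM cE rmorphM fK.
    * by left; exists (f d); rewrite -rmorphM -dE gK.
    * by right; exists (f d); rewrite -rmorphM -dE gK.
- by rewrite big_map -rmorph_prod -rmorphM -gaE gK.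
Qed.

Lemma mpoly_rmorphism_id (K : fieldType) n (h : {rmorphism {mpoly K[n]} -> {mpoly K[n]}}) :
  (forall c, h c%:MP = c%:MP) -> (forall i, h 'X_i = 'X_i) -> h =1 id.
Proof.
move=> hC hX p; rewrite [in LHS](mpolyE p) [in RHS](mpolyE p) rmorph_sum.
apply: eq_bigr => m _; rewrite -!mul_mpolyC rmorphM hC mpolyXE_id rmorph_prod.
by congr (_ * _); apply: eq_bigr => i _; rewrite rmorphXn /= hX.
Qed.

Section MPoly.
Variables (K : fieldType) (n : nat).

Let X (i : 'I_n.+1) : {poly {mpoly K[n]}} :=
  if unlift ord_max i is Some j then ('X_j)%:P else 'X.
Let C : {rmorphism K -> {poly {mpoly K[n]}}} := polyC \o @mpolyC n K.
Let toP : {rmorphism {mpoly K[n.+1]} -> {poly {mpoly K[n]}}} := mmap C X.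
Let W : {rmorphism {mpoly K[n]} -> {mpoly K[n.+1]}} :=
  mmap (@mpolyC n.+1 K) (fun j => 'X_(lift ord_max j)).
Let ofP : {rmorphism {poly {mpoly K[n]}} -> {mpoly K[n.+1]}} :=
  horner_eval 'X_ord_max \o map_poly W.

(** The last variable is split off: [toP] sends it to ['X] and the others to constants, and [ofP] is
    the inverse substitution. *)
Lemma ufd_mpolyS : ufd {mpoly K[n]} -> ufd {mpoly K[n.+1]}.
Proof.
move/ufd_poly; apply: (@ufd_iso _ _ ofP toP).
  move=> p; elim/poly_ind: p => [|p c IHp]; first by rewrite !rmorph0.
  rewrite !(rmorphD, rmorphM) /= IHp; congr (_ * _ + _).
    rewrite map_polyX /horner_eval hornerX /toP /= mmapX mmap1U /X.
    by rewrite unlift_none.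
  rewrite map_polyC /horner_eval hornerC.
  pose h : {rmorphism {mpoly K[n]} -> {poly {mpoly K[n]}}} := toP \o W.
  change (h c = c%:P).
  rewrite [in LHS](mpolyE c) [in RHS](mpolyE c) !rmorph_sum.
  apply: eq_bigr => m _; rewrite -!mul_mpolyC !rmorphM mpolyXE_id !rmorph_prod.
  congr (_ * _); first by rewrite /h /= /W mmapC mmapC.
  apply: eq_bigr => i _; rewrite !rmorphXn; congr (_ ^+ _).
  by rewrite /h /= /W mmapX mmap1U mmapX mmap1U /X liftK.
apply: (@mpoly_rmorphism_id _ _ (ofP \o toP)) => [c|i].
  by rewrite /= /toP mmapC /= map_polyC /horner_eval hornerC /W /= mmapC.
rewrite /= /toP mmapX mmap1U /X; case: unliftP => [j|] ->.
  by rewrite map_polyC /horner_eval hornerC /W /= mmapX mmap1U.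
by rewrite map_polyX /horner_eval hornerX.
Qed.

End MPoly.

Lemma ufd_mpoly (K : fieldType) n : ufd {mpoly K[n]}.
Proof.
elim: n => [|n IHn]; last exact: ufd_mpolyS.
move=> p p0; exists p, [::]; rewrite big_nil mulr1; split=> //.
move: p0; rewrite (nvar0_mpolyC p) mpolyC_eq0 => c0.
by apply: rmorph_unit; rewrite unitfE.
Qed.

End UniqueFactorization.

(** * Linear forms in three variables *)

Section LinearForms.
Variable K : numClosedFieldType.
Local Notation S := {mpoly K[3]}.
Implicit Types (a b u v w x y : 'rV[K]_3) (p q : S).

Definition dot a v : K := \sum_i a ord0 i * v ord0 i.

Definition lin a : S := \sum_i a ord0 i *: 'X_i.

Definition row3 (c0 c1 c2 : K) : 'rV[K]_3 := \row_i [:: c0; c1; c2]`_i.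

Definition crossv a b : 'rV[K]_3 :=
  let c := fun i j : 'I_3 => a ord0 i * b ord0 j - a ord0 j * b ord0 i in
  row3 (c 1 2) (c 2 0) (c 0 1).

Lemma ord3E : ((lift ord0 ord0 : 'I_3) = 1) * ((lift ord0 (lift ord0 ord0) : 'I_3) = 2).
Proof. by split; apply: val_inj. Qed.

Lemma big_ord3 (V : nmodType) (F : 'I_3 -> V) : \sum_i F i = F 0 + F 1 + F 2.
Proof. by rewrite !big_ord_recl big_ord0 addr0 !ord3E addrA. Qed.

Lemma ord3P (P : 'I_3 -> Prop) : P 0 -> P 1 -> P 2 -> forall i, P i.
Proof.
move=> P0 P1 P2 [[|[|[|i]]] Hi] //.
- by rewrite (_ : Ordinal Hi = 0) //; apply: val_inj.
- by rewrite (_ : Ordinal Hi = 1) //; apply: val_inj.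
- by rewrite (_ : Ordinal Hi = 2) //; apply: val_inj.
Qed.

Lemma row3E c0 c1 c2 : (row3 c0 c1 c2 ord0 0 = c0) *
  (row3 c0 c1 c2 ord0 1 = c1) * (row3 c0 c1 c2 ord0 2 = c2).
Proof. by rewrite !mxE. Qed.

Lemma dotE a v : dot a v = a ord0 0 * v ord0 0 + a ord0 1 * v ord0 1 + a ord0 2 * v ord0 2.
Proof. exact: big_ord3. Qed.

Lemma dotDr a u v : dot a (u + v) = dot a u + dot a v.
Proof. by rewrite !dotE !mxE; ring. Qed.

Lemma dotZr a c v : dot a (c *: v) = c * dot a v.
Proof. by rewrite !dotE !mxE; ring. Qed.

Lemma dotDl a b v : dot (a + b) v = dot a v + dot b v.
Proof. by rewrite !dotE !mxE; ring. Qed.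

Lemma dotZl a c v : dot (c *: a) v = c * dot a v.
Proof. by rewrite !dotE !mxE; ring. Qed.

Lemma row3P a b : a ord0 0 = b ord0 0 -> a ord0 1 = b ord0 1 ->
  a ord0 2 = b ord0 2 -> a = b.
Proof. by move=> *; apply/rowP; apply: ord3P. Qed.

Lemma meval_lin a v : (lin a).@[v ord0] = dot a v.
Proof.
rewrite /lin raddf_sum; apply: eq_bigr => i _ /=.
by rewrite mevalZ mevalXU.
Qed.

Lemma lin_homog a : lin a \is 1.-homog.
Proof. by apply: rpred_sum => i _; apply: rpredZ; rewrite dhomogX /= mdeg1. Qed.

Lemma lin_coef a i : (lin a)@_U_(i) = a ord0 i.
Proof.
rewrite /lin raddf_sum (bigD1 i) //= mcoeffZ mcoeffXU eqxx mulr1 big1 ?addr0 //.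
by move=> j /negPf ji; rewrite mcoeffZ mcoeffXU ji mulr0.
Qed.

Lemma homog1_lin p : p \is 1.-homog -> p = lin (\row_i p@_U_(i)).
Proof.
move/dhomogP => ph; apply/mpolyP => m.
have [/mdeg1P[i /eqP ->]|/eqP m1] := boolP (mdeg m == 1%N).
  by rewrite lin_coef mxE.
rewrite !memN_msupp_eq0 //; last by apply/negP => /ph.
by apply/negP; move/dhomogP: (lin_homog (\row_i p@_U_(i))) => h /h.
Qed.

Lemma poly_eq0_infinite (q : {poly K}) : (forall t, q.[t] = 0) -> q = 0.
Proof.
move=> q0; apply/eqP/negPn/negP => qn0.
have := max_poly_roots (rs := [seq i%:R | i <- iota 0 (size q)]) qn0.
rewrite size_map size_iota ltnn => h; suff : false by []; apply: h.
  by apply/allP => t _; rewrite /root q0.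
by rewrite map_inj_uniq ?iota_uniq // => i j /eqP; rewrite Num.Theory.eqr_nat => /eqP.
Qed.

Lemma poly_eq_infinite (q r : {poly K}) : (forall t, q.[t] = r.[t]) -> q = r.
Proof.
move=> qr; apply/eqP; rewrite -subr_eq0; apply/eqP/poly_eq0_infinite => t.
by rewrite hornerD hornerN qr subrr.
Qed.

(* The substitution x_i -> t^(N^i) reduces this to univariate polynomials. *)
Lemma meval_eq0 p : (forall v : 'rV[K]_3, p.@[v ord0] = 0) -> p = 0.
Proof.
move=> p0; pose N := msize p.
pose e (m : 'X_{1..3}) := (m 0%R + N * (m 1%R + N * m 2%R))%N.
pose P : {poly K} := \sum_(m <- msupp p) p@_m *: 'X^(e m).
have P0 : P = 0.
  apply: poly_eq0_infinite => t; rewrite -[RHS](p0 (row3 t (t ^+ N) (t ^+ (N * N)))).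
  rewrite mevalE horner_sum; apply: eq_bigr => m _.
  rewrite hornerZ hornerXn; congr (_ * _).
  rewrite !big_ord_recl big_ord0 mulr1 !ord3E !row3E -!exprM -!exprD.
  by congr (_ ^+ _); rewrite /e mulnDr mulnA.
have lt_msupp (m : 'X_{1..3}) i : m \in msupp p -> (m i < N)%N.
  move=> /msize_mdeg_lt; apply: leq_ltn_trans.
  by rewrite mdegE (bigD1 i) //= leq_addr.
have digits i j k : (i < N)%N -> (j < N)%N -> (k < N)%N ->
    [/\ (i + N * (j + N * k)) %% N = i, ((i + N * (j + N * k)) %/ N) %% N = j
      & ((i + N * (j + N * k)) %/ N) %/ N = k]%N.
  move=> iN jN kN; have N0 : (0 < N)%N by apply: leq_ltn_trans iN.
  rewrite addnC mulnC modnMDl modn_small // divnMDl // (divn_small iN) addn0.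
  by rewrite addnC mulnC modnMDl modn_small // divnMDl // (divn_small jN) addn0.
have e_inj : {in msupp p &, injective e}.
  move=> m m' mp mp'; rewrite /e => em; apply/mnmP.
  have [h0 h1 h2] := digits _ _ _ (lt_msupp _ 0 mp) (lt_msupp _ 1 mp) (lt_msupp _ 2 mp).
  have [h0' h1' h2'] := digits _ _ _ (lt_msupp _ 0 mp') (lt_msupp _ 1 mp') (lt_msupp _ 2 mp').
  apply: ord3P.
  - by rewrite -[LHS]h0 em.
  - by rewrite -[LHS]h1 em.
  - by rewrite -[LHS]h2 em.
apply/mpolyP => m; rewrite mcoeff0.
have [mp|/memN_msupp_eq0 //] := boolP (m \in msupp p).
have := congr1 (fun q : {poly K} => q`_(e m)) P0; rewrite /= coef0 coef_sum.
rewrite (bigD1_seq m) ?msupp_uniq //= coefZ coefXn eqxx mulr1.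
rewrite big_seq_cond big1 ?addr0 // => m' /andP[mp' mm'].
rewrite coefZ coefXn; case: eqP => [/esym em|]; last by rewrite mulr0.
by case/eqP: mm'; apply: e_inj.
Qed.

Section Projection.
Variables (a w : 'rV[K]_3).
Hypothesis aw : dot a w = 1.

(** Substituting [lq] means composing with the projection v - (a.v) w onto the plane a = 0. So [pr]
    kills [lin a] and is the identity modulo it: its kernel is the ideal of [lin a], which is
    therefore prime. *)
Let lq := [tuple 'X_i - w ord0 i *: lin a | i < 3].
Let pr (p : S) : S := p \mPo lq.

Let pr_lin : pr (lin a) = 0.
Proof.
rewrite /pr /lin raddf_sum /=.
transitivity (\sum_i (a ord0 i *: 'X_i - (a ord0 i * w ord0 i) *: lin a)).
  apply: eq_bigr => i _; rewrite comp_mpolyZ comp_mpolyXU.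
  by rewrite (nth_map 0) ?size_enum_ord // nth_ord_enum /= scalerBr scalerA.
by rewrite sumrB -scaler_suml -/(dot a w) aw scale1r subrr.
Qed.

Let pr_mod p : divides (lin a) (p - pr p).
Proof.
have dM q r : divides (lin a) (q - pr q) -> divides (lin a) (r - pr r) ->
    divides (lin a) (q * r - pr (q * r)).
  move=> dq dr; rewrite /pr rmorphM /= -/(pr q) -/(pr r).
  rewrite (_ : _ - _ = r * (q - pr q) + pr q * (r - pr r)); last by ring.
  by apply: divides_add; apply: divides_mull.
have dC c : divides (lin a) (c%:MP - pr c%:MP).
  by rewrite /pr comp_mpolyC subrr; exists 0; rewrite mul0r.
rewrite (mpolyE p); apply: (big_ind (fun q => divides (lin a) (q - pr q))) => [|q r dq dr|m _].
- by rewrite /pr comp_mpoly0 subrr; exists 0; rewrite mul0r.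
- by rewrite /pr comp_mpolyD opprD addrACA; exact: divides_add.
rewrite -mul_mpolyC; apply: (dM) => //.
rewrite mpolyXE_id; apply: (big_ind (fun q => divides (lin a) (q - pr q))) => [||i _].
- exact: (dC 1).
- exact: (dM).
elim: (m i) => [|k IHk]; first exact: (dC 1).
rewrite exprS; apply: (dM) => //.
rewrite /pr comp_mpolyXU (nth_map 0) ?size_enum_ord // nth_ord_enum opprB addrC subrK.
by exists (w ord0 i)%:MP; rewrite mul_mpolyC.
Qed.

Lemma lin_divides_proj p : (forall v, dot a v = 0 -> p.@[v ord0] = 0) -> divides (lin a) p.
Proof.
move=> p0; suff pr0 : pr p = 0 by have := pr_mod p; rewrite pr0 subr0.
apply: meval_eq0 => v; rewrite /pr comp_mpoly_meval.
rewrite -(p0 (v - dot a v *: w)); last first.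
  by rewrite dotDr -scaleNr dotZr aw mulr1 subrr.
apply: meval_eq => i; rewrite tnth_mktuple mevalB mevalXU mevalZ meval_lin.
by rewrite !mxE mulrC.
Qed.

Lemma lin_prime_proj : prime_elt (lin a).
Proof.
split.
- apply/eqP => a0; have := meval_lin a w; rewrite a0 meval0 aw.
  by move/esym/eqP; rewrite oner_eq0.
- apply/negP => /unitrP[c [ca _]].
  have := congr1 (fun p : S => p.@[(0 : 'rV[K]_3) ord0]) ca.
  rewrite /= mevalM meval_lin meval1 dotE !mxE !mulr0 !addr0 mulr0.
  by move/esym/eqP; rewrite oner_eq0.
- move=> p q [c cE].
  have /eqP : pr p * pr q = 0 by rewrite /pr -rmorphM cE rmorphM /= -/(pr (lin a)) pr_lin mulr0.
  rewrite mulf_eq0 => /orP[/eqP p0|/eqP q0].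
    by left; have := pr_mod p; rewrite p0 subr0.
  by right; have := pr_mod q; rewrite q0 subr0.
Qed.
End Projection.

Lemma dual_vector a : a != 0 -> exists w, dot a w = 1.
Proof.
case/rV0Pn => i ai; exists ((a ord0 i)^-1 *: delta_mx ord0 i).
rewrite dotZr /dot (bigD1 i) //= !mxE !eqxx mulr1 big1 ?addr0 ?mulVf //.
by move=> j /negPf ji; rewrite !mxE ji andbF mulr0.
Qed.

Lemma lin_dividesP a p : a != 0 ->
  divides (lin a) p <-> (forall v, dot a v = 0 -> p.@[v ord0] = 0).
Proof.
move=> /dual_vector[w aw]; split=> [[c ->] v av|p0].
  by rewrite mevalM meval_lin av mulr0.
exact: lin_divides_proj aw p p0.
Qed.

Lemma lin_prime a : a != 0 -> prime_elt (lin a).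
Proof. by move=> /dual_vector[w]; exact: lin_prime_proj. Qed.

Lemma lin_neq0 a : a != 0 -> lin a != 0.
Proof. by case/lin_prime. Qed.

Lemma crossv_dotl a b : dot a (crossv a b) = 0.
Proof. by rewrite dotE !row3E; ring. Qed.

Lemma crossv_dotr a b : dot b (crossv a b) = 0.
Proof. by rewrite dotE !row3E; ring. Qed.

Lemma crossv_indep a b : crossv a b != 0 -> exists2 v, dot a v = 0 & dot b v != 0.
Proof.
move=> ab; apply: contrapT => nv.
have H v : dot a v = 0 -> dot b v = 0.
  by move=> av; apply/eqP/negPn/negP => bv; apply: nv; exists v.
(* By the triple product b.(e x a) = e.(a x b), taking for [e] the unit vectors reads off the
   coordinates of a x b. *)
have e c0 c1 c2 : dot b (crossv (row3 c0 c1 c2) a) = 0.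
  by apply: H; exact: crossv_dotr.
case/eqP: ab; apply: row3P; rewrite !row3E mxE.
- by have := e 1 0 0; rewrite dotE !row3E => <-; ring.
- by have := e 0 1 0; rewrite dotE !row3E => <-; ring.
- by have := e 0 0 1; rewrite dotE !row3E => <-; ring.
Qed.

Lemma crossv_neq0l a b : crossv a b != 0 -> a != 0.
Proof.
apply: contraNneq => ->; apply/eqP.
by apply: row3P; rewrite !row3E !mxE; ring.
Qed.

Lemma crossvC a b : crossv a b = - crossv b a.
Proof. by apply: row3P; rewrite !mxE /= ?mxE; ring. Qed.

Lemma crossv_neq0C a b : (crossv a b != 0) = (crossv b a != 0).
Proof. by rewrite crossvC oppr_eq0. Qed.

Lemma lin_not_divides a b : crossv a b != 0 -> ~ divides (lin a) (lin b).
Proof.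
move=> ab; have a0 := crossv_neq0l ab; have [v av bv] := crossv_indep ab.
by move/(lin_dividesP _ a0)/(_ v av); rewrite meval_lin; apply/eqP.
Qed.

Definition indep_lines (L : seq 'rV[K]_3) := pairwise (fun a b => crossv a b != 0) L.

Lemma lin_divides_prod a L : a != 0 -> all (fun b => crossv a b != 0) L ->
  ~ divides (lin a) (\prod_(b <- L) lin b).
Proof.
move=> a0 /allP aL dL; have [|_ /mapP[b bL ->]] := prime_dvd_prod (s := map lin L) (lin_prime a0).
  by rewrite big_map.
exact/lin_not_divides/aL.
Qed.

Lemma lin_prod_divides L p : indep_lines L -> all (fun a => a != 0) L ->
  (forall a, a \in L -> divides (lin a) p) -> divides (\prod_(a <- L) lin a) p.
Proof.
elim: L p => [|a L IHL] p; first by exists p; rewrite big_nil mulr1.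
rewrite /indep_lines /= => /andP[aL iL] /andP[a0 L0] dL.
have [|q qE] := IHL p iL L0.
  by move=> b bL; apply: dL; rewrite inE bL orbT.
have : divides (lin a) p by apply: dL; rewrite mem_head.
rewrite qE; have [_ _ pp] := lin_prime a0.
case/pp => [[r ->]|]; first by exists r; rewrite big_cons mulrA.
by move/(lin_divides_prod a0 aL).
Qed.

End LinearForms.

(** * Homogeneous polynomials and restriction to a line *)

Section HomogeneousQuotient.
Variables (K : fieldType) (n : nat).
Local Notation S := {mpoly K[n]}.

Lemma pihomog_mulr (q r : S) k m : r \is k.-homog ->
  pihomog mdeg m (q * r) = if (k <= m)%N then pihomog mdeg (m - k) q * r else 0.
Proof.
move=> rk; pose N := maxn (msize q) m.+1.
rewrite [in LHS](pihomog_partitionE (k := N) (mf := mdeg) (p := q)) ?leq_maxl //.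
rewrite mulr_suml raddf_sum /=.
have E (i : nat) : pihomog mdeg m (pihomog mdeg i q * r)
    = if (i + k == m)%N then pihomog mdeg i q * r else 0.
  have h : pihomog mdeg i q * r \is (i + k).-homog by apply: dhomogM => //; exact: pihomogP.
  case: eqP => [<-|/eqP ne]; first exact: pihomog_dE.
  by rewrite (pihomog_ne0 _ h).
under eq_bigr do rewrite E.
case: leqP => km.
  have lt : (m - k < N)%N by rewrite leq_max ltnS leq_subr orbT.
  rewrite (bigD1 (Ordinal lt)) //= subnK // eqxx big1 ?addr0 // => i ne.
  case: eqP => // ikm; case/eqP: ne; apply: val_inj => /=; lia.
by rewrite big1 // => i _; case: eqP => // ikm; lia.
Qed.

(** For [m < k] the cofactor would have negative degree, so it vanishes, in accordance with the
    convention of [S_gr]. *)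
Lemma homog_cofactor (q r : S) k m : r != 0 -> r \is k.-homog -> q * r \is m.-homog ->
  if (k <= m)%N then q \is (m - k).-homog else q == 0.
Proof.
move=> r0 rk qr; have := pihomog_mulr q m rk; rewrite pihomog_dE //.
case: leqP => _; first by move/(mulIf r0) ->; exact: pihomogP.
by move/eqP; rewrite mulf_eq0 (negPf r0) orbF.
Qed.

End HomogeneousQuotient.

Section SpaceDim.
Variable K : fieldType.

Lemma vspace_has_dim m (U : {vspace dhomog 3 K m}) :
  has_dim (fun p : {mpoly K[3]} => exists2 q, q \in U & p = mpoly_of_dhomog q) (\dim U).
Proof.
pose b := vbasis U; have bU := vbasisP U.
exists (fun i => mpoly_of_dhomog (tnth b i)); split.
- move=> c; exists (\sum_i c i *: tnth b i); last first.
    by rewrite raddf_sum; apply: eq_bigr => i _; rewrite -linearZ.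
  by apply: rpred_sum => i _; apply: rpredZ; apply: vbasis_mem; exact: mem_tnth.
- move=> _ [q qU ->]; exists (fun i => coord b i q).
  rewrite [in LHS](coord_vbasis qU) raddf_sum; apply: eq_bigr => i _.
  by rewrite -linearZ (tnth_nth 0).
- move=> c c0; have /freeP fb := basis_free bU; apply: fb.
  apply: val_inj; rewrite -[RHS]c0 /= raddf_sum; apply: eq_bigr => i _.
  by rewrite -linearZ (tnth_nth 0).
Qed.

Lemma dim_dhomog m : \dim {:dhomog 3 K m} = 'C(m.+2, 2).
Proof. by rewrite dimvf /dim /= addn2 -[RHS]bin_sub // !subSS subn0. Qed.

Lemma homog_has_dim m : has_dim (fun p : {mpoly K[3]} => p \is m.-homog) 'C(m.+2, 2).
Proof.
rewrite -dim_dhomog; apply: eq_has_dim (vspace_has_dim _) => p; split.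
  by case=> q _ ->; case: q.
by move=> pm; exists (DHomog pm); rewrite ?memvf.
Qed.

Lemma poly_has_dim n : has_dim (fun q : {poly K} => (size q <= n)%N) n.
Proof.
have E (c : 'I_n -> K) : \sum_i c i *: 'X^i = \poly_(i < n) (oapp c 0 (insub i)).
  rewrite poly_def; apply: eq_bigr => i _; congr (_ *: _).
  by rewrite insubT //= => lt; rewrite /= (_ : Sub _ _ = i) //; exact: val_inj.
exists (fun i : 'I_n => 'X^i); split.
- by move=> c; rewrite E size_poly.
- move=> q qn; exists (fun i => q`_i); rewrite E; apply/polyP => i.
  rewrite coef_poly; case: ltnP => [lt|/(leq_trans qn)/(nth_default 0) //].
  by rewrite insubT.
- move=> c; rewrite E => /polyP c0 i; have := c0 i.
  rewrite coef0 coef_poly ltn_ord insubT //= => lt.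
  by rewrite (_ : Sub _ _ = i) //; exact: val_inj.
Qed.

End SpaceDim.

Section Restriction.
Variable K : numClosedFieldType.
Local Notation S := {mpoly K[3]}.
Implicit Types (a b u v w x y : 'rV[K]_3) (p q : S).

(* [w] completes a basis [u, v] of the plane [a = 0], and [x, y, a] is dual to
   [u, v, w] *)
Definition frame a u v x y w :=
  [/\ [/\ dot a u = 0, dot a v = 0 & dot a w = 1],
      [/\ dot x u = 1, dot x v = 0 & dot x w = 0],
      [/\ dot y u = 0, dot y v = 1 & dot y w = 0] &
      forall z, z = dot x z *: u + dot y z *: v + dot a z *: w].

Lemma frame_exists a : a != 0 -> exists u v x y w, frame a u v x y w.
Proof.
case/rV0Pn; apply: ord3P => ai.
- exists (row3 (- a ord0 1 / a ord0 0) 1 0), (row3 (- a ord0 2 / a ord0 0) 0 1),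
    (row3 0 1 0), (row3 0 0 1), (row3 (a ord0 0)^-1 0 0).
  rewrite /frame !dotE !row3E; split; [split|split|split|] => /=; try by field.
  by move=> p; apply: row3P; rewrite !dotE !mxE /=; field.
- exists (row3 1 (- a ord0 0 / a ord0 1) 0), (row3 0 (- a ord0 2 / a ord0 1) 1),
    (row3 1 0 0), (row3 0 0 1), (row3 0 (a ord0 1)^-1 0).
  rewrite /frame !dotE !row3E; split; [split|split|split|] => /=; try by field.
  by move=> p; apply: row3P; rewrite !dotE !mxE /=; field.
- exists (row3 1 0 (- a ord0 0 / a ord0 2)), (row3 0 1 (- a ord0 1 / a ord0 2)),
    (row3 1 0 0), (row3 0 1 0), (row3 0 0 (a ord0 2)^-1).
  rewrite /frame !dotE !row3E; split; [split|split|split|] => /=; try by field.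
  by move=> p; apply: row3P; rewrite !dotE !mxE /=; field.
Qed.

(** Moving [v] by a generic multiple of [u] places the point at infinity of the parametrization
    [u + t v] on no line of [L], so every intersection point has a finite parameter. *)
Lemma frame_avoid a (L : seq 'rV[K]_3) : a != 0 ->
  all (fun b => crossv a b != 0) L ->
  exists u v x y w, frame a u v x y w /\ forall b, b \in L -> dot b v != 0.
Proof.
move=> /frame_exists[u [v [x [y [w [au xu yu pE]]]]]] /allP aL.
pose q (b : 'rV[K]_3) : {poly K} := (dot b v)%:P + (dot b u)%:P * 'X.
have q0 : \prod_(b <- L) q b != 0.
  rewrite prodf_seq_neq0; apply/allP => b bL; apply/implyP => _.
  apply/eqP => qb; have [p ap bp] := crossv_indep (aL _ bL).
  case/eqP: bp; rewrite (pE p) ap scale0r addr0 dotDr !dotZr.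
  have := congr1 (fun q : {poly K} => q`_0) qb.
  rewrite coefD coefC coefMX coef0 eqxx addr0 => -> /=.
  have := congr1 (fun q : {poly K} => q`_1) qb.
  by rewrite coefD coefC coefMX coefC coef0 /= add0r => ->; rewrite !mulr0 addr0.
have [t qt] : exists t, (\prod_(b <- L) q b).[t] != 0.
  apply: contrapT => nt; case/eqP: q0; apply: poly_eq0_infinite => t.
  by apply/eqP/negPn/negP => qt; apply: nt; exists t.
move: au xu yu => [au av aw] [xu xv xw] [yu yv yw].
(* Replacing [v] by [v + t *: u] forces [x - t *: y] in place of [x] to keep the frame dual. *)
exists u, (v + t *: u), (x - t *: y), y, w; split.
  rewrite /frame -!scaleNr !(dotDr, dotDl, dotZr, dotZl) au av aw xu xv xw yu yv yw.
  split; [split|split|split|]; try by ring.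
  by move=> p; rewrite [in LHS](pE p) dotDl dotZl; apply: row3P; rewrite !mxE; ring.
move=> b bL; apply: contraNneq qt; rewrite dotDr dotZr => bv.
rewrite horner_prod; apply/eqP; rewrite (big_rem b) //= {1}/q.
by rewrite hornerD hornerM !hornerC hornerX [_ * t]mulrC bv mul0r.
Qed.

Lemma meval_homogZ (t : K) (z : 'rV[K]_3) p m :
  p \is m.-homog -> p.@[(t *: z) ord0] = t ^+ m * p.@[z ord0].
Proof.
move=> /dhomogP pm.
rewrite !mevalE mulr_sumr big_seq [RHS]big_seq; apply: eq_bigr => k kp.
rewrite mulrCA; congr (_ * _); rewrite -(pm _ kp) /= mdegE -prodrXr -big_split.
by apply: eq_bigr => i _; rewrite mxE exprMn.
Qed.

Variables (u v : 'rV[K]_3).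

(** Dehomogenized restriction to the line a = 0: for a frame it sets [lin x] to 1, [lin y] to ['X]
    and [lin a] to 0. Degrees thereby turn into bounds on sizes. *)
Definition restr : {rmorphism S -> {poly K}} :=
  mmap (@polyC K) (fun i => (u ord0 i)%:P + (v ord0 i)%:P * 'X).

Lemma restrZ c p : restr (c *: p) = c *: restr p.
Proof. by rewrite /restr /= mmapZ mul_polyC. Qed.

Lemma horner_restr p t : (restr p).[t] = p.@[(u + t *: v) ord0].
Proof.
rewrite mevalE /restr /mmap horner_sum; apply: eq_bigr => m _.
rewrite hornerM hornerC /mmap1 horner_prod; congr (_ * _).
apply: eq_bigr => i _; rewrite horner_exp; congr (_ ^+ _).
by rewrite hornerD hornerM !hornerC hornerX !mxE mulrC.
Qed.

Lemma restr_lin a : restr (lin a) = (dot a u)%:P + (dot a v)%:P * 'X.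
Proof.
apply: poly_eq_infinite => t; rewrite horner_restr meval_lin dotDr dotZr.
by rewrite hornerD hornerM !hornerC hornerX mulrC.
Qed.

Lemma size_restr p m : p \is m.-homog -> (size (restr p) <= m.+1)%N.
Proof.
move/dhomogP => pm; rewrite /restr /= /mmap.
rewrite big_seq; apply: (big_ind (fun q : {poly K} => (size q <= m.+1)%N)).
- by rewrite size_poly0.
- by move=> q r sq sr; apply: leq_trans (size_polyD _ _) _; rewrite geq_max sq.
move=> k kp; rewrite mul_polyC; apply: leq_trans (size_scale_leq _ _) _.
have : forall (s : seq 'I_3),
    (size (\prod_(i <- s) ((u ord0 i)%:P + (v ord0 i)%:P * 'X) ^+ k i)%R
     <= (\sum_(i <- s) k i).+1)%N.
  elim=> [|i s IHs]; first by rewrite !big_nil size_poly1.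
  rewrite !big_cons; apply: leq_trans (size_polyMleq _ _) _.
  have : (size (((u ord0 i)%:P + (v ord0 i)%:P * 'X : {poly K}) ^+ k i)%R <= (k i).+1)%N.
    apply: leq_trans (size_poly_exp_leq _ _) _; rewrite ltnS -[leqRHS]mul1n leq_mul //.
    suff : (size ((u ord0 i)%:P + (v ord0 i)%:P * 'X : {poly K})%R <= 2)%N.
      by case: size => // j; rewrite ltnS.
    apply: leq_trans (size_polyD _ _) _; rewrite geq_max size_polyC.
    case: eqP => _ /=; rewrite mul_polyC;
      by rewrite (leq_trans (size_scale_leq _ _)) // size_polyX.
  by move: IHs; set s1 := size _; set s2 := size _; lia.
move/(_ (index_enum 'I_3)) => h; apply: leq_trans h _.
by rewrite ltnS -mdegE (pm _ kp).
Qed.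

Variables (a x y w : 'rV[K]_3).
Hypothesis fr : frame a u v x y w.

Lemma restr_linx : restr (lin x) = 1.
Proof. by rewrite restr_lin; case: fr => _ [-> -> _] _ _; rewrite mul0r addr0. Qed.

Lemma restr_liny : restr (lin y) = 'X.
Proof. by rewrite restr_lin; case: fr => _ _ [-> -> _] _; rewrite mul1r add0r. Qed.

Lemma restr_lina : restr (lin a) = 0.
Proof. by rewrite restr_lin; case: fr => -[-> -> _] _ _ _; rewrite mul0r add0r. Qed.

Lemma restr_surj (q : {poly K}) m : (size q <= m.+1)%N ->
  exists2 p, p \is m.-homog & restr p = q.
Proof.
move=> qm; exists (\sum_(i < m.+1) q`_i *: (lin x ^+ (m - i) * lin y ^+ i)).
  apply: rpred_sum => i _; apply: rpredZ.
  have := dhomogM (dhomogMn (m - i) (lin_homog x)) (dhomogMn i (lin_homog y)).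
  by rewrite !mul1n subnK // -ltnS.
rewrite raddf_sum /=; apply/polyP => j; rewrite coef_sum.
transitivity ((\poly_(i < m.+1) q`_i)`_j).
  rewrite poly_def coef_sum; apply: eq_bigr => i _.
  by rewrite restrZ rmorphM !rmorphXn /= restr_linx restr_liny expr1n mul1r.
by rewrite coef_poly; case: ltnP => // /(leq_trans qm)/(nth_default 0).
Qed.

(** The parametrization misses the points of the plane with x = 0. Multiplying by [lin x] takes care
    of them, and this factor is not divisible by the prime [lin a]. *)
Lemma restr_eq0 p m : p \is m.-homog -> restr p = 0 -> divides (lin a) p.
Proof.
move=> pm p0; have [[au av aw] [xu xv xw] [yu yv yw] pE] := fr.
have a0 : a != 0 by apply/eqP => a0; move: aw; rewrite a0 dotE !mxE !mul0r !addr0 => /esym/eqP; rewrite oner_eq0.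
have : divides (lin a) (p * lin x).
  apply/lin_dividesP => // z az; rewrite mevalM meval_lin.
  have [-> |xz] := eqVneq (dot x z) 0; first by rewrite mulr0.
  suff -> : p.@[z ord0] = 0 by rewrite mul0r.
  have -> : z = dot x z *: (u + (dot y z / dot x z) *: v).
    by rewrite [in LHS](pE z) az scale0r addr0 scalerDr scalerA mulrCA divff ?mulr1.
  by rewrite (meval_homogZ _ _ pm) -horner_restr p0 horner0 mulr0.
have [_ _ pp] := lin_prime a0; case/pp => // /(lin_dividesP _ a0)/(_ u au).
by rewrite meval_lin xu => /eqP; rewrite oner_eq0.
Qed.

End Restriction.

(** * Multiples of a univariate polynomial reached in all large degrees *)

Section EventualIdeal.
Variable K : numClosedFieldType.
Variable W : nat -> {poly K} -> Prop.
Hypothesis W0 : forall N, (2 <= N)%N -> W N 0.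
Hypothesis WD : forall N p q, W N p -> W N q -> W N (p + q).

(** [W N] will be the set of values of [wcomp] on logarithmic derivations of degree N - 2. For fixed
    [N] it is only additive; ideal-like behaviour is expected for large [N] only, and within the
    size bound. *)
Definition eventually_contains (G : {poly K}) := exists N0, forall N, (N0 <= N)%N ->
  forall y, (size (y * G)%R <= N)%N -> W N (y * G).

Lemma eventually_eqp G H : G %= H -> eventually_contains G -> eventually_contains H.
Proof.
move=> /eqpP[[c d] /= /andP[c0 d0] E] [N0 GN]; exists N0 => N NN y.
have -> : H = (d^-1 * c) *: G by rewrite -scalerA E scalerA mulVf ?scale1r.
by rewrite -scalerAr scalerAl; exact: GN.
Qed.

(* In [y * gcdp G H = r * G + z * H] one may take [r] reduced modulo
   [H %/ gcdp G H], so that no cancellation of high degree terms occurs. *)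
Lemma eventually_gcd G H : eventually_contains G -> eventually_contains H ->
  eventually_contains (gcdp G H).
Proof.
move=> evG evH; have [-> |G0] := eqVneq G 0; first by rewrite gcd0p.
have [-> |H0] := eqVneq H 0; first by rewrite gcdp0.
case: evG evH => [N1 GN] [N2 HN].
have [[s t] /= /eqpP[[c d] /= /andP[c0 d0] E]] := Bezoutp G H.
set g := gcdp G H in E *.
have gE : g = (d^-1 * c) *: (s * G + t * H).
  by rewrite -scalerA E scalerA mulVf ?scale1r.
have [G' GE] : exists G', G = G' * g.
  by have /dvdpP[G' ->] := dvdp_gcdl G H; exists G'.
have [H' HE] : exists H', H = H' * g.
  by have /dvdpP[H' ->] := dvdp_gcdr G H; exists H'.
have H'0 : H' != 0 by apply: contraNneq H0 => H'0; rewrite HE H'0 mul0r.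
exists (maxn (maxn N1 N2) (size H' + size G)) => N.
rewrite !geq_max => /andP[/andP[N1N N2N] sN] y yN.
pose r := ((d^-1 * c) *: (y * s)) %% H'; pose q := ((d^-1 * c) *: (y * s)) %/ H'.
have qr : (d^-1 * c) *: (y * s) = q * H' + r by exact: divp_eq.
pose z := (d^-1 * c) *: (y * t) + q * G'.
have yE : y * g = r * G + z * H.
  have HG : H' * G = G' * H by rewrite [in LHS]GE [in RHS]HE; ring.
  transitivity (((d^-1 * c) *: (y * s)) * G + ((d^-1 * c) *: (y * t)) * H).
    by rewrite [in LHS]gE -!scalerAl -scalerAr -scalerDr; congr (_ *: _); ring.
  rewrite qr /z; move: (_ *: (y * t)) => A.
  rewrite mulrDl -[q * H' * G]mulrA HG mulrDl [RHS]addrCA addrC mulrA [in RHS]addrC.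
  by rewrite addrC [q * G' * H + _]addrC.
have sr : (size (r * G)%R <= N)%N.
  apply: leq_trans sN; apply: leq_trans (size_polyMleq _ _) _.
  have : (size r < size H')%N by rewrite ltn_modp.
  by set s1 := size r; set s2 := size H'; set s3 := size G; lia.
rewrite yE; apply: WD; first exact: GN.
apply: HN => //; rewrite (_ : z * H = y * g - r * G); last by rewrite yE addrC addKr.
by apply: leq_trans (size_polyD _ _) _; rewrite size_polyN geq_max yN.
Qed.

(** Up to a scalar, this is [wcomp] of the constant vector z of parameter [c] multiplied by the
    lines that miss z, when [rs] lists the parameters of the lines; [c] need not belong to [rs]. *)
Definition cofactor (rs : seq K) (c : K) : {poly K} :=
  ('X - c%:P) * \prod_(t <- rs | t != c) ('X - t%:P).

Lemma root_cofactor rs c t : root (cofactor rs c) t = (t == c) || (t \in rs).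
Proof.
rewrite rootM root_XsubC; case: eqP => //= /eqP tc.
by rewrite -big_filter root_prod_XsubC mem_filter tc.
Qed.

(* The common divisors of the cofactors have only simple roots, all in [rs]. *)
Lemma gcd_cofactors rs (G := foldr (fun c p => gcdp (cofactor rs c) p) 0 (rs ++ [:: 0; 1])) :
  G %= \prod_(t <- undup rs) ('X - t%:P).
Proof.
set Q := \prod_(t <- _) _.
have cof0 c : cofactor rs c != 0.
  by rewrite mulf_neq0 ?polyXsubC_eq0 // prodf_seq_neq0; apply/allP => t _;
    rewrite polyXsubC_eq0 implybT.
have Gdvd c : c \in rs ++ [:: 0; 1] -> G %| cofactor rs c.
  rewrite /G; elim: (rs ++ _) => //= d s IHs; rewrite inE => /predU1P[->|cs].
    exact: dvdp_gcdl.
  by apply: dvdp_trans (IHs cs); exact: dvdp_gcdr.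
have Qdvd c : Q %| cofactor rs c.
  apply: uniq_roots_dvdp; last by rewrite uniq_rootsE undup_uniq.
  by apply/allP => t; rewrite mem_undup root_cofactor => ->; rewrite orbT.
have QG : Q %| G.
  rewrite /G; elim: (rs ++ _) => [|d s IHs] /=; first exact: dvdp0.
  by rewrite dvdp_gcd Qdvd IHs.
have G0 : G != 0.
  apply: contraNneq (cof0 0) => G0; rewrite -dvd0p -G0; apply: Gdvd.
  by rewrite mem_cat !inE eqxx orbT.
have /dvdpP[e GE] := QG.
suff /size_poly1P[c c0 eE] : size e == 1%N.
  by rewrite GE eE mul_polyC eqp_scale.
apply/negPn/negP => /closed_rootP[t et].
have XG : ('X - t%:P) * Q %| G by rewrite GE dvdp_mul // dvdp_XsubCl.
(* For [t] in [rs], the root [t] of [cofactor rs t] is simple, which excludes a square. *)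
have [trs|trs] := boolP (t \in rs).
  have XQ : 'X - t%:P %| Q by rewrite dvdp_XsubCl root_prod_XsubC mem_undup.
  have : ('X - t%:P) * ('X - t%:P) %| cofactor rs t.
    apply: dvdp_trans (Gdvd t _); last by rewrite mem_cat trs.
    by apply: dvdp_trans XG; apply: dvdp_mul.
  rewrite /cofactor dvdp_mul2l ?polyXsubC_eq0 // dvdp_XsubCl -big_filter.
  by rewrite root_prod_XsubC mem_filter eqxx.
(* Outside [rs], the cofactor at [c] vanishes only at [c]; the extra values 0 and 1 cannot both
   equal [t]. *)
have rt c : c \in rs ++ [:: 0; 1] -> t = c.
  move=> /Gdvd dG; have : root (cofactor rs c) t.
    rewrite -dvdp_XsubCl; apply: dvdp_trans dG; apply: dvdp_trans XG.
    exact: dvdp_mulIl.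
  by rewrite root_cofactor (negPf trs) orbF => /eqP.
have := oner_eq0 K; rewrite -(rt 1) ?(rt 0) ?eqxx //.
  by rewrite mem_cat !inE eqxx orbT.
by rewrite mem_cat !inE eqxx !orbT.
Qed.

Lemma eventually_cofactors rs :
  (forall c, eventually_contains (cofactor rs c)) ->
  eventually_contains (\prod_(t <- undup rs) ('X - t%:P)).
Proof.
move=> ev; apply: eventually_eqp (gcd_cofactors rs) _.
elim: (rs ++ _) => [|c s IHs] /=; last exact: eventually_gcd.
by exists 2%N => N N2 y _; rewrite mulr0; exact: W0.
Qed.

End EventualIdeal.

(** * Logarithmic derivations *)

Section LogarithmicDerivations.
Variable K : numClosedFieldType.
Local Notation S := {mpoly K[3]}.
Local Notation V := {ffun 'I_3 -> S}.
Implicit Types (a b u v w x y z : 'rV[K]_3) (p : S) (th : V) (L : seq 'rV[K]_3).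

Definition pairing b th : S := \sum_i b ord0 i *: th i.

(* The degree [m] part of the module D(A) of logarithmic derivations *)
Definition logder L (m : nat) th : Prop :=
  (forall i, th i \is m.-homog) /\
  forall b, b \in L -> divides (lin b) (pairing b th).

Lemma pairing_linear b : linear (pairing b).
Proof.
move=> c th et; rewrite /pairing scaler_sumr -big_split.
by apply: eq_bigr => i _; rewrite !ffunE scalerDr !scalerA [c * _]mulrC.
Qed.

Lemma pairing_homog b th m : (forall i, th i \is m.-homog) -> pairing b th \is m.-homog.
Proof. by move=> h; apply: rpred_sum => i _; apply: rpredZ. Qed.

Lemma pairing_mul b p th : pairing b [ffun i => p * th i] = p * pairing b th.
Proof.
by rewrite /pairing mulr_sumr; apply: eq_bigr => i _; rewrite ffunE scalerAr.
Qed.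

Lemma pairing_const b z p : pairing b [ffun i => z ord0 i *: p] = dot b z *: p.
Proof.
by rewrite /pairing /dot scaler_suml; apply: eq_bigr => i _; rewrite ffunE scalerA.
Qed.

Lemma pairing_euler b p : pairing b [ffun i => p * 'X_i] = p * lin b.
Proof.
by rewrite /pairing /lin mulr_sumr; apply: eq_bigr => i _; rewrite ffunE scalerAr.
Qed.

Lemma logderD L m th et : logder L m th -> logder L m et -> logder L m (th + et).
Proof.
move=> [h1 d1] [h2 d2]; split=> [i|b bL]; first by rewrite ffunE rpredD.
by rewrite -[th]scale1r pairing_linear scale1r; apply: divides_add; [exact: d1|exact: d2].
Qed.

Lemma logderZ L m c th : logder L m th -> logder L m (c *: th).
Proof.
move=> [h1 d1]; split=> [i|b bL]; first by rewrite ffunE rpredZ.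
have := pairing_linear b c th 0; rewrite addr0 => ->.
have -> : pairing b 0 = 0 by rewrite /pairing big1 // => i _; rewrite ffunE scaler0.
by rewrite addr0 -mul_mpolyC; apply: divides_mull; exact: d1.
Qed.

Lemma logder0 L m : logder L m 0.
Proof.
split=> [i|b _]; first by rewrite ffunE rpred0.
exists 0; rewrite mul0r /pairing big1 // => i _.
by rewrite ffunE scaler0.
Qed.

Section AddLine.
Variables (a u v x y w : 'rV[K]_3) (L : seq 'rV[K]_3).
Hypothesis fr : frame a u v x y w.
Hypothesis vL : forall b, b \in L -> dot b v != 0.
Hypothesis aL : all (fun b => crossv a b != 0) L.

(* On the line [a = 0], parametrized by [u + t v], a logarithmic derivation
   restricts to [tcomp * u + (wcomp + 'X * tcomp) * v]. *)
Definition tcomp th : {poly K} := restr u v (pairing x th).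
Definition wcomp th : {poly K} := restr u v (pairing y th) - 'X * tcomp th.

Let tcomp_linear : linear tcomp.
Proof. by move=> c th et; rewrite /tcomp pairing_linear rmorphD /= restrZ. Qed.

Let wcomp_linear : linear wcomp.
Proof.
move=> c th et; rewrite /wcomp tcomp_linear pairing_linear rmorphD /= restrZ.
by rewrite scalerBr mulrDr -scalerAr opprD addrACA.
Qed.

Let wcomp0 : wcomp 0 = 0.
Proof. by rewrite -(subrr 0) linearB_fun // subrr. Qed.

(** The parameter [t] for which [u + t v] lies on the line [b]. *)
Definition meet b : K := - (dot b u / dot b v).

Let a_neq0 : a != 0.
Proof.
have [[_ _ aw] _ _ _] := fr; apply/eqP => a0; move: aw.
by rewrite a0 dotE !mxE !mul0r !addr0 => /esym/eqP; rewrite oner_eq0.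
Qed.

Let b_neq0 b : b \in L -> b != 0.
Proof. by move/vL; apply: contraNneq => ->; rewrite dotE !mxE !mul0r !addr0. Qed.

Let restr_linb b : b \in L -> restr u v (lin b) = dot b v *: ('X - (meet b)%:P).
Proof.
move=> bL; rewrite restr_lin scalerBr -!mul_polyC -polyCM /meet mulrN polyCN opprK.
by rewrite mulrCA divff ?vL // mulr1 addrC.
Qed.

Lemma frame_expand th i :
  th i = u ord0 i *: pairing x th + v ord0 i *: pairing y th + w ord0 i *: pairing a th.
Proof.
have [_ _ _ zE] := fr.
rewrite /pairing !scaler_sumr -!big_split /=.
rewrite [LHS](_ : _ = \sum_j (i == j)%:R *: th j); last first.
  rewrite (bigD1 i) //= eqxx scale1r big1 ?addr0 // => j /negPf ji.
  by rewrite eq_sym ji scale0r.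
apply: eq_bigr => j _; rewrite !scalerA -!scalerDl; congr (_ *: _).
have dj z : dot z (delta_mx 0 j) = z ord0 j.
  rewrite /dot (bigD1 j) //= !mxE !eqxx mulr1 big1 ?addr0 //.
  by move=> k /negPf kj; rewrite !mxE kj andbF mulr0.
have /rowP/(_ i) := zE (delta_mx 0 j); rewrite !dj !mxE eqxx /= => ->.
by rewrite mulrC [y _ _ * _]mulrC [a _ _ * _]mulrC.
Qed.

(** At the common point of [a] and [b], a derivation tangent to both lines takes a radial value, and
    [wcomp] measures its non-radial part. *)
Lemma wcomp_root m th b : logder (a :: L) m th -> b \in L -> root (wcomp th) (meet b).
Proof.
move=> [thm thd] bL; have [[au av aw] _ _ _] := fr.
rewrite /root /wcomp /tcomp hornerD hornerN hornerM hornerX !horner_restr.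
set t := meet b; set z := (u + t *: v) ord0.
have bz : dot b (u + t *: v) = 0.
  by rewrite dotDr dotZr /t /meet mulNr divfK ?subrr // vL.
have az : dot a (u + t *: v) = 0 by rewrite dotDr dotZr au av mulr0 addr0.
have pz : (pairing b th).@[z] = 0.
  have [|c ->] := thd b; first by rewrite inE bL orbT.
  by rewrite mevalM meval_lin bz mulr0.
have paz : (pairing a th).@[z] = 0.
  have [|c ->] := thd a; first by rewrite mem_head.
  by rewrite mevalM meval_lin az mulr0.
have : (pairing b th).@[z]
    = dot b u * (pairing x th).@[z] + dot b v * (pairing y th).@[z].
  rewrite {1}/pairing (eq_bigr (fun i => (b ord0 i * u ord0 i) *: pairing x th
     + (b ord0 i * v ord0 i) *: pairing y th + (b ord0 i * w ord0 i) *: pairing a th)).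
    rewrite !big_split /= -!scaler_suml !mevalD !mevalZ paz mulr0 addr0.
    by [].
  by move=> i _; rewrite [in LHS](frame_expand th i) !scalerDr !scalerA.
rewrite pz => /esym e; rewrite /t /meet mulNr opprK; apply/eqP.
apply: (mulfI (vL bL)); rewrite mulr0 -[RHS]e mulrDr addrC; congr (_ + _).
by rewrite mulrA mulrCA divff ?mulr1 // vL.
Qed.

Lemma size_wcomp m th : logder (a :: L) m th -> (size (wcomp th) <= m.+2)%N.
Proof.
move=> [thm _]; apply: leq_trans (size_polyD _ _) _; rewrite geq_max.
rewrite (leq_trans (size_restr _ _ (pairing_homog y thm))) //= size_polyN.
apply: leq_trans (size_polyMleq _ _) _; rewrite size_polyX /= ltnS.
exact: size_restr (pairing_homog x thm).
Qed.

(** The witness is the constant vector [z = u + c v] times [g * F], where [F] is the product of the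
    lines of [L] not through [z]. It is tangent to [a] and to the lines through [z] because their
    forms kill [z], and to the others because of [F]. *)
Lemma wcomp_cofactor c : eventually_contains
  (fun N q => exists m th, [/\ N = m.+2, logder (a :: L) m th & wcomp th = q])
  (cofactor (map meet L) c).
Proof.
have [[au av aw] [xu xv xw] [yu yv yw] _] := fr.
pose Lc := [seq b <- L | meet b != c].
pose F := \prod_(b <- Lc) lin b.
pose k := \prod_(b <- Lc) dot b v.
have LcL b : b \in Lc -> b \in L by rewrite mem_filter => /andP[].
have k0 : k != 0.
  rewrite prodf_seq_neq0; apply/allP => b /LcL bL.
  by rewrite vL.
have FE : ('X - c%:P) * restr u v F = k *: cofactor (map meet L) c.
  rewrite /cofactor scalerAr; congr (_ * _).
  rewrite big_map -big_filter -/Lc rmorph_prod /= -scaler_prod.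
  by rewrite big_seq [RHS]big_seq; apply: eq_bigr => b /LcL; exact: restr_linb.
have Fh : F \is (size Lc).-homog.
  rewrite /F; elim: (Lc) => [|b s IHs]; first by rewrite big_nil dhomog1.
  by rewrite big_cons; exact: (dhomogM (lin_homog b) IHs).
have sG : size (cofactor (map meet L) c) = (size Lc).+2.
  rewrite /cofactor big_map -big_filter -/Lc size_mul ?polyXsubC_eq0 ?size_XsubC //.
    by rewrite -(big_map meet xpredT (fun t => 'X - t%:P)) size_prod_XsubC size_map.
  by rewrite prodf_seq_neq0; apply/allP => b _; rewrite polyXsubC_eq0.
exists 2%N => -[//|[//|m]] _ q.
have [->|q0] := eqVneq q 0.
  by move=> _; exists m, 0; split; [|exact: logder0|rewrite wcomp0 mul0r].
rewrite size_mul // -?size_poly_gt0 sG // addnS /= => sq.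
have sq0 : (0 < size q)%N by rewrite size_poly_gt0.
(* [wcomp] of the witness is (c - 'X) times the restriction of [g * F], and [F] restricts to [k]
   times monic linear factors; hence the scalar [- k^-1]. *)
have [|g gh gE] := restr_surj fr (q := - k^-1 *: q) (m := m - size Lc).
  apply: leq_trans (size_scale_leq _ _) _.
  by move: sq sq0; move: (size q) (size Lc) => i j; lia.
pose z := u + c *: v; pose th : V := [ffun i => z ord0 i *: (g * F)].
have gFh : g * F \is m.-homog.
  have := dhomogM gh Fh; rewrite subnK //.
  by move: sq sq0; move: (size q) (size Lc) => i j; lia.
exists m, th; split=> //.
  split=> [i|b]; first by rewrite ffunE rpredZ.
  rewrite pairing_const inE => /predU1P[->|bL].
    by exists 0; rewrite /z dotDr dotZr au av mulr0 addr0 scale0r mul0r.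
  have [bc|bc] := eqVneq (meet b) c.
    exists 0; rewrite /z dotDr dotZr -bc /meet mulNr divfK ?vL // subrr.
    by rewrite scale0r mul0r.
  rewrite -mul_mpolyC; apply: divides_mull; apply: divides_mull.
  have bLc : b \in Lc by rewrite mem_filter bc.
  exists (\prod_(b' <- rem b Lc) lin b'); rewrite mulrC.
  exact: (big_rem b bLc).
rewrite /wcomp /tcomp !pairing_const !restrZ /z !(dotDr, dotZr) xu xv yu yv.
rewrite mulr0 addr0 mulr1 add0r scale1r rmorphM /= gE.
transitivity (- ((- k^-1) *: q * (('X - c%:P) * restr u v F))).
  by rewrite -mul_polyC; ring.
by rewrite FE -scalerAl -scalerAr scalerA mulNr mulVf // scaleN1r opprK.
Qed.

Lemma divides_lin_pairing m th : (forall i, th i \is m.-homog) ->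
  divides (lin a) (pairing a th) -> tcomp th = 0 -> wcomp th = 0 ->
  forall i, divides (lin a) (th i).
Proof.
move=> thm da t0; rewrite /wcomp t0 mulr0 subr0 => w0 i.
rewrite (frame_expand th i) -!mul_mpolyC; apply: divides_add; last exact: divides_mull.
by apply: divides_add; apply: divides_mull;
  apply: (restr_eq0 fr (m := m)) => //; exact: pairing_homog.
Qed.

Let Q : {poly K} := \prod_(t <- undup (map meet L)) ('X - t%:P).
Let h := size (undup (map meet L)).

(** The summands count the derivations restricting to 0, which are [lin a] times those of [L] in
    degree [m]; the radial restrictions, all realized by multiples of the Euler field; and the
    values of [wcomp], which are the multiples of [Q] of size at most [m.+3]. *)
Lemma logder_add_line : exists N, forall m n, (N <= m)%N ->
  has_dim (logder L m) n -> has_dim (logder (a :: L) m.+1) (n + m.+1 + (m.+3 - h)).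
Proof.
have Q0 : Q != 0.
  by rewrite prodf_seq_neq0; apply/allP => t _; rewrite polyXsubC_eq0.
have sQ : size Q = h.+1 by rewrite size_prod_XsubC.
have := eventually_cofactors _ _ wcomp_cofactor.
case=> [N N2|N p q|N0 evQ].
- by case: N N2 => [//|[//|m]] _; exists m, 0; split; [|exact: logder0|].
- move=> [m [th [-> Dth <-]]] [m' [et [[<-] Det <-]]]; exists m, (th + et).
  split=> //; first exact: logderD.
  by rewrite -[th]scale1r wcomp_linear !scale1r.
exists N0 => m n Nm Dn.
apply: (@has_dim_exact K V {poly K} wcomp _
  (fun q : {poly K} => exists2 c : {poly K}, (size c <= m.+3 - h)%N & q = c * Q)) => //.
- apply: (@has_dim_exact K V {poly K} tcomp _ (fun q : {poly K} => (size q <= m.+1)%N)) => //.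
  + apply: (@has_dim_inj K V V (fun th : V => [ffun i => lin a * th i])) Dn.
    * by move=> c th et; apply/ffunP => i; rewrite !ffunE mulrDr scalerAr.
    * move=> th _ /ffunP E; apply/ffunP => i; have /eqP := E i; rewrite !ffunE.
      by rewrite mulf_eq0 (negPf (lin_neq0 a_neq0)) => /eqP.
    move=> th; split.
      case=> -[[thm thd] w0] t0.
      have /choice[et etE] := divides_lin_pairing thm (thd _ (mem_head _ _)) t0 w0.
      have thE : th = [ffun i => lin a * [ffun j => et j] i].
        by apply/ffunP => i; rewrite !ffunE etE mulrC.
      exists [ffun j => et j] => //; split=> [i|b bL].
        rewrite ffunE; have := thm i; rewrite etE.
        move/(homog_cofactor (lin_neq0 a_neq0) (lin_homog a)).
        by rewrite /= subn1.
      have : divides (lin b) (lin a * pairing b [ffun j => et j]).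
        by rewrite -pairing_mul -thE; apply: thd; rewrite inE bL orbT.
      have [_ _ pp] := lin_prime (b_neq0 bL).
      case/pp => // /lin_not_divides []; rewrite crossv_neq0C.
      exact: (allP aL).
    case=> et [etm etd] ->; split; last first.
      by rewrite /tcomp pairing_mul rmorphM /= (restr_lina fr) mul0r.
    split; last by rewrite /wcomp /tcomp !pairing_mul !rmorphM /= (restr_lina fr) !mul0r mulr0 subr0.
    split=> [i|b]; first by rewrite ffunE; exact: (dhomogM (lin_homog a) (etm i)).
    rewrite pairing_mul inE => /predU1P[->|bL].
      by rewrite mulrC; apply: divides_mull; exists 1; rewrite mul1r.
    by apply: divides_mull; exact: etd.
  + exact: poly_has_dim.
  + move=> th et [Dth wth] [Det wet]; split; first exact: logderD.
    by rewrite -[th]scale1r wcomp_linear wth wet scaler0 addr0.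
  + move=> c th [Dth wth]; split; first exact: logderZ.
    by rewrite -[c *: th]addr0 wcomp_linear wth scaler0 wcomp0 addr0.
  + move=> th [[thm thd] w0].
    have := size_restr u v (pairing_homog y thm).
    (* Since [wcomp th = 0], the y-component is ['X * tcomp th], which lowers the size bound on
       [tcomp th] by one. *)
    move/eqP: w0; rewrite subr_eq0 => /eqP ->.
    have [->|t0] := eqVneq (tcomp th) 0; first by rewrite size_poly0.
    by rewrite mulrC size_mulX // ltnS.
  + move=> q sq; have [g gh gE] := restr_surj fr sq.
    have tE : tcomp [ffun i => g * 'X_i] = q.
      by rewrite /tcomp pairing_euler rmorphM /= gE (restr_linx fr) mulr1.
    exists [ffun i => g * 'X_i] => //; split; last first.
      rewrite /wcomp tE pairing_euler rmorphM /= gE (restr_liny fr) mulrC subrr.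
      by [].
    split=> [i|b _]; last by rewrite pairing_euler; exists g.
    have X1 : 'X_i \is [in K[3], 1.-homog] by rewrite dhomogX /= mdeg1.
    by rewrite ffunE mulrC; exact: (dhomogM X1 gh).
- apply: (@has_dim_inj K _ _ (fun c : {poly K} => c * Q)) (poly_has_dim _ _).
  + by move=> c q r; rewrite mulrDl scalerAl.
  + by move=> c _ /eqP; rewrite mulf_eq0 (negPf Q0) orbF => /eqP.
  + by [].
- exact: logderD.
- by move=> c th; exact: logderZ.
- move=> th Dth.
  have /dvdpP[c cE] : Q %| wcomp th.
    apply: uniq_roots_dvdp; last by rewrite uniq_rootsE undup_uniq.
    apply/allP => t; rewrite mem_undup => /mapP[b bL ->].
    exact: wcomp_root Dth bL.
  exists c => //; have [->|c0] := eqVneq c 0; first by rewrite size_poly0.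
  have := size_wcomp Dth; rewrite cE size_mul // sQ addnS /=.
  by move: (size c) => i; lia.
- move=> _ [c sc ->].
  have [|| m' [th [[<-] Dth wE]]] := evQ m.+3 _ c; last by exists th.
    by apply: leq_trans Nm _; lia.
  have [->|c0] := eqVneq c 0; first by rewrite mul0r size_poly0.
  rewrite size_mul // sQ addnS /=; move: c0; rewrite -size_poly_gt0.
  by move: sc; move: (size c) => i; lia.
Qed.

End AddLine.
End LogarithmicDerivations.

(** * Points of the plane and the Tjurina number *)

Section Points.
Variable K : numClosedFieldType.
Implicit Types (a b u v z : 'rV[K]_3) (P : point K) (L : seq 'rV[K]_3).

Lemma base_point_subproof : \dim <[row3 1 0 0 : 'rV[K]_3]>%VS == 1%N.
Proof.
rewrite dim_vline eqb1; apply/eqP => e; have := congr1 (fun z : 'rV[K]_3 => z ord0 0) e.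
by rewrite /= row3E mxE => /eqP; rewrite oner_eq0.
Qed.

Definition base_point : point K := 
  exist (fun P : {vspace 'rV[K]_3} => \dim P == 1%N) _ base_point_subproof.

(* [z = 0] is sent to an arbitrary point *)
Definition point_of z : point K := insubd base_point <[z]>%VS.

Lemma val_point_of z : z != 0 -> val (point_of z) = <[z]>%VS.
Proof. by move=> z0; rewrite insubdK // -topredE /= dim_vline z0. Qed.

Definition rep P : 'rV[K]_3 := vpick (val P).

Lemma rep_neq0 P : rep P != 0.
Proof. by rewrite vpick0 -dimv_eq0; case: P => P /= /eqP ->. Qed.

Lemma val_rep P : val P = <[rep P]>%VS.
Proof.
apply/esym/eqP; rewrite eqEdim -memvE memv_pick dim_vline rep_neq0.
by case: P => P /= /eqP ->.
Qed.

Lemma point_of_rep P : point_of (rep P) = P.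
Proof. by apply: val_inj; rewrite val_point_of ?rep_neq0 // -val_rep. Qed.

Lemma rep_point_of z : z != 0 -> exists2 c, c != 0 & rep (point_of z) = c *: z.
Proof.
move=> z0; have : rep (point_of z) \in val (point_of z) by exact: memv_pick.
rewrite val_point_of // => /vlineP[c cE]; exists c => //.
by apply: contraTneq (rep_neq0 (point_of z)) => c0; rewrite cE c0 scale0r eqxx.
Qed.

Lemma point_of_scale c z : c != 0 -> z != 0 -> point_of (c *: z) = point_of z.
Proof.
move=> c0 z0; apply: val_inj; rewrite !val_point_of ?scaler_eq0 ?negb_or ?c0 //.
apply/eqP; rewrite eqEdim !dim_vline scaler_eq0 (negPf c0) (negPf z0) /= leqnn andbT.
by rewrite -memvE memvZ // memv_line.
Qed.

Definition incident b P := dot b (rep P) == 0.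

Lemma incident_point_of b z : z != 0 -> incident b (point_of z) = (dot b z == 0).
Proof.
move=> /rep_point_of[c c0 zE]; rewrite /incident zE dotZr mulf_eq0.
by rewrite (negPf c0).
Qed.

Lemma vanishes_atE b P : vanishes_at (lin b) P <-> incident b P.
Proof.
split=> [vP|/eqP bP v]; first by rewrite /incident -meval_lin vP ?memv_pick.
by rewrite val_rep => /vlineP[c ->]; rewrite meval_lin dotZr bP mulr0.
Qed.

Lemma cross_kernel a b z : crossv a b != 0 -> dot a z = 0 -> dot b z = 0 ->
  exists c, z = c *: crossv a b.
Proof.
move=> ab az bz.
have /rV0Pn[i wi] := ab; set w := crossv a b in ab wi *.
(* Vector triple product: z x (a x b) = (b.z) a - (a.z) b. *)
have par : crossv z w = 0.
  apply: row3P; rewrite /w !row3E [RHS]mxE.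
  - transitivity (dot b z * a ord0 0 - dot a z * b ord0 0); first by rewrite !dotE; ring.
    by rewrite az bz !mul0r subrr.
  - transitivity (dot b z * a ord0 1 - dot a z * b ord0 1); first by rewrite !dotE; ring.
    by rewrite az bz !mul0r subrr.
  - transitivity (dot b z * a ord0 2 - dot a z * b ord0 2); first by rewrite !dotE; ring.
    by rewrite az bz !mul0r subrr.
clearbody w; exists (z ord0 i / w ord0 i); apply/rowP => j; rewrite mxE mulrAC.
apply: (mulIf wi); rewrite divfK //.
have p01 : z ord0 0 * w ord0 1 = z ord0 1 * w ord0 0.
  by have := congr1 (fun z' : 'rV[K]_3 => z' ord0 2) par; rewrite /= row3E mxE => /eqP; rewrite subr_eq0 => /eqP.
have p12 : z ord0 1 * w ord0 2 = z ord0 2 * w ord0 1.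
  by have := congr1 (fun z' : 'rV[K]_3 => z' ord0 0) par; rewrite /= row3E mxE => /eqP; rewrite subr_eq0 => /eqP.
have p20 : z ord0 2 * w ord0 0 = z ord0 0 * w ord0 2.
  by have := congr1 (fun z' : 'rV[K]_3 => z' ord0 1) par; rewrite /= row3E mxE => /eqP; rewrite subr_eq0 => /eqP.
move: i {wi} j; apply: ord3P; apply: ord3P; by rewrite ?p01 ?p12 ?p20.
Qed.

Lemma incident_meet a b P : crossv a b != 0 ->
  (incident a P && incident b P) = (P == point_of (crossv a b)).
Proof.
move=> ab; apply/andP/eqP => [[/eqP aP /eqP bP]|->]; last first.
  by rewrite !incident_point_of // crossv_dotl crossv_dotr eqxx.
have [c cE] := cross_kernel ab aP bP.
rewrite -{1}(point_of_rep P) cE point_of_scale //.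
by apply: contraTneq (rep_neq0 P) => c0; rewrite cE c0 scale0r eqxx.
Qed.

Definition meets a L := undup [seq point_of (crossv a b) | b <- L].

(** The sum of the Milnor numbers (k-1)^2 of the k-fold points, built line by line; as the new line
    carries at most [size L'] intersection points, the subtraction is not truncated. *)
Fixpoint milnor_sum L : nat :=
  if L is a :: L' then (milnor_sum L' + ((size L').*2 - size (meets a L')))%N else 0%N.

Lemma size_meets a L : (size (meets a L) <= size L)%N.
Proof. by apply: leq_trans (size_undup _) _; rewrite size_map. Qed.

Lemma size_undup_map (T : eqType) (U1 U2 : eqType) (f : T -> U1) (g : T -> U2) s :
  {in s &, forall i j, (f i == f j) = (g i == g j)} ->
  size (undup (map f s)) = size (undup (map g s)).
Proof.
elim: s => //= i s IHs fg.
have -> : (f i \in map f s) = (g i \in map g s).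
  apply/mapP/mapP => -[j js E]; exists j => //; apply/eqP; [rewrite -fg|rewrite fg];
    by rewrite ?inE ?E ?eqxx ?js ?orbT.
have IH := IHs (fun j k js ks => fg j k (mem_behead (s := i :: s) js) (mem_behead (s := i :: s) ks)).
by case: ifP => _ /=; rewrite IH.
Qed.

(** As [v] lies on no line of [L], all intersection points have finite parameters, and distinct
    parameters give distinct points. This identifies the geometric count with the degree of [Q]. *)
Lemma size_meets_frame a u v x y w L : frame a u v x y w ->
  (forall b, b \in L -> dot b v != 0) -> all (fun b => crossv a b != 0) L ->
  size (meets a L) = size (undup (map (meet u v) L)).
Proof.
move=> fr vL /allP aL; apply: size_undup_map => b b' bL b'L.
have [[au av aw] [xu xv xw] [yu yv yw] zE] := fr.
have on c : dot a (u + c *: v) = 0 by rewrite dotDr dotZr au av mulr0 addr0.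
have ptE b0 : b0 \in L -> point_of (crossv a b0) = point_of (u + meet u v b0 *: v).
  move=> b0L; apply/esym/eqP; rewrite -incident_meet ?aL //.
  have z0 : u + meet u v b0 *: v != 0.
    apply/eqP => z0; have := dotDr x u (meet u v b0 *: v).
    rewrite z0 dotZr xu xv mulr0 addr0 dotE !mxE !mulr0 !addr0 => /esym/eqP.
    by rewrite oner_eq0.
  rewrite !incident_point_of // on eqxx dotDr dotZr /meet mulNr divfK ?vL //.
  by rewrite subrr eqxx.
rewrite !ptE //; apply/eqP/eqP => [|-> //].
set c := meet u v b; set c' := meet u v b' => E.
have n0 c0 : u + c0 *: v != 0.
  apply/eqP => z0; have := dotDr x u (c0 *: v).
  rewrite z0 dotZr xu xv mulr0 addr0 dotE !mxE !mulr0 !addr0 => /esym/eqP.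
  by rewrite oner_eq0.
have := congr1 val E; rewrite !val_point_of // => VE.
have : u + c *: v \in <[u + c' *: v]>%VS by rewrite -VE memv_line.
case/vlineP => k kE.
have k1 : k = 1.
  have := congr1 (dot x) kE; rewrite !(dotDr, dotZr) xu xv !mulr0 !addr0 mulr1.
  by [].
have := congr1 (dot y) kE; rewrite k1 scale1r !(dotDr, dotZr) yu yv !add0r !mulr1.
by [].
Qed.

Lemma homog_triple_has_dim m :
  has_dim (fun th : {ffun 'I_3 -> {mpoly K[3]}} => forall i, th i \is m.-homog)
    (3 * 'C(m.+2, 2)).
Proof.
have lin_at (i : 'I_3) : linear (fun th : {ffun 'I_3 -> {mpoly K[3]}} => th i).
  by move=> c th et; rewrite !ffunE.
have single (i : 'I_3) (p : {mpoly K[3]}) : p \is m.-homog ->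
    forall j, [ffun j => if j == i then p else 0] j \is m.-homog.
  by move=> pm j; rewrite ffunE; case: ifP => // _; rewrite rpred0.
rewrite (_ : (3 * _ = 0 + 'C(m.+2, 2) + 'C(m.+2, 2) + 'C(m.+2, 2))%N); last by lia.
have HD := homog_has_dim K m.
apply: (has_dim_exact (lin_at 0) _ HD).
- apply: (has_dim_exact (lin_at 1) _ HD).
  + apply: (has_dim_exact (lin_at 2) _ HD).
    * apply: eq_has_dim (has_dim_zero _) => th; split=> [->|[[[_ t0] t1] t2]].
        by rewrite !ffunE; split=> //; split=> //; split=> // i; rewrite ffunE rpred0.
      apply/ffunP => i; rewrite [RHS]ffunE; move: i.
      exact: ord3P.
    * move=> th et [[h1 a1] b1] [[h2 a2] b2]; rewrite /= !ffunE a1 a2 b1 b2 addr0.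
      by split=> //; split=> // i; rewrite ffunE rpredD.
    * move=> c th [[h1 a1] b1]; rewrite /= !ffunE a1 b1 scaler0.
      by split=> //; split=> // i; rewrite ffunE rpredZ.
    * by move=> th [[h1 _] _].
    * move=> p pm; exists [ffun j => if j == 2 then p else 0]; rewrite ?ffunE //.
      by split; [split; [exact: single|]|].
  + move=> th et [h1 a1] [h2 a2]; rewrite /= !ffunE a1 a2 addr0.
    by split=> // i; rewrite ffunE rpredD.
  + move=> c th [h1 a1]; rewrite /= !ffunE a1 scaler0.
    by split=> // i; rewrite ffunE rpredZ.
  + by move=> th [h1 _].
  + move=> p pm; exists [ffun j => if j == 1 then p else 0]; rewrite ?ffunE //.
    by split; [exact: single|].
- by move=> th et h1 h2 i; rewrite ffunE rpredD.
- by move=> c th h1 i; rewrite ffunE rpredZ.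
- by move=> th h1.
- by move=> p pm; exists [ffun j => if j == 0 then p else 0]; rewrite ?ffunE //; exact: single.
Qed.

(** Writing degrees as [m + size L] absorbs the degree shift in the kernel of restriction, one for
    each added line, so that [m] stays fixed in the induction. *)
Lemma logder_dim L : indep_lines L -> all (fun a => a != 0) L ->
  exists N, forall m, (N <= m)%N -> has_dim (logder L (m + size L))
    (3 * 'C(m.+2, 2) + (size L).*2 * m.+2 + milnor_sum L).
Proof.
elim: L => [|a L IHL].
  move=> _ _; exists 0%N => m _ /=; rewrite !addn0.
  apply: eq_has_dim (homog_triple_has_dim m) => th.
  by split=> [h|[h _] //]; split.
rewrite /indep_lines /= => /andP[aL iL] /andP[a0 L0].
have [u [v [x [y [w [fr vL]]]]]] := frame_avoid a0 aL.
have [N1 H1] := IHL iL L0; have [N2 H2] := logder_add_line fr vL aL.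
exists (maxn N1 N2) => m; rewrite geq_max => /andP[m1 m2].
have := H2 _ _ (leq_trans m2 (leq_addr (size L) m)) (H1 m m1).
rewrite -(size_meets_frame fr) // addnS.
have := size_meets a L; move: (size (meets a L)) (size L) (milnor_sum L) => h k t hk.
(* With [k] old lines the new one adds (m + k + 1) + (m + k + 3 - h) = 2(m + 2) + (2k - h): the
   linear term and the increment of [milnor_sum]. *)
rewrite doubleS [(_.*2.+2 * _)%N]mulSn [(_.*2.+1 * _)%N]mulSn; move: ('C(m.+2, 2)) (k.*2 * m.+2)%N => c e.
rewrite [X in has_dim _ X -> _](_ : _ = 3 * c + (m.+2 + (m.+2 + e)) + (t + (k.*2 - h)))%N; first by rewrite addnS.
lia.
Qed.

End Points.

(** * The Tjurina number as a sum over successive lines *)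

Section Tjurina.
Variable K : numClosedFieldType.
Implicit Types (a b v : 'rV[K]_3) (P : point K) (L : seq 'rV[K]_3).

Definition mult L P := count (fun b => incident b P) L.

(** A point of [a] on k > 0 lines of [L] gains k^2 - (k-1)^2 = 2k - 1. Over the points of [a] the k
    add up to [size L], as each line meets [a] once, and the 1 count the points of [meets a L].
    Further points in [pts] lie on at most one line and contribute nothing. *)
Lemma milnor_sumE L (pts : seq (point K)) : uniq pts -> indep_lines L ->
  {in L &, forall a b, crossv a b != 0 -> point_of (crossv a b) \in pts} ->
  milnor_sum L = (\sum_(P <- pts) (mult L P).-1 ^ 2)%N.
Proof.
move=> upts; elim: L => [|a L IHL] /=.
  by move=> _ _; rewrite big1.
rewrite /indep_lines /= => /andP[/allP aL iL] Lpts.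
rewrite IHL //; last by move=> b c bL cL; apply: Lpts; rewrite inE ?bL ?cL orbT.
have ptsa b : b \in L -> point_of (crossv a b) \in pts.
  by move=> bL; apply: Lpts (aL _ bL); rewrite inE ?eqxx ?bL ?orbT.
have sumL : (\sum_(P <- pts | incident a P) mult L P = size L)%N.
  rewrite /mult; under eq_bigr => P _ do rewrite -sum1_count big_mkcond.
  rewrite exchange_big /= -sum1_size big_seq [RHS]big_seq; apply: eq_bigr => b bL.
  rewrite -big_mkcondr /= (eq_bigl (pred1 (point_of (crossv a b)))); last first.
    by move=> P /=; rewrite incident_meet // aL.
  by rewrite -big_filter filter_pred1_uniq ?ptsa // big_seq1.
have sumh : (\sum_(P <- pts | incident a P) (0 < mult L P) = size (meets a L))%N.
  rewrite -big_mkcondr /= sum1_count -size_filter; apply/perm_size/uniq_perm.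
  - exact: filter_uniq.
  - exact: undup_uniq.
  move=> P; rewrite mem_filter mem_undup; apply/andP/mapP => [[/andP[aP] mP Ppts]|].
    have : has (fun b => incident b P) L by rewrite has_count.
    case/hasP => b bL bP; exists b => //.
    by apply/eqP; rewrite -incident_meet ?aL // aP.
  case=> b bL ->; rewrite ptsa //; split=> //.
  have /andP[-> bP] : incident a (point_of (crossv a b)) && incident b (point_of (crossv a b)).
    by rewrite incident_meet ?aL.
  by rewrite -has_count; apply/hasP; exists b.
rewrite -sumL -sumh -mul2n big_distrr /= -sumnB; last first.
  by move=> P _; case: (mult L P) => // k; lia.
rewrite [X in (_ + X)%N]big_mkcond -big_split; apply: eq_bigr => P _ /=.
rewrite /mult /=; case: (incident a P) => /=; last by rewrite addn0 !add0n.
by rewrite add0n; case: (count _ _) => //= k; rewrite !expnS expn0; lia.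
Qed.

Lemma crossv0_dot a b v : a != 0 -> crossv a b = 0 -> dot a v = 0 -> dot b v = 0.
Proof.
move=> /rV0Pn[i ai] ab av; apply: (mulfI ai); rewrite mulr0.
suff -> : a ord0 i * dot b v = b ord0 i * dot a v by rewrite av mulr0.
have E k := congr1 (fun z : 'rV[K]_3 => z ord0 k) ab.
have e01 : a ord0 0 * b ord0 1 = a ord0 1 * b ord0 0.
  by have := E 2; rewrite /= row3E mxE => /eqP; rewrite subr_eq0 => /eqP.
have e12 : a ord0 1 * b ord0 2 = a ord0 2 * b ord0 1.
  by have := E 0; rewrite /= row3E mxE => /eqP; rewrite subr_eq0 => /eqP.
have e20 : a ord0 2 * b ord0 0 = a ord0 0 * b ord0 2.
  by have := E 1; rewrite /= row3E mxE => /eqP; rewrite subr_eq0 => /eqP.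
rewrite !dotE !mulrDr !mulrA; move: i {ai}; apply: ord3P.
- by rewrite e01 -e20 [b ord0 0 * a _ _]mulrC ![b ord0 0 * _]mulrC.
- by rewrite -e01 e12 ![b ord0 1 * _]mulrC.
- by rewrite e20 -e12 ![b ord0 2 * _]mulrC.
Qed.

Variables (d : nat) (l : 'I_d -> {mpoly K[3]}).
Hypothesis hl : line_arrangement l.

Definition line_coef (i : 'I_d) : 'rV[K]_3 := \row_j (l i)@_U_(j).
Definition lines : seq 'rV[K]_3 := map line_coef (enum 'I_d).

Lemma line_coefE i : l i = lin (line_coef i).
Proof. by apply: homog1_lin; case: hl => /(_ i)[]. Qed.

Lemma line_coef_neq0 i : line_coef i != 0.
Proof.
have [_] := hl.1 i; apply: contraNneq; rewrite line_coefE => ->.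
by rewrite /lin big1 // => j _; rewrite mxE scale0r.
Qed.

Lemma line_coef_indep i j : i != j -> crossv (line_coef i) (line_coef j) != 0.
Proof.
apply: contraNneq => c0; apply/eqP; apply: (hl.2); apply/seteqP.
have dotP k k' : crossv (line_coef k) (line_coef k') = 0 ->
    (zero_locus (l k) `<=` zero_locus (l k'))%classic.
  move=> kk P /=; rewrite /zero_locus /= !line_coefE => vP v vPin.
  rewrite meval_lin; apply: (crossv0_dot (line_coef_neq0 k)) => //.
  by rewrite -meval_lin; exact: vP.
by split; apply: dotP => //; rewrite crossvC c0 oppr0.
Qed.

Lemma lines_indep : indep_lines lines.
Proof.
rewrite /indep_lines pairwise_map; have := enum_uniq 'I_d.
elim: (enum 'I_d) => //= i s IHs /andP[i_s us]; rewrite IHs // andbT.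
by apply/allP => j js; apply: line_coef_indep; apply: contraNneq i_s => ->.
Qed.

Lemma lines_neq0 : all (fun a => a != 0) lines.
Proof. by apply/allP => _ /mapP[i _ ->]; exact: line_coef_neq0. Qed.

Lemma size_lines : size lines = d.
Proof. by rewrite size_map size_enum_ord. Qed.

Lemma arr_polyE : arr_poly l = \prod_(a <- lines) lin a.
Proof.
by rewrite big_map /arr_poly big_enum; apply: eq_bigr => i _; exact: line_coefE.
Qed.

Lemma mult_linesE P : #|[set i : 'I_d | `[< vanishes_at (l i) P >]]%SET| = mult lines P.
Proof.
rewrite /mult count_map -sum1_count big_enum_cond -sum1_card; apply: eq_bigl => i /=.
by rewrite inE; apply/asboolP/idP; rewrite line_coefE => /vanishes_atE.
Qed.

Lemma tjurinaE : tjurina l = milnor_sum lines.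
Proof.
(* Pairs with [a = b] yield [point_of 0], the default point; this is harmless, since only its actual
   multiplicity enters. *)
pose pts := undup [seq point_of (crossv a b) | a <- lines, b <- lines].
have ptsP : {in lines &, forall a b, crossv a b != 0 -> point_of (crossv a b) \in pts}.
  by move=> a b aL bL _; rewrite mem_undup; apply: allpairs_f.
rewrite (milnor_sumE (undup_uniq _) lines_indep ptsP) /tjurina.
have nE k : (2 <= k)%N -> npoints l k = (\sum_(P <- pts) (mult lines P == k))%N.
  move=> k2; rewrite /npoints.
  (* For [k >= 2] the set is finite, because its points are intersections of two lines; so
     [fset_set] does not return its default. *)
  have -> : mult_points l k = [set` [fset P in [seq P <- pts | mult lines P == k]]%fset]%classic.
    apply/seteqP; split=> P; rewrite /mult_points /= mult_linesE; last first.
      by rewrite inE /= mem_filter => /andP[/eqP].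
      move=> mk; rewrite inE /= mem_filter mk eqxx /=.
      have : (1 < mult lines P)%N by rewrite mk.
      rewrite /mult; have := lines_indep; rewrite /indep_lines => il m1.
      have [a [b [aL bL ab aP bP]]] : exists a b,
          [/\ a \in lines, b \in lines, crossv a b != 0, incident a P & incident b P].
        elim: lines il m1 => //= a s IHs /andP[/allP al il].
        case aP: (incident a P); rewrite /= ?add1n ?add0n.
          rewrite ltnS -has_count => /hasP[b bs bP].
          by exists a, b; rewrite !inE eqxx bs orbT aP bP al.
        move=> /(IHs il)[b [c [bs cs bc bP cP]]].
        by exists b, c; rewrite !inE bs cs !orbT.
      suff -> : P = point_of (crossv a b) by exact: ptsP.
      by apply/eqP; rewrite -incident_meet // aP.
  rewrite set_fsetK card_fseq undup_id ?filter_uniq ?undup_uniq //.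
  by rewrite size_filter -sum1_count big_mkcond.
under eq_big_nat => k /andP[k2 _] do rewrite (nE k k2) big_distrl /=.
rewrite exchange_big /=; apply: eq_bigr => P _.
have mP : (mult lines P <= d)%N by rewrite -[leqRHS]size_lines count_size.
case: (leqP 2 (mult lines P)) => m2.
  rewrite (bigD1_seq (mult lines P)) ?iota_uniq ?mem_index_iota ?m2 //=.
  rewrite eqxx mul1n big1 ?addn0 // => k /negPf km.
  by rewrite eq_sym km.
rewrite big_nat big1 => [|k /andP[k2 _]].
  by move: m2; case: (mult lines P) => [|[]].
by rewrite ltn_eqF ?mul0n // (leq_trans m2).
Qed.

End Tjurina.

(** * Syzygies of the Jacobian ideal and the ideal I *)

Section GradientAndDeterminant.
Variable K : numClosedFieldType.
Local Notation S := {mpoly K[3]}.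
Implicit Types (a b v : 'rV[K]_3) (p q : S) (s t : 'I_3 -> S) (L : seq 'rV[K]_3).

Lemma deriv_homog (i : 'I_3) p m : p \is m.-homog -> p^`M(i) \is m.-1.-homog.
Proof.
move=> /dhomogP pm; apply/dhomogP => k; rewrite mcoeff_msupp mcoeff_deriv => pk.
have /pm /= : (k + U_(i))%MM \in msupp p.
  by rewrite mcoeff_msupp; apply: contraNneq pk => ->; rewrite mul0rn.
by rewrite mdegD mdeg1 addn1 => <-.
Qed.

Definition grad t p : S := \sum_i t i * p^`M(i).

Lemma gradM t p q : grad t (p * q) = grad t p * q + p * grad t q.
Proof.
rewrite /grad mulr_suml mulr_sumr -big_split; apply: eq_bigr => i _ /=.
by rewrite mderivM; ring.
Qed.

Lemma grad_lin (th : {ffun 'I_3 -> S}) a : grad th (lin a) = pairing a th.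
Proof.
apply: eq_bigr => i _; have -> : (lin a)^`M(i) = (a ord0 i)%:MP.
  rewrite /lin raddf_sum (bigD1 i) //= mderivZ mderivX mnm1E eqxx big1 ?addr0.
    rewrite scale1r -[RHS]mulr1 mul_mpolyC; congr (_ *: _).
    by rewrite (_ : (U_(i) - U_(i))%MM = 0%MM) ?mpolyX0 //; apply/mnmP => j; rewrite mnmBE subnn mnm0E.
  by move=> j ji; rewrite mderivZ mderivX mnm1E (negPf ji) scale0r scaler0.
by rewrite mulrC mul_mpolyC.
Qed.

Lemma grad_prod_divides (th : {ffun 'I_3 -> S}) L :
  (forall a, a \in L -> divides (lin a) (pairing a th)) ->
  divides (\prod_(a <- L) lin a) (grad th (\prod_(a <- L) lin a)).
Proof.
elim: L => [|a L IHL] dL.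
  by rewrite big_nil; exists (grad th 1); rewrite mulr1.
rewrite big_cons gradM grad_lin; apply: divides_add.
  have [q ->] := dL a (mem_head _ _).
  by exists q; rewrite mulrA.
have [|q ->] := IHL; first by move=> b bL; apply: dL; rewrite inE bL orbT.
by exists q; rewrite mulrCA mulrA.
Qed.

(** Modulo [lin a], the Leibniz rule leaves only the term in which [lin a] is differentiated, and
    the product of the other forms is prime to [lin a]. *)
Lemma divides_pairing (th : {ffun 'I_3 -> S}) L a :
  indep_lines L -> all (fun a => a != 0) L -> a \in L ->
  divides (\prod_(a <- L) lin a) (grad th (\prod_(a <- L) lin a)) ->
  divides (lin a) (pairing a th).
Proof.
move=> iL /allP L0 aL; have a0 := L0 _ aL.
have aF : all (fun b => crossv a b != 0) (rem a L).
  move: iL; rewrite /indep_lines => iL.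
  elim: L iL {L0} aL => //= b L IHL /andP[/allP bL iL].
  have [<-|ba] := eqVneq b a => [_|]; first by apply/allP.
  rewrite inE eq_sym (negPf ba) /= => aL; rewrite IHL // andbT.
  by rewrite crossv_neq0C bL.
rewrite (big_rem a) //= gradM grad_lin => -[q qE].
have : divides (lin a) (pairing a th * \prod_(b <- rem a L) lin b).
  exists (q * \prod_(b <- rem a L) lin b - grad th (\prod_(b <- rem a L) lin b)).
  rewrite -[LHS](addrK (lin a * grad th (\prod_(b <- rem a L) lin b))) qE mulrBl.
  by rewrite -mulrA [lin a * \prod_(b <- _) _]mulrC [lin a * grad _ _]mulrC.
have [_ _ pp] := lin_prime a0; case/pp => // dF.
by case: (lin_divides_prod a0 aF).
Qed.

Lemma grad_euler L p (F := \prod_(a <- L) lin a) :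
  grad (fun i => p * 'X_i) F = (size L)%:R * p * F.
Proof.
rewrite /F; elim: L {F} => [|a L IHL].
  rewrite big_nil !mul0r /grad big1 // => i _.
  by rewrite -mpolyC1 mderivC mulr0.
rewrite big_cons gradM IHL.
have -> : grad (fun i => p * 'X_i) (lin a) = p * lin a.
  by rewrite -pairing_euler -grad_lin; apply: eq_bigr => i _; rewrite ffunE.
rewrite (_ : size (a :: L) = size L + 1)%N; last by rewrite addn1.
by rewrite natrD; ring.
Qed.

Definition det_euler s t : S :=
  'X_0 * (s 1 * t 2 - s 2 * t 1) + 'X_1 * (s 2 * t 0 - s 0 * t 2)
  + 'X_2 * (s 0 * t 1 - s 1 * t 0).

Lemma linE a : lin a = a ord0 0 *: 'X_0 + a ord0 1 *: 'X_1 + a ord0 2 *: 'X_2.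
Proof. exact: big_ord3. Qed.

Lemma pairingE a (th : {ffun 'I_3 -> S}) :
  pairing a th = a ord0 0 *: th 0 + a ord0 1 *: th 1 + a ord0 2 *: th 2.
Proof. exact: big_ord3. Qed.

(* Cramer's rule for the matrix with rows the Euler field, [s] and [t] *)
Lemma det_euler_divides a (s t : {ffun 'I_3 -> S}) : a != 0 ->
  divides (lin a) (pairing a s) -> divides (lin a) (pairing a t) ->
  divides (lin a) (det_euler s t).
Proof.
move=> a0 ds dt; have /rV0Pn[i ai] := a0.
suff H : divides (lin a) ((a ord0 i)%:MP * det_euler s t).
  have := divides_mull (a ord0 i)^-1%:MP H.
  by rewrite mulrA -mpolyCM mulVf // mul1r.
have E : (a ord0 i)%:MP * det_euler s t = [:: s 1 * t 2 - s 2 * t 1; s 2 * t 0 - s 0 * t 2;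
      s 0 * t 1 - s 1 * t 0]`_i * lin a
    + [:: t 1 * 'X_2 - t 2 * 'X_1; t 2 * 'X_0 - t 0 * 'X_2; t 0 * 'X_1 - t 1 * 'X_0]`_i
      * pairing a s
    + [:: 'X_1 * s 2 - 'X_2 * s 1; 'X_2 * s 0 - 'X_0 * s 2; 'X_0 * s 1 - 'X_1 * s 0]`_i
      * pairing a t.
  rewrite linE !pairingE -!mul_mpolyC /det_euler; move: i {ai}.
  by apply: ord3P => /=; ring.
rewrite E; apply: divides_add; last exact: divides_mull.
by apply: divides_add; apply: divides_mull => //; exists 1; rewrite mul1r.
Qed.

(* Both [s] and [t] are orthogonal to the gradient of [p], hence their cross
   product is parallel to it. *)
Lemma cross_parallel_grad (s t : 'I_3 -> S) p : grad s p = 0 -> grad t p = 0 ->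
  let c := fun i j => s i * t j - s j * t i in
  let e := grad (fun i => 'X_i) p in
  let h := det_euler s t in
  [/\ c 1 2 * e = h * p^`M(0), c 2 0 * e = h * p^`M(1) & c 0 1 * e = h * p^`M(2)].
Proof.
rewrite /grad !big_ord3 /det_euler /= => E1 E2.
move: (p^`M(0)) (p^`M(1)) (p^`M(2)) E1 E2 => g0 g1 g2 E1 E2.
split; apply/eqP; rewrite -subr_eq0; apply/eqP.
- transitivity (('X_1 * t 2 - 'X_2 * t 1) * (s 0 * g0 + s 1 * g1 + s 2 * g2)
    - ('X_1 * s 2 - 'X_2 * s 1) * (t 0 * g0 + t 1 * g1 + t 2 * g2)); first by ring.
  by rewrite E1 E2; ring.
- transitivity (('X_2 * t 0 - 'X_0 * t 2) * (s 0 * g0 + s 1 * g1 + s 2 * g2)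
    - ('X_2 * s 0 - 'X_0 * s 2) * (t 0 * g0 + t 1 * g1 + t 2 * g2)); first by ring.
  by rewrite E1 E2; ring.
- transitivity (('X_0 * t 1 - 'X_1 * t 0) * (s 0 * g0 + s 1 * g1 + s 2 * g2)
    - ('X_0 * s 1 - 'X_1 * s 0) * (t 0 * g0 + t 1 * g1 + t 2 * g2)); first by ring.
  by rewrite E1 E2; ring.
Qed.

Lemma det_euler_homog s t m n : (forall i, s i \is m.-homog) ->
  (forall i, t i \is n.-homog) -> det_euler s t \is (1 + (m + n)).-homog.
Proof.
move=> sm tn; have X1 (i : 'I_3) : 'X_i \is [in K[3], 1.-homog] by rewrite dhomogX /= mdeg1.
have h i j : s i * t j \is (m + n).-homog by exact: dhomogM.
by rewrite /det_euler !rpredD //; apply: dhomogM => //; rewrite rpredB.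
Qed.

Lemma det_euler_piE s t m k : (forall i, s i \is m.-homog) ->
  pihomog mdeg k (det_euler s t) =
    if (m.+1 <= k)%N then det_euler s (fun i => pihomog mdeg (k - m.+1) (t i)) else 0.
Proof.
move=> sm; have X1 (i : 'I_3) : 'X_i \is [in K[3], 1.-homog] by rewrite dhomogX /= mdeg1.
have Xs i j : 'X_i * s j \is (m.+1).-homog by exact: (dhomogM (X1 i) (sm j)).
have E (t' : 'I_3 -> S) : det_euler s t' = t' 0 * ('X_1 * s 2) - t' 0 * ('X_2 * s 1)
    + (t' 1 * ('X_2 * s 0) - t' 1 * ('X_0 * s 2)) + (t' 2 * ('X_0 * s 1) - t' 2 * ('X_1 * s 0)).
  by rewrite /det_euler; ring.
rewrite (E t) !(pihomogD, pihomogN) !(pihomog_mulr _ _ (Xs _ _)).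
by case: ifP => _; [rewrite E | rewrite !(subr0, addr0)].
Qed.

Lemma det_euler_linear s c t t' :
  det_euler s (fun i => c * t i + t' i) = c * det_euler s t + det_euler s t'.
Proof. by rewrite /det_euler; ring. Qed.

End GradientAndDeterminant.

Section ParallelVectors.
Variable R : idomainType.
Hypothesis ufdR : ufd R.

(** One starts from a t = b s with [a] a nonzero coordinate of [s]. A prime factor of [a] divides
    every b s_j but not every s_j, so it divides [b] and cancels, until [a] is a unit. *)
Lemma parallel_multiple n (s t : 'I_n -> R) :
  (exists i, s i != 0) ->
  (forall p, prime_elt p -> ~ forall i, divides p (s i)) ->
  (forall i j, s i * t j = s j * t i) -> exists c, forall i, t i = c * s i.
Proof.
move=> [i0 si0] prim st.
suff H a b : a != 0 -> (forall j, a * t j = b * s j) -> exists c, forall j, t j = c * s j.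
  by apply: (H _ (t i0) si0) => j; rewrite st mulrC.
move=> a0; have [u [q [uU qP ->]]] := ufdR a0.
elim: q b qP => [|p q IHq] b qP E.
  exists (u^-1 * b) => j; rewrite -mulrA -E big_nil mulr1 mulrA mulVr // mul1r.
  by [].
have pp : prime_elt p by apply: qP; rewrite mem_head.
have [p0 _ pdvd] := pp.
have [[b' bE]|npb] := pselect (divides p b).
  apply: (IHq b'); first by move=> x xq; apply: qP; rewrite inE xq orbT.
  move=> j; apply: (mulIf p0); have := E j; rewrite bE big_cons => E'.
  transitivity (u * (p * \prod_(j <- q) j) * t j); first by ring.
  by rewrite E'; ring.
case: (prim _ pp) => j; have [|//|//] := pdvd b (s j).
by exists (u * (\prod_(j <- q) j) * t j); rewrite -E big_cons; ring.
Qed.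

End ParallelVectors.

Section LinearImage.
Variables (A : nzRingType) (M : lmodType A).

Definition linear_image (psi : {linear M -> A^o}) : {pred A^o} :=
  [pred h : A^o | `[< exists u, psi u = h >]].

Lemma linear_imageP (psi : {linear M -> A^o}) h :
  reflect (exists u, psi u = h) (h \in linear_image psi).
Proof. by rewrite inE; exact: asboolP. Qed.

Lemma linear_image_submod_closed (psi : {linear M -> A^o}) :
  submod_closed (linear_image psi).
Proof.
split=> [|a u v]; first by apply/linear_imageP; exists 0; rewrite raddf0.
move=> /linear_imageP[x <-] /linear_imageP[y <-].
by apply/linear_imageP; exists (a *: x + y); rewrite linearP.
Qed.

HB.instance Definition _ (psi : {linear M -> A^o}) :=
  GRing.isSubmodClosed.Build A A^o (linear_image psi)
    (linear_image_submod_closed psi).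

End LinearImage.

Lemma mcoeff_pihomog (K : fieldType) n (p : {mpoly K[n]}) m k :
  (pihomog mdeg m p)@_k = if mdeg k == m then p@_k else 0.
Proof.
have H (i : nat) : mdeg k != i -> (pihomog mdeg i p)@_k = 0.
  by apply: dhomog_nemf_coeff; exact: pihomogP.
case: eqP => [<-|/eqP]; last exact: H.
pose N := maxn (msize p) (mdeg k).+1.
rewrite [in RHS](pihomog_partitionE (k := N) (mf := mdeg) (p := p)) ?leq_maxl //.
have kN : (mdeg k < N)%N by rewrite leq_maxr.
rewrite [RHS](raddf_sum (mcoeff k)) (bigD1 (Ordinal kN)) //= big1 ?addr0 // => i ik.
by apply: H; apply: contraNneq ik => ki; apply/eqP/val_inj.
Qed.

Section SyzygyPairing.
Variables (K : numClosedFieldType) (d r : nat) (l : 'I_d -> {mpoly K[3]}).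
Local Notation S := {mpoly K[3]}.
Local Notation f := (arr_poly l).
Hypothesis hl : line_arrangement l.
Hypothesis hr : is_mdr f r.
Hypothesis r_ge1 : (1 <= r)%N.
Variable rho : AR f.
Hypothesis rho_deg : AR_gr r%:Z rho.
Hypothesis rho_neq0 : rho != 0.
Implicit Types u : AR f.

Lemma arr_poly_homog : f \is d.-homog.
Proof.
have : \prod_(a <- lines l) lin a \is (size (lines l)).-homog.
  elim: (lines l) => [|a L IHL]; first by rewrite big_nil dhomog1.
  by rewrite big_cons; exact: (dhomogM (lin_homog a) IHL).
by rewrite -(arr_polyE hl) size_lines.
Qed.

Lemma arr_poly_neq0 : f != 0.
Proof. by apply/prodf_neq0 => i _; case: (hl.1 i). Qed.

Definition coord_of u (i : 'I_3) : S := val u ord0 i.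

Definition triple_of u : {ffun 'I_3 -> S} := [ffun i => coord_of u i].

Lemma syzygyP (w : 'rV[S]_3) : reflect (grad (w ord0) f = 0) (w \in syzygies f).
Proof. by rewrite inE; exact: eqP. Qed.

Lemma AR_grad u : grad (coord_of u) f = 0.
Proof. by apply/syzygyP; case: u. Qed.

Lemma AR_ext u v : (forall i, coord_of u i = coord_of v i) -> u = v.
Proof. by move=> uv; apply: val_inj; apply/rowP. Qed.

Lemma coord_lin a u v i : coord_of (a *: u + v) i = a * coord_of u i + coord_of v i.
Proof. by rewrite /coord_of [val _]linearP !mxE. Qed.

Lemma coordZ a u i : coord_of (a *: u) i = a * coord_of u i.
Proof. by rewrite /coord_of [val _]linearZ !mxE. Qed.

Lemma coordD u v i : coord_of (u + v) i = coord_of u i + coord_of v i.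
Proof. by rewrite /coord_of [val _]raddfD !mxE. Qed.

Lemma coord0 i : coord_of 0 i = 0.
Proof. by rewrite /coord_of [val _]raddf0 !mxE. Qed.

Lemma coordB u v i : coord_of (u - v) i = coord_of u i - coord_of v i.
Proof. by rewrite /coord_of [val _]raddfB !mxE. Qed.

Lemma AR_make (t : 'I_3 -> S) : grad t f = 0 -> exists u, forall i, coord_of u i = t i.
Proof.
move=> t0; have h : (\row_i t i) \in syzygies f.
  by apply/syzygyP; rewrite -[RHS]t0; apply: eq_bigr => i _; rewrite mxE.
by exists (ARSyzygy h) => i; rewrite /coord_of /= mxE.
Qed.

Lemma rho_homog i : coord_of rho i \is r.-homog.
Proof. exact: rho_deg. Qed.

Lemma AR_neq0 u : u != 0 -> exists i, coord_of u i != 0.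
Proof.
move=> u0; apply: contrapT => nu; case/eqP: u0; apply: AR_ext => i.
by rewrite coord0; apply/eqP/negPn/negP => ui; apply: nu; exists i.
Qed.

(** For [d = 0] the polynomial is constant, so constant triples are syzygies and the minimal degree
    would be 0. *)
Lemma size_arr_gt0 : (0 < d)%N.
Proof.
rewrite lt0n; apply/eqP => d0.
have g0 : grad (fun i => (i == 0)%:R) f = 0.
  have /dhomogP f0 := arr_poly_homog.
  rewrite /grad big1 // => i _; apply/eqP; rewrite mulf_eq0; apply/orP; right.
  apply/eqP/mpolyP => m; rewrite mcoeff0 mcoeff_deriv.
  rewrite [X in X *+ _]memN_msupp_eq0 ?mul0rn //; apply/negP => /f0 /=.
  by rewrite mdegD mdeg1 addn1 d0.
have [u uE] := AR_make g0; have [_ Hr] := hr.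
have u0 : u = 0.
  apply: (Hr 0%N r_ge1) => i; rewrite /= -[val u ord0 i]/(coord_of u i) uE.
  by case: eqP => _; rewrite ?rpred0 ?dhomog1.
by have := uE 0; rewrite u0 coord0 => /esym/eqP; rewrite oner_eq0.
Qed.

Lemma AR_pairing u a : a \in lines l -> divides (lin a) (pairing a (triple_of u)).
Proof.
move=> al; apply: (divides_pairing (lines_indep hl) (lines_neq0 hl) al).
rewrite -(arr_polyE hl) (_ : grad _ _ = 0); first by exists 0; rewrite mul0r.
by rewrite -[RHS](AR_grad u) /grad; apply: eq_bigr => i _; rewrite ffunE.
Qed.

Lemma det_divides u v : divides f (det_euler (coord_of u) (coord_of v)).
Proof.
have -> : det_euler (coord_of u) (coord_of v) = det_euler (triple_of u) (triple_of v).
  by rewrite /det_euler !ffunE.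
rewrite (arr_polyE hl); apply: lin_prod_divides (lines_indep hl) (lines_neq0 hl) _ => a al.
apply: det_euler_divides; [|exact: AR_pairing|exact: AR_pairing].
exact: (allP (lines_neq0 hl)).
Qed.

(* [psi u = det (E, rho, u) / f], where [E] is the Euler field *)
Definition psi_fun u : S^o := sval (cid (det_divides rho u)).

Lemma psi_funE u : det_euler (coord_of rho) (coord_of u) = psi_fun u * f.
Proof. by rewrite /psi_fun; case: cid. Qed.

Lemma psi_linear : linear psi_fun.
Proof.
move=> a u v; apply: (mulIf arr_poly_neq0).
rewrite mulrDl -!psi_funE -[_ *: psi_fun u]/(a * psi_fun u) -mulrA -psi_funE.
by rewrite -det_euler_linear /det_euler !coord_lin.
Qed.

Definition psi : {linear AR f -> S^o} := 
  HB.pack_for {linear AR f -> S^o} psi_fun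
    (GRing.isLinear.Build _ _ _ _ psi_fun psi_linear).

Lemma psiE u : det_euler (coord_of rho) (coord_of u) = psi u * f.
Proof. exact: psi_funE. Qed.

(** The partial derivatives share the degree d - 1, so a relation splits by degree. Elements of
    [AR f] need not be homogeneous, whereas the minimality of [r] concerns homogeneous ones. *)
Lemma comp_exists m u : exists v, forall i, coord_of v i = pihomog mdeg m (coord_of u i).
Proof.
apply: AR_make; have := congr1 (pihomog mdeg (m + d.-1)) (AR_grad u).
rewrite pihomog0 /grad raddf_sum /= => E; rewrite -[RHS]E; apply: eq_bigr => i _.
by rewrite (pihomog_mulr _ _ (deriv_homog i arr_poly_homog)) leq_addl addnK.
Qed.

Definition comp m u : AR f := sval (cid (comp_exists m u)).

Lemma coord_comp m u i : coord_of (comp m u) i = pihomog mdeg m (coord_of u i).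
Proof. by rewrite /comp; case: cid. Qed.

Lemma comp_homog m u : AR_gr m%:Z (comp m u).
Proof.
move=> i; change (coord_of (comp m u) i \is m.-homog).
by rewrite coord_comp; exact: pihomogP.
Qed.

Lemma psi_homog m u : AR_gr m%:Z u ->
  if (d <= r + m.+1)%N then psi u \is (r + m.+1 - d).-homog else psi u == 0.
Proof.
move=> um; apply: homog_cofactor arr_poly_neq0 arr_poly_homog _.
by rewrite -psiE addnS; exact: (det_euler_homog rho_homog um).
Qed.

Lemma psi_comp m u k : (k + d = r + m.+1)%N -> psi (comp m u) = pihomog mdeg k (psi u).
Proof.
move=> E; apply: (mulIf arr_poly_neq0); rewrite -psiE.
have := pihomog_mulr (psi u) (k + d) arr_poly_homog; rewrite leq_addl addnK => <-.
rewrite -psiE (det_euler_piE _ _ rho_homog) E addnS ltnS leq_addr subSS addKn.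
by rewrite /det_euler !coord_comp.
Qed.

(** [psi] shifts degrees by r + 1 - d, so this component would come from a part of [u] of degree k +
    d - r - 1 < 0. *)
Lemma psi_low k u : (k + d <= r)%N -> pihomog mdeg k (psi u) = 0.
Proof.
move=> E; apply: (mulIf arr_poly_neq0); rewrite mul0r.
have := pihomog_mulr (psi u) (k + d) arr_poly_homog; rewrite leq_addl addnK => <-.
by rewrite -psiE (det_euler_piE _ _ rho_homog) ltnNge E.
Qed.

Lemma psi_eq0 u : psi u = 0 -> forall i j,
  coord_of rho i * coord_of u j = coord_of rho j * coord_of u i.
Proof.
move=> u0; have [] := cross_parallel_grad (AR_grad rho) (AR_grad u).
rewrite psiE u0 !mul0r.
(* Euler's identity; in characteristic zero, with [d > 0], the factor d f can then be cancelled. *)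
have -> : grad (fun i => 'X_i) f = d%:R * f.
  rewrite (arr_polyE hl); have := grad_euler (lines l) 1.
  rewrite size_lines // mulr1 => <-; apply: eq_bigr => i _; by rewrite mul1r.
have df : d%:R * f != 0.
  rewrite mulf_neq0 ?arr_poly_neq0 // -mpolyC_nat mpolyC_eq0.
  by rewrite Num.Theory.pnatr_eq0 -lt0n size_arr_gt0.
have cancel x : x * (d%:R * f) = 0 -> x = 0.
  by move/eqP; rewrite mulf_eq0 (negPf df) orbF => /eqP.
move=> /cancel/eqP; rewrite subr_eq0 => /eqP c12 /cancel/eqP; rewrite subr_eq0 => /eqP c20.
move=> /cancel/eqP; rewrite subr_eq0 => /eqP c01.
by apply: ord3P; apply: ord3P.
Qed.

Lemma AR_msize v i : coord_of v i != 0 -> (r < msize (coord_of v i))%N.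
Proof.
move=> vi; pose m := mdeg (mlead (coord_of v i)).
have ms : msize (coord_of v i) = m.+1 by rewrite -mlead_deg.
rewrite ms ltnS leqNgt; apply/negP => mr.
have [_ /(_ m mr (comp m v) (comp_homog m v)) H] := hr.
have := congr1 (fun w => coord_of w i) H; rewrite /= coord0 coord_comp.
move/(congr1 (mcoeff (mlead (coord_of v i)))); rewrite mcoeff_pihomog eqxx mcoeff0.
by move/eqP; rewrite mleadc_eq0 (negPf vi).
Qed.

(** Division by a nonunit would leave a nonzero syzygy with a nonzero coordinate of too small a
    size. The quotient is not known to be homogeneous, whence the bound [AR_msize] for arbitrary
    syzygies. *)
Lemma rho_primitive p : prime_elt p -> ~ forall i, divides p (coord_of rho i).
Proof.
move=> [p0 pU _] /choice[q qE].
have [|v vE] := AR_make (t := q).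
  apply: (mulIf p0); rewrite mul0r -[RHS](AR_grad rho) /grad mulr_suml.
  by apply: eq_bigr => i _; rewrite qE mulrAC.
have [i ri] := AR_neq0 rho_neq0.
have vi : coord_of v i != 0 by apply: contraNneq ri; rewrite vE qE => ->; rewrite mul0r.
have := AR_msize vi; have sp : (1 < msize p)%N.
  rewrite ltnNge; apply: contraNN pU => /msize1_polyC pE.
  rewrite pE mpolyC_eq0 in p0; rewrite pE; apply: rmorph_unit.
  by rewrite unitfE.
have sr : msize (coord_of rho i) = r.+1.
  rewrite -mlead_deg //; congr _.+1.
  by have /dhomogP := rho_homog i; apply; exact: mlead_supp.
have := msizeM vi p0; rewrite {1}vE -qE sr; move: sp.
by move: (mmeasure _ _) (mmeasure _ (coord_of v i)) => x y; lia.
Qed.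

Lemma psi_ker u : psi u = 0 <-> exists p : S^o, p *: rho = u.
Proof.
split=> [u0|[p <-]].
  have [|c cE] := parallel_multiple (@ufd_mpoly K 3) (AR_neq0 rho_neq0) rho_primitive (t := coord_of u).
    exact: psi_eq0.
  by exists c; apply: AR_ext => i; rewrite coordZ cE.
apply: (mulIf arr_poly_neq0); rewrite mul0r -psiE /det_euler !coordZ; ring.
Qed.

End SyzygyPairing.

(** * Saturation of the image of [psi] and the exact sequence *)

Section Saturation.
Variable K : numClosedFieldType.
Local Notation S := {mpoly K[3]}.
Implicit Types p q h : S.

Lemma varE : ('X_0 = lin (row3 1 0 0) :> S) * ('X_1 = lin (row3 0 1 0) :> S)
  * ('X_2 = lin (row3 0 0 1) :> S).
Proof. by rewrite !linE !row3E !scale1r !scale0r !(addr0, add0r). Qed.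

Lemma split_x2 p : exists c e (g : {poly K}),
  p = c * 'X_1 + e * 'X_0 + (map_poly (@mpolyC 3 K) g).['X_2].
Proof.
pose J p := exists c e (g : {poly K}),
  p = c * 'X_1 + e * 'X_0 + (map_poly (@mpolyC 3 K) g).['X_2].
rewrite -/(J p) (mpolyE p); apply: (big_ind J) => [|q q'|m _].
- by exists 0, 0, 0; rewrite rmorph0 horner0 !mul0r !addr0.
- move=> [c [e [g ->]]] [c' [e' [g' ->]]]; exists (c + c'), (e + e'), (g + g').
  by rewrite rmorphD hornerD; ring.
have drop i : m i != 0%N -> exists q, 'X_[m] = q * 'X_i.
  by move=> mi; exists 'X_[m - U_(i)]; rewrite -mpolyXD submK ?lep1mP.
have [m0|/drop[q ->]] := eqVneq (m 0) 0%N; last first.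
  by exists 0, (p@_m *: q), 0; rewrite rmorph0 horner0 mul0r addr0 add0r scalerAl.
have [m1|/drop[q ->]] := eqVneq (m 1) 0%N; last first.
  by exists (p@_m *: q), 0, 0; rewrite rmorph0 horner0 mul0r !addr0 scalerAl.
exists 0, 0, (p@_m *: 'X^(m 2)).
rewrite !mul0r !add0r map_polyZ rmorphXn /= map_polyX hornerZ hornerXn.
rewrite mul_mpolyC mpolyXE_id !big_ord_recl big_ord0 mulr1 !ord3E.
by rewrite (_ : ord0 = 0) // m0 m1 !expr0 !mul1r.
Qed.

(** ['X_2] is a nonzerodivisor modulo ['X_0] and ['X_1]: on the axis (0, 0, t) the residue [g]
    satisfies t g(t) = 0. *)
Lemma colon_x2 p a b : 'X_2 * p = a * 'X_1 + b * 'X_0 ->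
  exists c e, p = c * 'X_1 + e * 'X_0.
Proof.
have [c [e [g ->]]] := split_x2 p => H; exists c, e.
suff -> : g = 0 by rewrite rmorph0 horner0 addr0.
have Xg : 'X * g = 0.
  apply: poly_eq0_infinite => t.
  have := congr1 (fun q : S => q.@[(row3 0 0 t) ord0]) H.
  rewrite /= !(mevalM, mevalD, mevalXU) !row3E !mulr0 !addr0 add0r => E.
  rewrite hornerM hornerX -[RHS]E; congr (_ * _).
  elim/poly_ind: g {H E} => [|g k IHg]; first by rewrite rmorph0 !horner0 meval0.
  rewrite rmorphD rmorphM /= map_polyX map_polyC !hornerMXaddC.
  by rewrite IHg mevalD mevalM mevalXU row3E mevalC.
by apply/eqP; move/eqP: Xg; rewrite mulf_eq0 polyX_eq0.
Qed.

Variables (d r : nat) (l : 'I_d -> S).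
Local Notation f := (arr_poly l).
Hypothesis hl : line_arrangement l.
Hypothesis hr : is_mdr f r.
Hypothesis r_ge1 : (1 <= r)%N.
Variable rho : AR f.
Hypothesis rho_deg : AR_gr r%:Z rho.
Hypothesis rho_neq0 : rho != 0.
Local Notation psi := (psi hl rho).
Local Notation I := (linear_image psi).

Let psiK u : psi u = 0 <-> exists p : S^o, p *: rho = u.
Proof. exact: (psi_ker hl hr r_ge1 rho_deg rho_neq0). Qed.

Lemma scale_rho_inj (p : S) : p *: rho = 0 -> p = 0.
Proof.
move=> p0; have [i ri] := AR_neq0 rho_neq0; apply: (mulIf ri).
by rewrite mul0r -coordZ p0 coord0.
Qed.

(* [H^1_m (AR f) = 0] since a second syzygy module has depth at least 2, and
   [H^2_m (S rho) = 0]; this is the corresponding chase in the Koszul complex. *)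
Lemma image_colon_vars h : (forall i, 'X_i * h \in I) -> h \in I.
Proof.
move=> hI; have /choice[u uE] : forall i, exists v, psi v = 'X_i * h.
  by move=> i; apply/linear_imageP.
(* [psi] sends both terms to x_i x_j h, so their difference lies in the kernel S rho. *)
have rel i j : exists p : S, p *: rho = 'X_j *: u i - 'X_i *: u j.
  apply/psiK; rewrite linearB !(linearZZ psi) !uE.
  by apply/eqP; rewrite subr_eq0; apply/eqP; rewrite -![_ *: _]/(_ * _) mulrCA.
have [p01 E01] := rel 0 1; have [p02 E02] := rel 0 2; have [p12 E12] := rel 1 2.
have : 'X_2 * p01 = p02 * 'X_1 + (- p12) * 'X_0.
  apply/eqP; rewrite -subr_eq0; apply/eqP; apply: scale_rho_inj.
  apply: AR_ext => i; rewrite coordZ coord0.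
  have C p j k : p *: rho = 'X_j *: u k - 'X_k *: u j ->
      p * coord_of rho i = 'X_j * coord_of (u k) i - 'X_k * coord_of (u j) i.
    by move=> E; rewrite -coordZ E coordB !coordZ.
  transitivity ('X_2 * (p01 * coord_of rho i) - 'X_1 * (p02 * coord_of rho i)
    + 'X_0 * (p12 * coord_of rho i)); first by ring.
  by rewrite (C _ _ _ E01) (C _ _ _ E02) (C _ _ _ E12); ring.
case/colon_x2=> c [e p01E].
(* Correcting the lifts by multiples of [rho] gives x_1 v_0 = x_0 v_1; hence x_0 divides v_0, and
   the quotient is a preimage of [h]. *)
pose v0 := u 0 - c *: rho; pose v1 := u 1 + e *: rho.
have v01 i : 'X_1 * coord_of v0 i = 'X_0 * coord_of v1 i.
  rewrite coordB coordD !coordZ; apply/eqP; rewrite -subr_eq0; apply/eqP.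
  transitivity (('X_1 * coord_of (u 0) i - 'X_0 * coord_of (u 1) i)
    - (c * 'X_1 + e * 'X_0) * coord_of rho i); first by ring.
  by rewrite -p01E -!coordZ E01 coordB subrr.
have X0p : prime_elt ('X_0 : S).
  rewrite varE; apply: lin_prime; apply/eqP => /(congr1 (fun z : 'rV[K]_3 => z ord0 0)).
  by rewrite row3E mxE => /eqP; rewrite oner_eq0.
have X01 : ~ divides ('X_0 : S) 'X_1.
  rewrite !varE; apply: lin_not_divides; apply/eqP => /(congr1 (fun z : 'rV[K]_3 => z ord0 2)).
  by rewrite /= !row3E mxE mul0r mulr1 subr0 => /eqP; rewrite oner_eq0.
have /choice[q qE] : forall i, divides ('X_0 : S) (coord_of v0 i).
  move=> i; have [_ _ pp] := X0p; have [||//] := pp 'X_1 (coord_of v0 i).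
    by exists (coord_of v1 i); rewrite v01 mulrC.
  by move/X01.
have X00 : 'X_0 != 0 :> S by case: X0p.
have [|v vE] := AR_make (l := l) (t := q).
  apply: (mulIf X00); rewrite mul0r -[RHS](AR_grad v0) /grad mulr_suml.
  by apply: eq_bigr => i _; rewrite qE mulrAC.
apply/linear_imageP; exists v; apply: (mulfI X00).
rewrite -uE -[LHS]/('X_0 *: (psi v : S^o)) -linearZ.
have -> : 'X_0 *: v = v0 by apply: AR_ext => i; rewrite coordZ vE qE mulrC.
rewrite /v0 linearB (_ : psi (c *: rho) = 0) ?subr0 //.
by apply/psiK; exists c.
Qed.

Lemma image_saturated : saturated I.
Proof.
move=> p [N]; elim: N => [|N IHN] pN.
  by have := pN 0%MM (@mdeg0 3); rewrite mpolyX0 mul1r.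
apply: IHN => m mN; apply: image_colon_vars => i.
by rewrite mulrA -mpolyXD; apply: pN; rewrite mdegD mdeg1 mN.
Qed.

Lemma image_homogeneous : homogeneous I.
Proof.
move=> p /linear_imageP[u <-] k; apply/linear_imageP.
case: (leqP (k + d) r) => E.
  by exists 0; rewrite linear0 (psi_low hl rho_deg).
have E' : (k + d = r + (k + d - r.+1).+1)%N by move: E; clear; lia.
by exists (comp hl (k + d - r.+1) u); exact: (psi_comp hl rho_deg u E').
Qed.

Definition scale_rho_fun (p : S^o) : AR f := p *: rho.

Lemma scale_rho_linear : linear scale_rho_fun.
Proof. by move=> a p q; rewrite /scale_rho_fun scalerDl -scalerA. Qed.

Definition scale_rho : {linear S^o -> AR f} :=
  HB.pack_for {linear S^o -> AR f} scale_rho_fun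
    (GRing.isLinear.Build _ _ _ _ scale_rho_fun scale_rho_linear).

Lemma psi_in_image u : psi u \in I.
Proof. by apply/linear_imageP; exists u. Qed.

Definition image_ideal : submodClosed S^o := I.

Definition psi_image_fun u : ideal_mod I := IdealMod (psi_in_image u).

Lemma psi_image_linear : linear psi_image_fun.
Proof. by move=> a u v; apply: val_inj; exact: (linearP psi a u v). Qed.

Definition psi_image : {linear AR f -> ideal_mod I} :=
  HB.pack_for {linear AR f -> ideal_mod I} psi_image_fun
    (GRing.isLinear.Build _ _ _ _ psi_image_fun psi_image_linear).

Lemma psi_image_sequence : syzygy_sequence d r rho scale_rho psi_image.
Proof.
split; first exact: scale1r.
split.
- move=> m x; rewrite /gshift => xm i; change (S_gr m (coord_of (x *: rho) i)); rewrite coordZ.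
  have ri := rho_homog rho_deg i; move: xm; case: m => m.
    case: (leqP r m) => rm.
      rewrite (_ : - r%:Z + m%:Z = (m - r)%N%:Z); last by lia.
      by move=> xm; have := dhomogM xm ri; rewrite subnK.
    rewrite (_ : - r%:Z + m%:Z = Negz (r - m).-1); last by rewrite NegzE; lia.
    by move=> /= ->; rewrite mul0r rpred0.
  rewrite (_ : - r%:Z + Negz m = Negz (r + m)); last by rewrite !NegzE; lia.
  by move=> /= ->; rewrite mul0r.
- move=> m u um; change (S_gr (r%:Z - d%:Z + 1 + m) (psi u)); case: m um => m um.
    have := psi_homog hl rho_deg um; case: leqP => E.
      rewrite (_ : r%:Z - d%:Z + 1 + m%:Z = (r + m.+1 - d)%N%:Z) //; lia.
    rewrite (_ : r%:Z - d%:Z + 1 + m%:Z = Negz (d - (r + m.+1)).-1); last by rewrite NegzE; lia.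
    by move/eqP.
  have -> : u = 0 by apply: AR_ext => i; rewrite coord0; exact: um.
  by rewrite linear0; case: (_ + _) => // n; exact: rpred0.
- move=> p q pq; apply/eqP; rewrite -subr_eq0; apply/eqP; apply: scale_rho_inj.
  by rewrite scalerBl; apply/eqP; rewrite subr_eq0; apply/eqP.
- move=> u; split=> [u0|].
    by apply/psiK; have := congr1 val u0.
  by move/psiK => u0; apply: val_inj.
- by move=> [h hI]; have [u uE] := linear_imageP _ _ hI; exists u; apply: val_inj.
Qed.

End Saturation.

(** * The Hilbert function of the ideal I *)

Section HilbertFunction.
Variable K : numClosedFieldType.
Local Notation S := {mpoly K[3]}.

Lemma ideal_compP (I : submodClosed S^o) m (p : dhomog 3 K m) :
  (p \in ideal_comp I m) = (mpoly_of_dhomog p \in I).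
Proof. by rewrite /ideal_comp; case: cid. Qed.

Lemma ideal_comp_has_dim (I : submodClosed S^o) m :
  has_dim (fun p : S => p \is m.-homog /\ p \in I) (\dim (ideal_comp I m)).
Proof.
apply: eq_has_dim (vspace_has_dim _) => p; split.
  by case=> q; rewrite ideal_compP => qI ->; split => //; case: q {qI}.
by case=> pm pI; exists (DHomog pm); rewrite // ideal_compP.
Qed.

Variables (d r : nat) (l : 'I_d -> S).
Local Notation f := (arr_poly l).
Hypothesis hl : line_arrangement l.
Hypothesis hr : is_mdr f r.
Hypothesis r_ge1 : (1 <= r)%N.
Variable rho : AR f.
Hypothesis rho_deg : AR_gr r%:Z rho.
Hypothesis rho_neq0 : rho != 0.
Local Notation psi := (psi hl rho).
Local Notation I := (linear_image psi).
Local Notation V := {ffun 'I_3 -> S}.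
Implicit Types (th : V) (u : AR f).

Let d_gt0 : (0 < d)%N := size_arr_gt0 hl hr r_ge1.
Let f_neq0 : f != 0 := arr_poly_neq0 hl.

Let dK_neq0 : d%:R != 0 :> K.
Proof. by rewrite Num.Theory.pnatr_eq0 -lt0n. Qed.

Lemma det_linear : linear (fun th : V => det_euler (coord_of rho) th).
Proof.
move=> c th et; rewrite -mul_mpolyC -det_euler_linear.
by rewrite /det_euler !ffunE !mul_mpolyC.
Qed.

Lemma grad_linear : linear (fun th : V => grad th f).
Proof.
move=> c th et; rewrite /grad scaler_sumr -big_split; apply: eq_bigr => i _ /=.
by rewrite !ffunE mulrDl scalerAl.
Qed.

Lemma logder_grad M th : logder (lines l) M th ->
  exists2 g : S, g \is M.-1.-homog & grad th f = g * f.
Proof.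
move=> [thM thd]; have := grad_prod_divides thd.
rewrite -(arr_polyE hl) => -[g gE]; exists g => //.
have gM : grad th f \is (M + d.-1).-homog.
  apply: rpred_sum => i _; apply: dhomogM => //.
  exact: (deriv_homog i (arr_poly_homog hl)).
have := homog_cofactor f_neq0 (arr_poly_homog hl) (q := g) (m := M + d.-1).
rewrite -gE => /(_ gM); case: leqP => [dM|dM].
  by rewrite (_ : M + d.-1 - d = M.-1)%N //; lia.
(* Here [M = 0] and [g = 0], so the truncated [M.-1] does no harm. *)
by move/eqP ->; rewrite rpred0.
Qed.

Lemma euler_logder L m (g : S) : g \is m.-homog -> logder L m.+1 [ffun i => g * 'X_i].
Proof.
move=> gm; have X1 (i : 'I_3) : 'X_i \is [in K[3], 1.-homog] by rewrite dhomogX /= mdeg1.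
split=> [i|b _]; last by rewrite pairing_euler; exists g.
by rewrite ffunE mulrC; exact: (dhomogM (X1 i) gm).
Qed.

Lemma grad_euler_arr (g : S) : grad [ffun i => (d%:R^-1 *: g) * 'X_i] f = g * f.
Proof.
have := grad_euler (lines l) (d%:R^-1 *: g).
rewrite size_lines -(arr_polyE hl) // -mpolyC_nat mul_mpolyC scalerA divff // scale1r => <-.
by apply: eq_bigr => i _; rewrite ffunE.
Qed.

Lemma det_euler_euler (g : S) : det_euler (coord_of rho) [ffun i => g * 'X_i] = 0.
Proof. by rewrite /det_euler !ffunE; ring. Qed.

Lemma AR_of_grad th : grad th f = 0 -> exists u : AR f, th = triple_of u.
Proof.
move=> th0; have [u uE] := AR_make th0; exists u.
by apply/ffunP => i; rewrite ffunE uE.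
Qed.

Lemma det_triple u : det_euler (coord_of rho) (triple_of u) = psi u * f.
Proof. by rewrite -psiE /det_euler !ffunE. Qed.

Lemma logder_triple M u : AR_gr M%:Z u -> logder (lines l) M (triple_of u).
Proof.
move=> uM; split=> [i|a al]; last exact: (AR_pairing hl).
by rewrite ffunE; exact: uM.
Qed.

Lemma grad_triple u : grad (triple_of u) f = 0.
Proof. by rewrite -[RHS](AR_grad u) /grad; apply: eq_bigr => i _; rewrite ffunE. Qed.

(** The kernel is S rho + S E with E the Euler field; applying a derivation to [f] kills S rho and
    is injective on S E. The two summands count multipliers of degrees M - r and M - 1. *)
Lemma logder_det_ker_dim M : (r <= M)%N -> (0 < M)%N ->
  has_dim (fun th => logder (lines l) M th /\ det_euler (coord_of rho) th = 0)
    ('C((M - r).+2, 2) + 'C(M.+1, 2)).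
Proof.
move=> rM M0; have [i0 ri0] := AR_neq0 rho_neq0.
apply: (has_dim_exact (f := fun th => grad th f)
  (Q := fun q : S => exists2 g : S, g \is M.-1.-homog & q = g * f)).
- exact: grad_linear.
- apply: (has_dim_inj (f := fun p : S => [ffun i => p * triple_of rho i])) (homog_has_dim K _).
  + by move=> c p q; apply/ffunP => i; rewrite !ffunE mulrDl scalerAl.
  + move=> p _ /ffunP/(_ i0); rewrite !ffunE => /eqP.
    by rewrite mulf_eq0 (negPf ri0) orbF => /eqP.
  move=> th; split=> [[[[thM thd] det0] g0]|[p pM ->]].
    have [u thE] := AR_of_grad g0.
    have /(psi_ker hl hr r_ge1 rho_deg rho_neq0)[p pE] : psi u = 0.
      by apply: (mulIf f_neq0); rewrite mul0r -det_triple -thE.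
    have thi i : th i = p * triple_of rho i by rewrite thE !ffunE -pE coordZ.
    exists p; last by apply/ffunP => i; rewrite [RHS]ffunE.
    have := homog_cofactor ri0 (rho_homog rho_deg i0) (q := p) (m := M).
    by rewrite rM; apply; have := thM i0; rewrite thi ffunE.
  have -> : [ffun i => p * triple_of rho i] = triple_of (p *: rho).
    by apply/ffunP => i; rewrite !ffunE coordZ.
  split; last exact: grad_triple.
  split; last first.
    rewrite det_triple (_ : psi _ = 0) ?mul0r //.
    by apply/(psi_ker hl hr r_ge1 rho_deg rho_neq0); exists p.
  apply: logder_triple => i; change (coord_of (p *: rho) i \is M.-homog).
  by rewrite coordZ; have := dhomogM pM (rho_homog rho_deg i); rewrite subnK.
- have := homog_has_dim K M.-1; rewrite prednK //.
  apply: (has_dim_inj (f := fun g : S => g * f)) => //.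
  + by move=> c p q; rewrite mulrDl scalerAl.
  + by move=> g _ /eqP; rewrite mulf_eq0 (negPf f_neq0) orbF => /eqP.
- move=> th et [Dth dth] [Det det]; split; first exact: logderD.
  by rewrite -[th]scale1r det_linear dth det scaler0 addr0.
- move=> c th [Dth dth]; split; first exact: logderZ.
  rewrite -[c *: th]addr0 det_linear dth scaler0 add0r.
  by rewrite /det_euler !ffunE; ring.
- by move=> th [/logder_grad].
- move=> _ [g gM ->]; exists [ffun i => (d%:R^-1 *: g) * 'X_i]; last exact: grad_euler_arr.
  split; last exact: det_euler_euler.
  by have := euler_logder (lines l) (rpredZ (d%:R^-1) gM); rewrite prednK.
Qed.

Lemma logder_image_dim m : (r <= m + d)%N ->
  has_dim (logder (lines l) (m + d))
    ('C((m + d - r).+2, 2) + 'C((m + d).+1, 2) + \dim (ideal_comp I (m + r.+1))).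
Proof.
move=> rM; have M0 : (0 < m + d)%N by lia.
apply: (has_dim_exact (f := fun th => det_euler (coord_of rho) th)
  (Q := fun q : S => exists2 h : S, h \is (m + r.+1).-homog /\ h \in I & q = h * f)).
- exact: det_linear.
- exact: logder_det_ker_dim.
- apply: (has_dim_inj (f := fun h : S => h * f)) (ideal_comp_has_dim I _) => //.
  + by move=> c p q; rewrite mulrDl scalerAl.
  + by move=> g _ /eqP; rewrite mulf_eq0 (negPf f_neq0) orbF => /eqP.
- exact: logderD.
- by move=> c th; exact: logderZ.
- move=> th Dth; have [g gM gE] := logder_grad Dth.
  (* Subtracting this multiple of the Euler field turns [th] into a syzygy without changing the
     determinant. *)
  pose et : V := [ffun i => (d%:R^-1 *: g) * 'X_i].
  have Det : logder (lines l) (m + d) et.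
    by have := euler_logder (lines l) (rpredZ (d%:R^-1) gM); rewrite prednK.
  have [|u uE] := AR_of_grad (th := th - et).
    by rewrite (linearB_fun _ _ grad_linear) gE grad_euler_arr subrr.
  have um : AR_gr (m + d)%:Z u.
    move=> i; change (coord_of u i \is (m + d).-homog).
    have := congr1 (fun t : V => t i) uE; rewrite /= [in RHS]ffunE => <-.
    by rewrite !ffunE rpredB //; [exact: Dth.1|have := Det.1 i; rewrite ffunE].
  exists (psi u); last first.
    rewrite -det_triple -uE (linearB_fun _ _ det_linear).
    by rewrite [X in _ - X]det_euler_euler subr0.
  split; last exact: psi_in_image.
  have := psi_homog hl rho_deg um; rewrite leq_eqVlt.
  have -> : (r + (m + d).+1 - d = m + r.+1)%N by lia.
  by rewrite (_ : (d < r + (m + d).+1)%N = true) ?orbT //; lia.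
- move=> _ [h [hm /linear_imageP[u uE]] ->].
  exists (triple_of (comp hl (m + d) u)).
    by apply: logder_triple; exact: comp_homog.
  rewrite det_triple; have E : (m + r.+1 + d = r + (m + d).+1)%N by lia.
  by rewrite (psi_comp hl rho_deg u E) uE pihomog_dE.
Qed.

Lemma bin2S k : ('C(k.+2, 2) * 2 = k.+2 * k.+1)%N.
Proof. by have := mul_bin_diag k.+2 1; rewrite bin1 mulnC => ->; rewrite mulnC. Qed.

(** [logder_dim] and [logder_image_dim] count the same space; in C(m+r+3, 2) - dim I_(m+r+1) all
    terms depending on [m] then cancel. *)
Lemma image_degree : exists2 e : nat, is_degree I e &
  e%:Z = (d%:Z - 1) ^+ 2 - r%:Z * (d%:Z - r%:Z - 1) - (tjurina l)%:Z.
Proof.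
have [N HN] := logder_dim (lines_indep hl) (lines_neq0 hl).
rewrite size_lines in HN.
have H m : (N + r <= m)%N -> (hilbert_fun I (m + r.+1))%:Z =
    (d%:Z - 1) ^+ 2 - r%:Z * (d%:Z - r%:Z - 1) - (tjurina l)%:Z.
  move=> Nm; have Nm' : (N <= m)%N by lia.
  have := has_dim_uniq (HN m Nm') (logder_image_dim (m := m) ltac:(lia)).
  rewrite -(tjurinaE hl) /hilbert_fun dim_dhomog.
  have : (\dim (ideal_comp I (m + r.+1)) <= 'C((m + r.+1).+2, 2))%N.
    by rewrite -(dim_dhomog K) dimvS // subvf.
  have b1 := bin2S m; have b2 := bin2S (m + d - r); have b3 := bin2S (m + d).-1.
  have b4 := bin2S (m + r.+1); rewrite (prednK (n := m + d)) in b3; last by lia.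
  move: ('C(_, _)) b1 => c1 b1.
  move: ('C((m + d - r).+2, 2)) b2 => c2 b2.
  move: ('C((m + d).+1, 2)) b3 => c3 b3.
  move: ('C((m + r.+1).+2, 2)) b4 => c4 b4.
  move: (\dim _) (tjurina l) => D t DC.
  move: (m + d - r)%N (subnK (leq_trans (leq_trans (leq_addl N r) Nm) (leq_addr d m))) b2 => k kE b2.
  rewrite -muln2 => E; rewrite -subzn //.
  nia.
exists (hilbert_fun I (N + r + r.+1)); last exact: H.
exists (N + r + r.+1)%N => m Nm.
have -> : m = (m - r.+1 + r.+1)%N by lia.
have mN : (N + r <= m - r.+1)%N by lia.
by have [] := etrans (H _ mN) (esym (H _ (leqnn _))).
Qed.

End HilbertFunction.

(** * Saturated ideals of finite degree *)

Section IdealsOfDegree.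
Variable K : numClosedFieldType.
Local Notation S := {mpoly K[3]}.
Implicit Types (I : submodClosed S^o) (p q : S).

Lemma var_exp_homog (i : 'I_3) m : ('X_i : S) ^+ m \is m.-homog.
Proof.
have Xi : ('X_i : S) \is 1.-homog by rewrite dhomogX /= mdeg1.
by have := dhomogMn m Xi; rewrite mul1n.
Qed.

Lemma ideal_mulZ I (c : K) p : p \in I -> c *: p \in I.
Proof. by move=> pI; rewrite -mul_mpolyC; exact: (@rpredZ _ S^o I c%:MP p pI). Qed.

Lemma ideal_mull I p q : q \in I -> p * q \in I.
Proof. by move=> qI; exact: (@rpredZ _ S^o I p q qI). Qed.

Lemma ideal0 I : 0 \in I.
Proof. exact: (rpred0 I). Qed.

Lemma idealD I p q : p \in I -> q \in I -> p + q \in I.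
Proof. by move=> pI qI; exact: (@rpredD _ I p q pI qI). Qed.

Lemma idealN I p : p \in I -> - p \in I.
Proof. by move=> pI; rewrite -mulN1r; exact: ideal_mull. Qed.

Lemma idealB I p q : p \in I -> q \in I -> p - q \in I.
Proof. by move=> pI qI; apply: idealD => //; exact: idealN. Qed.

Lemma ideal_sum I (T : Type) (s : seq T) (Q : pred T) (F : T -> S) :
  (forall i, Q i -> F i \in I) -> \sum_(i <- s | Q i) F i \in I.
Proof. by move=> FI; elim/big_ind: _ => //; [exact: ideal0|exact: idealD]. Qed.

Definition independent_mod (J : {pred S}) n (y : 'I_n -> S) :=
  forall c : 'I_n -> K, \sum_i c i *: y i \in J -> forall i, c i = 0.

(** Joined to a basis of the degree [m] part of [I], the [y i] remain independent among the forms of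
    degree [m]. *)
Lemma independent_mod_leq I m n (y : 'I_n -> S) :
  (forall i, y i \is m.-homog) -> independent_mod I y -> (n <= hilbert_fun I m)%N.
Proof.
move=> ym iy; have [b [bI Ib ib]] := ideal_comp_has_dim I m.
rewrite /hilbert_fun dim_dhomog; set D := \dim _ in b bI Ib ib *.
suff : (n + D <= 'C(m.+2, 2))%N by lia.
have bm i : b i \is m.-homog /\ b i \in I.
  have := bI (fun j => (j == i)%:R); rewrite (bigD1 i) //= eqxx scale1r big1 ?addr0 //.
  by move=> j /negPf ->; rewrite scale0r.
pose g (k : 'I_(n + D)) := match split k with inl i => y i | inr j => b j end.
apply: (independent_leq (b := g) _ _ (homog_has_dim K m)) => [k|c].
  by rewrite /g; case: (split k) => // j; case: (bm j).
rewrite big_split_ord /=.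
have E1 : \sum_i c (lshift D i) *: g (lshift D i) = \sum_i c (lshift D i) *: y i.
  by apply: eq_bigr => i _; rewrite /g (unsplitK (inl i)).
have E2 : \sum_i c (rshift n i) *: g (rshift n i) = \sum_i c (rshift n i) *: b i.
  by apply: eq_bigr => i _; rewrite /g (unsplitK (inr i)).
rewrite E1 E2 => c0.
have cl : forall i, c (lshift D i) = 0.
  apply: (iy (fun i => c (lshift D i))); move/eqP: c0; rewrite addr_eq0 => /eqP ->.
  apply: idealN; apply: ideal_sum => j _.
  by apply: ideal_mulZ; case: (bm j).
move=> k; rewrite -(splitK k); case: (split k) => j //=.
apply: (ib (fun j => c (rshift n j))); rewrite -[RHS]c0 [X in X + _]big1 ?add0r //.
by move=> i _; rewrite cl scale0r.
Qed.

Lemma homog_sum p : p = \sum_(m < msize p) pihomog mdeg m p.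
Proof. exact: pihomog_partitionE. Qed.

(** A strict inclusion of [P 0] in [P 1] makes the Hilbert function of S / P 0 unbounded: for p in
    [P 1] outside [P 0] and x_i outside [P 1], from [n] forms y_j independent modulo [P 0] one gets
    [n.+1], namely the p y_j and a power of x_i. But [e] is a bound, as [P 0] contains [I]. *)
Lemma proj_dim0_of_degree I e : is_degree I e -> proj_dim_le I 0.
Proof.
move=> [N HN] k P relP chain; rewrite leqn0; apply/eqP; case: k relP chain => // k relP chain.
have [sP [p0 p0P1 p0nP0]] := chain 0%N isT.
have [homP0 _ IP0] := relP 0%N isT; have [homP1 [i XiP1] _] := relP 1%N isT.
have [n0 [p [pn0 pP1 pP0]]] : exists n0 p, [/\ p \is n0.-homog, p \in P 1%N & p \notin P 0%N].
  apply: contrapT => np; case/negP: p0nP0; rewrite (homog_sum p0).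
  apply: rpred_sum => m _; apply/negPn/negP => nm; apply: np.
  by exists (nat_of_ord m), (pihomog mdeg m p0); split; [exact: pihomogP|exact: homP1|].
have primeX (J : prime_idealr S) j : ('X_i : S) \notin J -> ('X_i : S) ^+ j \notin J.
  move=> XJ; elim: j => [|j IHj]; first by rewrite expr0 idealr1.
  by rewrite exprS prime_idealrM negb_or XJ.
have constP (J : prime_idealr S) (c : K) q : c != 0 -> (c *: q \in J) = (q \in J).
  move=> c0; rewrite -mul_mpolyC prime_idealrM; apply: orb_idl => cJ.
  have : 1 \in J.
    rewrite (_ : 1 = c^-1%:MP * c%:MP :> S) ?prime_idealrM ?cJ ?orbT //.
    by rewrite -mpolyCM mulVf.
  by rewrite idealr1.
pose D n := `[< exists m (y : 'I_n -> S), [/\ (N <= m)%N, forall j, y j \is m.-homog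
  & independent_mod (P 0%N) y] >].
have D0 : exists n, D n.
  exists 0%N; apply/asboolP; exists N, (fun=> 0); split=> // [[]//|c _ []//].
have Dle n : D n -> (n <= e)%N.
  move=> /asboolP[m [y [Nm ym iy]]]; rewrite -(HN m Nm).
  by apply: (independent_mod_leq ym) => c cI; apply: iy; exact: IP0.
case: (ex_maxnP D0 Dle) => n /asboolP[m [y [Nm ym iy]]] maxn.
suff : D n.+1 by move/maxn; rewrite ltnn.
apply/asboolP; exists (n0 + m)%N.
exists (fun j => if unlift ord0 j is Some j' then p * y j' else 'X_i ^+ (n0 + m)).
split; first by apply: leq_trans Nm _; exact: leq_addl.
  move=> j; case: unliftP => [j' _|_]; first exact: dhomogM.
  exact: var_exp_homog.
move=> c; rewrite big_ord_recl unlift_none /=.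
have -> : \sum_(j < n) c (lift ord0 j) *:
      (if unlift ord0 (lift ord0 j) is Some j' then p * y j' else 'X_i ^+ (n0 + m))
    = p * \sum_(j < n) c (lift ord0 j) *: y j.
  rewrite mulr_sumr; apply: eq_bigr => j _.
  by rewrite liftK scalerAr.
move=> cP0.
(* Modulo [P 1] only the power of x_i survives. *)
have c0 : c ord0 = 0.
  apply/eqP/negPn/negP => c0; have := sP _ cP0.
  have pP : p * \sum_(j < n) c (lift ord0 j) *: y j \in P 1%N by rewrite prime_idealrM pP1.
  by rewrite rpredDr // constP // (negPf (primeX _ _ XiP1)).
move: cP0; rewrite c0 scale0r add0r prime_idealrM (negPf pP0) /= => /iy cl j.
by case: (unliftP ord0 j) => [j' ->|->].
Qed.

Lemma saturatedP I p : saturated I -> saturation I p <-> p \in I.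
Proof.
move=> satI; split; first exact: satI.
by move=> pI; exists 0%N => m _; exact: ideal_mull.
Qed.

Lemma meval_homog_sum p (t : K) (z : 'rV[K]_3) :
  p.@[(t *: z) ord0] = (\poly_(m < msize p) (pihomog mdeg m p).@[z ord0]).[t].
Proof.
rewrite {1}(homog_sum p) raddf_sum /= horner_poly; apply: eq_bigr => m _.
by rewrite (meval_homogZ _ _ (pihomogP mdeg m p)) mulrC.
Qed.

(** Along the multiples t z of a representative, the value is a polynomial in [t] whose coefficients
    are the values of the components at z, and the field is infinite. *)
Lemma vanishes_at_homog p (P : point K) :
  vanishes_at p P <-> forall m, (pihomog mdeg m p).@[rep P ord0] = 0.
Proof.
split=> [vP m|p0 v]; last first.
  rewrite val_rep => /vlineP[t ->]; rewrite meval_homog_sum.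
  by rewrite horner_poly big1 // => m _; rewrite p0 mul0r.
have q0 : \poly_(m < msize p) (pihomog mdeg m p).@[rep P ord0] = 0.
  apply: poly_eq0_infinite => t; rewrite -meval_homog_sum; apply: vP.
  by rewrite val_rep memvZ // memv_line.
have := congr1 (fun q : {poly K} => q`_m) q0; rewrite /= coef_poly coef0.
case: ltnP => // pm _; rewrite (_ : pihomog mdeg m p = 0) ?meval0 //.
apply/mpolyP => k; rewrite mcoeff_pihomog mcoeff0; case: eqP => // km.
by rewrite memN_msupp_eq0 //; apply: msize_mdeg_ge; rewrite km.
Qed.

Lemma vanishes_at_rep p m (P : point K) : p \is m.-homog ->
  vanishes_at p P <-> p.@[rep P ord0] = 0.
Proof.
move=> pm; rewrite vanishes_at_homog; split=> [/(_ m)|p0 k]; first by rewrite pihomog_dE.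
have [<-|km] := eqVneq m k; first by rewrite pihomog_dE.
by rewrite (pihomog_ne0 km pm) meval0.
Qed.

(** Evaluation at a representative of [P] maps the forms of degree [N] onto [K], with kernel the
    degree [N] part of [I]. *)
Lemma reduced_point_degree I (P : point K) e : saturated I ->
  defines_reduced_point I P -> is_degree I e -> e = 1%N.
Proof.
move=> satI IP [N /(_ N (leqnn N)) <-].
have /rV0Pn[i zi] := rep_neq0 P.
have : has_dim (fun p : S => p \is N.-homog) (\dim (ideal_comp I N) + 1).
  apply: (has_dim_exact (V := S) (W := K^o) (f := fun p : S => p.@[rep P ord0] : K^o)
    (Q := fun _ => True)).
  - by move=> c p q; rewrite mevalD mevalZ.
  - apply: eq_has_dim (ideal_comp_has_dim I N) => p.
    split=> [[pN pI]|[pN p0]]; split=> //.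
      by apply/(vanishes_at_rep _ pN)/IP/saturatedP.
    by apply/(saturatedP _ satI)/IP/(vanishes_at_rep _ pN).
  - exists (fun=> 1); split=> // [v _|c].
      by exists (fun=> v); rewrite big_ord1 /GRing.scale /= mulr1.
    by rewrite big_ord1 /GRing.scale /= mulr1 => c0 j; rewrite (ord1 j).
  - by move=> p q pN qN; rewrite rpredD.
  - by move=> c p pN; rewrite rpredZ.
  - by [].
  - move=> w _; exists ((w / rep P ord0 i ^+ N) *: 'X_i ^+ N); last first.
      by rewrite mevalZ rmorphXn /= mevalXU divfK // expf_neq0.
    by apply: rpredZ; exact: var_exp_homog.
move/(has_dim_uniq (homog_has_dim K N)); rewrite /hilbert_fun dim_dhomog => ->.
by rewrite addKn.
Qed.

(** In large degrees, forms modulo [I] are spanned by a power of one variable x_i. From x_j x_i^N =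
    z_j x_i^(N+1) modulo [I], saturation gives x_j = z_j x_i, so a form p of degree m is p(Z) x_i^m
    modulo [I]. *)
Lemma degree1_reduced_point I : homogeneous I -> saturated I -> is_degree I 1 ->
  exists P : point K, defines_reduced_point I P.
Proof.
move=> homI satI [N HN].
have Xh := var_exp_homog.
(* Otherwise [I] contains a power of every variable, hence all monomials of some degree; then 1 is
   in [I] by saturation and the degree is 0. *)
have [i XiI] : exists i : 'I_3, forall m, 'X_i ^+ m \notin I.
  apply: contrapT => nX.
  have /choice[e eI] : forall i : 'I_3, exists m, 'X_i ^+ m \in I.
    move=> i; apply: contrapT => ni; apply: nX; exists i => m.
    by apply/negP => mI; apply: ni; exists m.
  have I1 : 1 \in I.
    apply: satI; exists (\sum_i (e i).+1)%N => m mE; rewrite mulr1.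
    have [i mi] : exists i, (e i <= m i)%N.
      apply: contrapT => ne; have : (\sum_i m i < \sum_i (e i).+1)%N.
        apply: (@leq_trans (\sum_i e i).+1).
          rewrite ltnS; apply: leq_sum => i _; rewrite leqNgt; apply/negP => lt.
          by apply: ne; exists i; exact: ltnW.
        under [leqRHS]eq_bigr do rewrite -add1n.
        by rewrite big_split /= sum1_card card_ord add3n; lia.
      by rewrite -mdegE mE ltnn.
    rewrite -(submK (m := U_(i) *+ e i) (m' := m)).
      by rewrite mpolyXD -mpolyXn; apply: ideal_mull; exact: eI.
    apply/mnm_lepP => j; rewrite mulmnE mnm1E; case: eqP => [<-|]; by rewrite ?mul1n ?mul0n.
  have := HN N (leqnn N); rewrite /hilbert_fun (_ : ideal_comp I N = fullv) ?subnn //.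
  apply/vspaceP => p; rewrite memvf ideal_compP -[mpoly_of_dhomog p]mulr1.
  exact: ideal_mull.
have dep m q : (N <= m)%N -> q \is m.-homog -> exists c, q - c *: 'X_i ^+ m \in I.
  move=> Nm qm; apply: contrapT => nq.
  suff : (2 <= hilbert_fun I m)%N by rewrite (HN m Nm).
  apply: (independent_mod_leq (y := fun j : 'I_2 => if j == ord0 then q else 'X_i ^+ m)).
    by move=> j; case: ifP.
  move=> c; rewrite !big_ord_recl big_ord0 addr0 /=; set c0 := c ord0; set c1 := c _ => cI.
  have c00 : c0 = 0.
    apply/eqP/negPn/negP => c00; apply: nq; exists (- (c1 / c0)).
    rewrite scaleNr opprK -[q]scale1r -(mulVf c00) -scalerA [c1 / c0]mulrC -scalerA -scalerDr.
    exact: ideal_mulZ.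
  have c10 : c1 = 0.
    apply/eqP/negPn/negP => c10; move: cI; rewrite c00 scale0r add0r.
    by move/(ideal_mulZ c1^-1); rewrite scalerA mulVf // scale1r (negPf (XiI m)).
  by move=> j; case: (unliftP ord0 j) => [j' ->|-> //]; rewrite (ord1 j').
have /choice[z zE] : forall j, exists c, 'X_j * 'X_i ^+ N - c *: 'X_i ^+ N.+1 \in I.
  by move=> j; apply: dep => //; have := dhomogM (Xh j 1%N) (Xh i N).
have zi : z i = 1.
  apply/eqP; rewrite eq_sym -subr_eq0; apply/negPn/negP => zi; have := zE i.
  rewrite -exprS -[X in X - _]scale1r -scalerBl => /(ideal_mulZ (1 - z i)^-1).
  by rewrite scalerA mulVf // scale1r (negPf (XiI _)).
(* Every monomial of degree [N] is a multiple of x_i^N modulo [I], so all of them carry x_j - z_j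
   x_i into [I]. *)
have LI j : 'X_j - z j *: 'X_i \in I.
  apply: satI; exists N => m mN.
  have [|c cI] := dep N 'X_[m] (leqnn N); first by rewrite dhomogX /= mN.
  rewrite mulrC -[X in X \in _](subrK (('X_j - z j *: 'X_i) * (c *: 'X_i ^+ N))).
  apply: idealD; first by rewrite -mulrBr; exact: ideal_mull.
  rewrite -scalerAr; apply: ideal_mulZ.
  by rewrite mulrBl -scalerAl -exprS.
pose Z := \row_j z j.
have Z0 : Z != 0.
  apply/eqP => /(congr1 (fun v : 'rV[K]_3 => v ord0 i)); rewrite !mxE zi => /eqP.
  by rewrite oner_eq0.
have red p m : p \is m.-homog -> p - p.@[Z ord0] *: 'X_i ^+ m \in I.
  pose J q k := q - q.@[Z ord0] *: 'X_i ^+ k \in I.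
  have JM q k q' k' : J q k -> J q' k' -> J (q * q') (k + k')%N.
    rewrite /J => Jq Jq'; rewrite mevalM exprD.
    set s := 'X_i ^+ k in Jq *; set s' := 'X_i ^+ k' in Jq' *.
    rewrite (_ : _ - _ = q' * (q - q.@[Z ord0] *: s)
        + (q.@[Z ord0] *: s) * (q' - q'.@[Z ord0] *: s')).
      by apply: idealD; exact: ideal_mull.
    by rewrite -!mul_mpolyC mpolyCM; ring.
  have J1 : J 1 0%N by rewrite /J meval1 expr0 scale1r subrr ideal0.
  have JX k : J 'X_[k] (mdeg k).
    rewrite mpolyXE_id mdegE; elim: (index_enum 'I_3) => [|j s IHs].
      by rewrite !big_nil.
    rewrite !big_cons; apply: (JM) => //; elim: (k j) => [|n IHn] //.
    rewrite exprS; apply: (JM _ 1%N) => //.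
    by rewrite /J mevalXU mxE expr1.
  move/dhomogP => pm; rewrite {1 2}(mpolyE p) raddf_sum /= scaler_suml -sumrB.
  rewrite big_seq; apply: ideal_sum => k kp.
  rewrite mevalZ -scalerA -scalerBr; apply: ideal_mulZ.
  by rewrite -(pm _ kp); exact: JX.
have memI p m : p \is m.-homog -> p \in I <-> p.@[Z ord0] = 0.
  move=> pm; have pI := red _ _ pm; split=> [pI'|p0].
    apply/eqP/negPn/negP => p0.
    have : p.@[Z ord0] *: 'X_i ^+ m \in I.
      rewrite -[X in X \in _](subKr p); exact: idealB.
    by move/(ideal_mulZ (p.@[Z ord0])^-1); rewrite scalerA mulVf // scale1r (negPf (XiI m)).
  by move: pI; rewrite p0 scale0r subr0.
exists (point_of Z) => p; rewrite (saturatedP _ satI) vanishes_at_homog.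
have [c c0 cE] := rep_point_of Z0.
have evalE m : (pihomog mdeg m p).@[rep (point_of Z) ord0] = 0 <->
    (pihomog mdeg m p).@[Z ord0] = 0.
  rewrite cE (meval_homogZ _ _ (pihomogP mdeg m p)); split=> [/eqP|->]; last by rewrite mulr0.
  by rewrite mulf_eq0 expf_eq0 (negPf c0) andbF => /eqP.
split=> [pI m|p0].
  by apply/evalE/(memI _ _ (pihomogP mdeg m p)); exact: homI.
rewrite (homog_sum p); apply: ideal_sum => m _.
by apply/(memI _ _ (pihomogP mdeg m p))/evalE.
Qed.

End IdealsOfDegree.

(** * Freeness *)

Section Freeness.
Variables (K : numClosedFieldType) (d r : nat) (l : 'I_d -> {mpoly K[3]}).
Local Notation S := {mpoly K[3]}.
Local Notation f := (arr_poly l).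
Hypothesis hl : line_arrangement l.
Hypothesis hr : is_mdr f r.
Hypothesis r_ge1 : (1 <= r)%N.
Variable rho : AR f.
Hypothesis rho_deg : AR_gr r%:Z rho.
Hypothesis rho_neq0 : rho != 0.
Local Notation psi := (psi hl rho).
Local Notation I := (linear_image psi).
Implicit Types u v : AR f.

Let psiK u : psi u = 0 <-> exists p : S^o, p *: rho = u.
Proof. exact: (psi_ker hl hr r_ge1 rho_deg rho_neq0). Qed.

Lemma psi_scale (a : S) u : psi (a *: u) = a * psi u.
Proof. exact: (linearZZ psi a u). Qed.

Lemma psi_rho : psi rho = 0.
Proof. by apply/psiK; exists 1; rewrite scale1r. Qed.

(** A homogeneous preimage of 1, of degree d - r - 1, splits the exact sequence; together with [rho]
    it is a basis. *)
Lemma free_of_image_full : I =i predT -> free_arrangement l.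
Proof.
move=> IS; have /linear_imageP[u1 u1E] : (1 : S) \in I by rewrite IS.
(* For [r >= d] the constant component of every [psi u] vanishes, so 1 would not be reached. *)
have rd : (r < d)%N.
  rewrite ltnNge; apply/negP => dr; have := psi_low hl rho_deg (k := 0) u1 dr.
  by rewrite u1E pihomog_dE ?dhomog1 // => /eqP; rewrite oner_eq0.
pose u2 := comp hl (d - r.+1) u1.
have psi2 : psi u2 = 1.
  have E : (0 + d = r + (d - r.+1).+1)%N by lia.
  by rewrite (psi_comp hl rho_deg u1 E) u1E pihomog_dE // dhomog1.
exists 2%N, (fun j => if j == ord0 then rho else u2); split.
  move=> j; case: eqP => _; first by exists r%:Z.
  by exists (d - r.+1)%N%:Z; exact: comp_homog.
move=> u; have /psiK[p pE] : psi (u - psi u *: u2) = 0.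
  by rewrite linearB psi_scale psi2 mulr1 subrr.
have sumE (a : {ffun 'I_2 -> S}) : \sum_j a j *: (if j == ord0 then rho else u2)
    = a ord0 *: rho + a ord_max *: u2.
  by rewrite big_ord_recl big_ord1 /= (_ : lift ord0 ord0 = ord_max) //; apply: val_inj.
exists [ffun j => if j == ord0 then p else psi u : S]; split.
  by rewrite sumE !ffunE /= pE subrK.
move=> a; rewrite sumE => uE.
have a1 : psi u = a ord_max.
  by rewrite uE linearD !psi_scale psi_rho psi2 mulr0 add0r mulr1.
have a0 : p = a ord0.
  apply/eqP; rewrite -subr_eq0; apply/eqP; apply: (scale_rho_inj rho_neq0).
  by rewrite scalerBl pE a1 [X in X - _ - _]uE addrK subrr.
apply/ffunP => j; rewrite ffunE; case: eqP => [->//|j0].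
rewrite a1; congr (a _); apply: val_inj; move: j0; case: j => -[|[|j]] //= lt j0.
by case: j0; apply: val_inj.
Qed.

Section Basis.
Variables (n : nat) (e : 'I_n -> AR f).
Hypothesis e_homog : forall j, exists m, AR_gr m (e j).
Hypothesis e_basis : forall u, exists! a : {ffun 'I_n -> S}, u = \sum_j a j *: e j.

Lemma basis_inj (a b : 'I_n -> S) :
  \sum_j a j *: e j = \sum_j b j *: e j -> forall j, a j = b j.
Proof.
move=> ab j; have [c [_ cu]] := e_basis (\sum_j a j *: e j).
have ca : c = finfun a by apply: cu; apply: eq_bigr => i _; rewrite ffunE.
have cb : c = finfun b by apply: cu; rewrite ab; apply: eq_bigr => i _; rewrite ffunE.
by have := congr1 (fun g : {ffun 'I_n -> S} => g j) (etrans (esym ca) cb); rewrite /= !ffunE.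
Qed.

Lemma basis_neq0 j : e j != 0.
Proof.
apply/eqP => ej.
have := basis_inj (a := fun k => (k == j)%:R) (b := fun=> 0) _ j.
rewrite eqxx => H; suff /eqP : (1 : S) = 0 by rewrite oner_eq0.
apply: H; rewrite [RHS]big1 => [|i _]; last by rewrite scale0r.
rewrite (bigD1 j) //= ej scaler0 add0r big1 // => i /negPf ij.
by rewrite ij scale0r.
Qed.

Lemma basis_degree j : exists2 m, (r <= m)%N & AR_gr m%:Z (e j).
Proof.
have [[m|m] em] := e_homog j.
  exists m => //; rewrite leqNgt; apply/negP => mr.
  have [_ Hr] := hr; have := basis_neq0 j; rewrite (Hr m mr (e j) em).
  by rewrite eqxx.
case/eqP: (basis_neq0 j); apply: AR_ext => i; rewrite coord0.
exact: em.
Qed.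

(* By minimality of its degree, [rho] is a combination of the basis with
   constant coefficients. *)
Lemma rho_constant_comb : exists c : 'I_n -> K,
  (exists j, c j != 0) /\ rho = \sum_j (c j)%:MP *: e j.
Proof.
have [a [aE _]] := e_basis rho.
(* In degree [r] only basis elements of degree exactly [r] contribute, through the constant term of
   their coefficient. *)
pose c j := if `[< AR_gr r%:Z (e j) >] then (a j)@_0%MM else 0.
exists c.
have rhoE : rho = \sum_j (c j)%:MP *: e j.
  have coord_sum (g : 'I_n -> S) i : coord_of (\sum_j g j *: e j) i = \sum_j g j * coord_of (e j) i.
    elim/big_ind2: _ => [|x1 x2 y1 y2 <- <-|j _]; [exact: coord0|exact: coordD|exact: coordZ].
  apply: AR_ext => i; rewrite coord_sum -[LHS](pihomog_dE (rho_homog rho_deg i)).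
  rewrite [X in coord_of X _]aE coord_sum raddf_sum; apply: eq_bigr => j _ /=.
  have [m rm em] := basis_degree j.
  rewrite (pihomog_mulr _ _ (em i : coord_of (e j) i \is m.-homog)) /c.
  case: asboolP => [ejr|ejnr].
    have [->|ei0] := eqVneq (coord_of (e j) i) 0; first by rewrite !mulr0; case: ifP.
    have -> : m = r by apply: (dhomog_uniq ei0); [exact: em|exact: ejr].
    rewrite leqnn subnn; congr (_ * _); apply/mpolyP => k.
    rewrite mcoeff_pihomog mcoeffC mdeg_eq0; case: eqP => [->|]; by rewrite ?mulr1 ?mulr0.
  have -> : (m <= r)%N = false.
    apply/negP => mr; have mE : m = r by apply/eqP; rewrite eqn_leq mr.
    by apply: ejnr; rewrite -mE.
  by rewrite mul0r.
split=> //; apply: contrapT => nc; case/eqP: rho_neq0; rewrite rhoE big1 // => j _.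
have -> : c j = 0 by apply/eqP/negPn/negP => cj; apply: nc; exists j.
by rewrite scale0r.
Qed.

(** Some [e j0] occurs in [rho] with a nonzero constant coefficient, so [psi rho = 0] expresses
    [psi (e j0)] through the values at the other basis elements, and at most one other exists. *)
Lemma image_principal : exists h k, [/\ h \is k.-homog, h \in I &
  forall p, p \in I -> exists q, p = q * h].
Proof.
have [c [[j0 c0] rhoE]] := rho_constant_comb.
have c0P : (c j0)%:MP != 0 :> S by rewrite mpolyC_eq0.
have psiE' (b : 'I_n -> S) : psi (\sum_j b j *: e j) = \sum_j b j * psi (e j).
  by rewrite linear_sum; apply: eq_bigr => j _; exact: psi_scale.
have rel : \sum_j (c j)%:MP * psi (e j) = 0 by rewrite -psiE' -rhoE psi_rho.
(* For two further indices, psi(e_i) e_k - psi(e_k) e_i is a multiple of [rho] without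
   [e j0]-coordinate, hence 0. So psi(e_i) = 0, and the same argument gives e_i = 0. *)
have one_other i k : i != j0 -> k != j0 -> i = k.
  move=> ij kj; apply/eqP/negPn/negP => ik.
  have [p pE] : exists p : S^o, p *: rho = psi (e i) *: e k - psi (e k) *: e i.
    by apply/psiK; rewrite linearB !psi_scale mulrC subrr.
  have delta (x y : S) : x *: e k - y *: e i
      = \sum_j ((j == k)%:R * x - (j == i)%:R * y) *: e j.
    under eq_bigr do rewrite scalerBl.
    rewrite sumrB; congr (_ - _).
      rewrite (bigD1 k) //= eqxx mul1r big1 ?addr0 // => j /negPf ->.
      by rewrite mul0r scale0r.
    rewrite (bigD1 i) //= eqxx mul1r big1 ?addr0 // => j /negPf ->.
    by rewrite mul0r scale0r.
  have scale_comb (q : S) : q *: rho = \sum_j (q * (c j)%:MP) *: e j.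
    by rewrite rhoE scaler_sumr; apply: eq_bigr => j _; rewrite scalerA.
  have := pE; rewrite delta scale_comb => /basis_inj B.
  have p0 : p = 0.
    apply: (mulIf c0P); rewrite mul0r B.
    by rewrite ![j0 == _]eq_sym (negPf ij) (negPf kj) !mul0r subrr.
  have ei0 : psi (e i) = 0.
    have := B k; rewrite p0 mul0r eqxx mul1r [k == i]eq_sym (negPf ik) mul0r subr0.
    by move=> <-.
  have [q qE] := (psiK (e i)).1 ei0.
  (* With these values [delta] is the expansion of [e i] in the basis. *)
  have := delta 0 (-1); rewrite scale0r sub0r scaleN1r opprK -qE scale_comb => /basis_inj B'.
  have q0 : q = 0.
    apply: (mulIf c0P); rewrite mul0r B'.
    by rewrite ![j0 == _]eq_sym (negPf ij) mul0r mulr0 subrr.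
  by have := basis_neq0 i; rewrite -qE q0 scale0r eqxx.
have split_j0 (F : 'I_n -> S) : \sum_j F j = F j0 + \sum_(j | j != j0) F j by exact: bigD1.
have psi0 : psi (e j0) = - \sum_(j | j != j0) ((c j / c j0)%:MP * psi (e j)).
  apply: (mulfI c0P); move/eqP: rel; rewrite split_j0 addr_eq0 => /eqP ->.
  rewrite mulrN mulr_sumr; congr (- _); apply: eq_bigr => j _.
  by rewrite mulrA -mpolyCM mulrCA divff ?mulr1.
have memI p : p \in I -> exists b : 'I_n -> S, p = \sum_j b j * psi (e j).
  move=> /linear_imageP[u <-]; have [b [-> _]] := e_basis u.
  by exists b; rewrite psiE'.
have [[i ij]|none] := pselect (exists i, i != j0).
  have [m rm em] := basis_degree i.
  have := psi_homog hl rho_deg em; rewrite -/(psi (e i)) => H.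
  exists (psi (e i)), (r + m.+1 - d)%N; split; last 1 first.
  - move=> p /memI[b ->]; rewrite split_j0 psi0.
    have sum1 (F : 'I_n -> S) : \sum_(j | j != j0) F j = F i.
      rewrite (bigD1 i) //= big1 ?addr0 // => j /andP[jj ji].
      by case/eqP: ji; exact: one_other.
    rewrite !sum1; exists (- (b j0 * (c i / c j0)%:MP) + b i); ring.
  - by move: H; case: ifP => // _ /eqP ->; rewrite rpred0.
  - exact: psi_in_image.
exists 0, 0%N; split; [exact: rpred0|exact: ideal0|].
move=> p /memI[b ->]; exists 0; rewrite mulr0.
have all0 (j : 'I_n) : j = j0.
  by apply/eqP/negPn/negP => jj; apply: none; exists j.
rewrite split_j0 psi0 big_pred0 ?oppr0 ?mulr0 ?add0r; last first.
  by move=> j; rewrite (all0 j) eqxx.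
by rewrite big_pred0 // => j; rewrite (all0 j) eqxx.
Qed.

(** For [I] generated by a nonzero form of degree [k], the Hilbert function is C(m+2, 2) - C(m-k+2,
    2) from degree [k] on, and for [I = 0] it is C(m+2, 2); it is eventually constant only when
    [k = 0], and then the generator is a unit. *)
Lemma image_full_of_basis : I =i predT.
Proof.
have [h [k [hk hI hP]]] := image_principal.
have [D [N HN] _] := image_degree hl hr r_ge1 rho_deg rho_neq0.
have hilb m : hilbert_fun I m = ('C(m.+2, 2) - \dim (ideal_comp I m))%N.
  by rewrite /hilbert_fun dim_dhomog.
have [h0|h0] := eqVneq h 0.
  have dim0 m : \dim (ideal_comp I m) = 0%N.
    apply: has_dim_uniq (ideal_comp_has_dim I m) _.
    apply: eq_has_dim (has_dim_zero _) => p; split=> [->|[_ /hP[q ->]]].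
      by split; [exact: rpred0|exact: ideal0].
    by rewrite h0 mulr0.
  have := HN _ (leqnn N); have := HN _ (leqnSn N); rewrite !hilb !dim0 !subn0.
  by have := bin2S N; have := bin2S N.+1; nia.
have dimE m : (k <= m)%N -> \dim (ideal_comp I m) = 'C((m - k).+2, 2).
  move=> km; apply: has_dim_uniq (ideal_comp_has_dim I m) _.
  apply: (has_dim_inj (f := fun q : S => q * h)) (homog_has_dim K (m - k)).
  - by move=> c p q; rewrite mulrDl scalerAl.
  - by move=> q _ /eqP; rewrite mulf_eq0 (negPf h0) orbF => /eqP.
  move=> p; split=> [[pm /hP[q pE]]|[q qm ->]].
    exists q => //; have := homog_cofactor h0 hk (q := q) (m := m).
    by rewrite -pE km; apply.
  split; last exact: ideal_mull.
  by have := dhomogM qm hk; rewrite subnK.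
have k0 : k = 0%N.
  have Nk1 : (N <= N + k)%N by exact: leq_addr.
  have Nk2 : (N <= (N + k).+1)%N by apply: leq_trans Nk1 _.
  have := HN _ Nk1; have := HN _ Nk2; rewrite !hilb !dimE ?leq_addl //; last first.
    by apply: leq_trans (leq_addl N k) _.
  (* By Pascal's rule the Hilbert function grows by exactly [k] from degree N + k to the next. *)
  rewrite subSn ?leq_addl // addnK.
  rewrite [in X in X -> _]binS [X in (_ + _ - X)%N]binS !bin1.
  have : ('C(N.+2, 2) <= 'C((N + k).+2, 2))%N by rewrite leq_bin2l // !ltnS leq_addr.
  by move: ('C(N.+2, 2)) ('C((N + k).+2, 2)) => x y; lia.
have hC : h = (h@_0%MM)%:MP.
  apply: msize1_polyC; rewrite -mlead_deg // ltnS.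
  by have /dhomogP/(_ _ (mlead_supp h0)) /= := hk; rewrite k0 => ->.
move=> p; rewrite [RHS]inE; rewrite (_ : p = (p * (h@_0%MM)^-1%:MP) * h).
  by rewrite ideal_mull.
rewrite {2}hC -mulrA -mpolyCM mulVf ?mulr1 //.
by apply: contraNneq h0 => h00; rewrite hC h00 mpolyC0.
Qed.

End Basis.

Lemma free_iff_image_full : free_arrangement l <-> I =i predT.
Proof.
split; last exact: free_of_image_full.
by case=> n [e [eh eb]]; exact: image_full_of_basis eh eb.
Qed.

End Freeness.

(** * Nearly free arrangements *)

Section Uniqueness.
Variables (K : numClosedFieldType) (d r : nat) (l : 'I_d -> {mpoly K[3]}).
Local Notation S := {mpoly K[3]}.
Local Notation f := (arr_poly l).
Hypothesis hl : line_arrangement l.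
Hypothesis hr : is_mdr f r.
Hypothesis r_ge1 : (1 <= r)%N.
Variable rho : AR f.
Hypothesis rho_deg : AR_gr r%:Z rho.
Hypothesis rho_neq0 : rho != 0.
Local Notation psi := (psi hl rho).
Local Notation I := (linear_image psi).
Implicit Types u v : AR f.

Lemma is_mdr_uniq r' : is_mdr f r' -> r' = r.
Proof.
move=> [[u uh u0] H]; have [[v vh v0] H'] := hr.
apply/eqP; rewrite eqn_leq; apply/andP; split; rewrite leqNgt; apply/negP => lt.
  by case/eqP: v0; exact: H vh.
by case/eqP: u0; exact: H' uh.
Qed.

Lemma nearly_free_degree : nearly_free l <-> is_degree I 1.
Proof.
have [e eI eE] := image_degree hl hr r_ge1 rho_deg rho_neq0.
split=> [[r' /is_mdr_uniq -> tE]|[N HN]].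
  have e1 : e = 1%N by apply: (can_inj (@absz_nat)) => //; move: eE; rewrite tE; lia.
  by move: eI; rewrite e1.
exists r => //; have [N' HN'] := eI.
have e1 : e = 1%N by rewrite -(HN' _ (leq_maxl N' N)) HN // leq_maxr.
by move: eE; rewrite e1; lia.
Qed.

Lemma nearly_free_point : nearly_free l <-> exists P : point K, defines_reduced_point I P.
Proof.
have satI := image_saturated hr r_ge1 rho_deg rho_neq0 (hl := hl).
rewrite nearly_free_degree; split=> [I1|[P IP]].
  exact: degree1_reduced_point (image_homogeneous rho_deg) satI I1.
have [e eI _] := image_degree hl hr r_ge1 rho_deg rho_neq0.
have e1 := reduced_point_degree satI IP eI.
by move: eI; rewrite e1.
Qed.

Lemma point_lines (P : point K) : exists a b, [/\ crossv a b != 0, incident a P & incident b P].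
Proof.
(* The frame is built with [rep P] in the role of the form, so [u] and [v] are independent forms
   vanishing at [P]. *)
have [u [v [x [y [w [[zu zv _] [xu xv _] [yu yv _] _]]]]]] := frame_exists (rep_neq0 P).
have dotC (p q : 'rV[K]_3) : dot p q = dot q p by rewrite !dotE; ring.
exists u, v; split; [|by rewrite /incident dotC zu|by rewrite /incident dotC zv].
apply/eqP => uv0; have u0 : u != 0.
  by apply/eqP => u0; move: xu; rewrite u0 dotE !mxE !mulr0 !addr0 => /esym/eqP; rewrite oner_eq0.
have /eqP := crossv0_dot u0 uv0 (etrans (dotC u y) yu).
by rewrite dotC yv oner_eq0.
Qed.

(** A point is the only common zero of two independent linear forms of its ideal. *)
Lemma reduced_point_uniq (J J' : {pred S}) (P P' : point K) : J =i J' ->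
  defines_reduced_point J P -> defines_reduced_point J' P' -> P' = P.
Proof.
move=> JJ' JP JP'; have [a [b [ab aP bP]]] := point_lines P.
have on c : incident c P -> incident c P'.
  move=> /vanishes_atE/JP[N sN]; apply/vanishes_atE/JP'; exists N => m mN.
  by rewrite -JJ'; exact: sN.
apply/eqP; have := incident_meet P ab; rewrite aP bP => /esym/eqP ->.
by rewrite -incident_meet // !on.
Qed.

Variables (rho' : AR f) (I' : submodClosed S^o) (phi' : {linear S^o -> AR f})
  (psi' : {linear AR f -> ideal_mod I'}).
Hypothesis rho'_deg : AR_gr r%:Z rho'.
Hypothesis rho'_neq0 : rho' != 0.
Hypothesis seq' : syzygy_sequence d r rho' phi' psi'.
Hypothesis rd : (2 * r < d)%N.
Hypothesis nf : nearly_free l.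

Let satI : saturated I := image_saturated hr r_ge1 rho_deg rho_neq0 (hl := hl).

Let psiK u : psi u = 0 <-> exists p : S^o, p *: rho = u.
Proof. exact: (psi_ker hl hr r_ge1 rho_deg rho_neq0). Qed.

(** [psi rho'] has degree 2r + 1 - d <= 0, so it is a constant, and it vanishes because it lies in
    the ideal of a point. Then [rho'] is a multiple of [rho], and the degrees agree. *)
Lemma other_syzygy : exists2 c : K, c != 0 & rho' = (c%:MP : S) *: rho.
Proof.
have [P IP] := nearly_free_point.1 nf.
have psi0 : psi rho' = 0.
  have := psi_homog hl rho_deg rho'_deg; case: ifP => [dr|_ /eqP //].
  rewrite (_ : r + r.+1 - d = 0)%N; last by lia.
  move=> h0; have hC : psi rho' = ((psi rho')@_0%MM)%:MP.
    apply: msize1_polyC; have [->|p0] := eqVneq (psi rho') 0; first by rewrite msize0.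
    by rewrite -mlead_deg // ltnS; have /dhomogP/(_ _ (mlead_supp p0)) /= := h0 => ->.
  have : psi rho' \in I by exact: psi_in_image.
  move/(saturatedP _ satI)/IP/(vanishes_at_rep _ h0); rewrite hC mevalC => ->.
  by rewrite mpolyC0.
have [p pE] := (psiK rho').1 psi0; have [i ri] := AR_neq0 rho_neq0.
have ph : p \is 0.-homog.
  have := homog_cofactor ri (rho_homog rho_deg i) (q := p) (m := r).
  by rewrite leqnn subnn; apply; rewrite -coordZ pE; exact: rho'_deg.
have pC : p = (p@_0%MM)%:MP.
  apply: msize1_polyC; have [->|p0] := eqVneq p 0; first by rewrite msize0.
  by rewrite -mlead_deg // ltnS; have /dhomogP/(_ _ (mlead_supp p0)) /= := ph => ->.
exists (p@_0%MM); last by rewrite -pC pE.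
by apply: contraNneq rho'_neq0 => p0; rewrite -pE pC p0 mpolyC0 scale0r.
Qed.

Lemma other_injection : exists2 c : K, c != 0 &
  forall p, phi' p = (c%:MP : S) *: scale_rho rho p.
Proof.
have [c c0 cE] := other_syzygy; exists c => // p.
have -> : p = p *: (1 : S^o) by rewrite /GRing.scale /= mulr1.
rewrite linearZZ seq'.1 cE /scale_rho /= /scale_rho_fun !scalerA /GRing.scale /= mulr1.
by rewrite mulrC.
Qed.

Let ker_psi' u : psi' u = 0 <-> psi u = 0.
Proof.
have [c c0 cE] := other_injection; have [_ [_ _ _ ex _]] := seq'.
rewrite ex psiK; split=> -[p pE].
  by exists (c%:MP * p); rewrite -pE cE scalerA.
exists ((c^-1)%:MP * p); rewrite cE /scale_rho /= /scale_rho_fun scalerA mulrA.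
by rewrite -mpolyCM divff // mul1r.
Qed.

(* Multiplication by [val (psi' u) / psi u] does not depend on [u]; it is a
   constant since [I] contains two independent linear forms. *)
Lemma other_projection : exists2 c : K, c != 0 &
  forall u, val (psi' u) = c *: (psi u : S).
Proof.
have [P IP] := nearly_free_point.1 nf; have [a [b [ab aP bP]]] := point_lines P.
have linI e : incident e P -> exists u, psi u = lin e.
  by move=> /vanishes_atE/IP/(saturatedP _ satI)/linear_imageP.
have [u0' u0'E] := linI _ aP; have [u1 u1E] := linI _ bP.
have a0 : a != 0 := crossv_neq0l ab.
pose u0 := comp hl (d - r) u0'.
have u0E : psi u0 = lin a.
  have E : (1 + d = r + (d - r).+1)%N by lia.
  by rewrite (psi_comp hl rho_deg u0' E) u0'E pihomog_dE // lin_homog.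
(* psi(v) u - psi(u) v lies in the common kernel of [psi] and [psi']. *)
have swap u v : (psi v : S) * val (psi' u) = (psi u : S) * val (psi' v).
  have : psi' (psi v *: u - psi u *: v) = 0.
    apply/ker_psi'; rewrite linearB !psi_scale.
    by apply/eqP; rewrite subr_eq0 mulrC.
  rewrite linearB !(linearZZ psi') => /(congr1 val) /= E.
  by apply/eqP; rewrite -subr_eq0; apply/eqP.
(* By [swap], [lin a] divides [lin b] times psi'(u0), and [lin a] is a prime not dividing
   [lin b]. *)
have [g gE] : divides (lin a) (val (psi' u0)).
  have [_ _ pp] := lin_prime a0; have [||//] := pp (lin b) (val (psi' u0)).
    by exists (val (psi' u1)); rewrite -u1E swap u0E mulrC.
  by move/(lin_not_divides ab).
(* [u0] has degree d - r, which the shift turns into 1; so psi'(u0) is linear and its cofactor [g]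
   is a constant. *)
have gh : g \is 0.-homog.
  have [_ [_ gr' _ _ _]] := seq'.
  have := gr' (d - r)%N%:Z u0 (comp_homog _ _ _); rewrite /gshift /ideal_gr.
  rewrite (_ : r%:Z - d%:Z + 1 + (d - r)%N%:Z = 1%N%:Z); last by lia.
  by rewrite /S_gr gE => /(homog_cofactor (lin_neq0 a0) (lin_homog a)).
have gC : g = (g@_0%MM)%:MP.
  apply: msize1_polyC; have [->|g0] := eqVneq g 0; first by rewrite msize0.
  by rewrite -mlead_deg // ltnS; have /dhomogP/(_ _ (mlead_supp g0)) /= := gh => ->.
have psi'E u : val (psi' u) = g@_0%MM *: (psi u : S).
  apply: (mulfI (lin_neq0 a0)); have := swap u u0; rewrite u0E gE => ->.
  by rewrite -mul_mpolyC -gC mulrC [g * lin a]mulrC -mulrA.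
exists (g@_0%MM) => //; apply/eqP => g0.
have : psi u0 = 0 by apply/ker_psi'; apply: val_inj; rewrite psi'E g0 scale0r.
by rewrite u0E => /eqP; rewrite (negPf (lin_neq0 a0)).
Qed.

Lemma other_ideal : I' =i I.
Proof.
have [c c0 cE] := other_projection; have [_ [_ _ _ _ surj]] := seq'.
move=> h; apply/idP/linear_imageP => [hI|[u <-]].
  have [u uE] := surj (IdealMod hI); exists (c *: 1 *: u).
  rewrite psi_scale -scalerAl mul1r -cE uE.
  by [].
have := valP (psi' u); rewrite cE => /(ideal_mulZ c^-1).
by rewrite scalerA mulVf // scale1r.
Qed.

End Uniqueness.

Theorem proposition2p1 (R : realType) (d r : nat) (l : 'I_d -> {mpoly R[i][3]})
  (hA : line_arrangement l)
  (hr : is_mdr (arr_poly l) r)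
  (r_ge1 : (1 <= r)%N)
  (rho1 : AR (arr_poly l))
  (rho1_deg : AR_gr r%:Z rho1)
  (rho1_neq0 : rho1 != 0) :
  exists (I : submodClosed {mpoly R[i][3]}^o)
         (phi : {linear {mpoly R[i][3]}^o -> AR (arr_poly l)})
         (psi : {linear AR (arr_poly l) -> ideal_mod I}),
    [/\ homogeneous I,
        syzygy_sequence d r rho1 phi psi,
        (* (1) *)
        [/\ saturated I,
            proj_dim_le I 0 &
            exists2 e : nat, is_degree I e &
              e%:Z = (d%:Z - 1) ^+ 2 - r%:Z * (d%:Z - r%:Z - 1)
                     - (tjurina l)%:Z],
        (* (2) *)
        free_arrangement l <-> I =i predT &
        (* (3) *)
        (nearly_free l <-> exists P : point R[i], defines_reduced_point I P) /\
        (nearly_free l -> (2 * r < d)%N ->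
         forall (rho1' : AR (arr_poly l))
                (I' : submodClosed {mpoly R[i][3]}^o)
                (phi' : {linear {mpoly R[i][3]}^o -> AR (arr_poly l)})
                (psi' : {linear AR (arr_poly l) -> ideal_mod I'}),
           AR_gr r%:Z rho1' -> rho1' != 0 ->
           homogeneous I' -> syzygy_sequence d r rho1' phi' psi' ->
           [/\ I' =i I,
               exists2 c : R[i], c != 0 &
                 forall p, phi' p = (c%:MP : {mpoly R[i][3]}) *: phi p,
               exists2 c : R[i], c != 0 &
                 forall u, val (psi' u) = c *: (val (psi u) : {mpoly R[i][3]}) &
               forall P P' : point R[i],
                 defines_reduced_point I P -> defines_reduced_point I' P' ->
                 P' = P])].
Proof.
exists (image_ideal hA rho1), (scale_rho rho1), (psi_image hA rho1).
have deg := image_degree hA hr r_ge1 rho1_deg rho1_neq0.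
split.
- exact (image_homogeneous (hl := hA) rho1_deg).
- exact (psi_image_sequence hA hr r_ge1 rho1_deg rho1_neq0).
- split.
  + exact (image_saturated (hl := hA) hr r_ge1 rho1_deg rho1_neq0).
  + by have [e eI _] := deg; exact (proj_dim0_of_degree eI).
  + exact deg.
- exact (free_iff_image_full hA hr r_ge1 rho1_deg rho1_neq0).
split; first exact (nearly_free_point hA hr r_ge1 rho1_deg rho1_neq0).
move=> nf rd rho1' I' phi' psi' rho1'_deg rho1'_neq0 _ seq'.
have other := other_ideal hA hr r_ge1 rho1_deg rho1_neq0 rho1'_deg rho1'_neq0 seq' rd nf.
split.
- exact other.
- exact (other_injection hA hr r_ge1 rho1_deg rho1_neq0 rho1'_deg rho1'_neq0 seq' rd nf).
- exact (other_projection hA hr r_ge1 rho1_deg rho1_neq0 rho1'_deg rho1'_neq0 seq' rd nf).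
- move=> P P' IP IP'.
  exact (reduced_point_uniq (fun p => esym (other p)) IP IP').
Qed.
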